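(* Let $d\ge 1$, $k\in\{0,1,\ldots,d\}$, and consider a great hypersphere tessellation of $\mathbb{S}^d$ with non-degenerate directional distribution $\kappa$ and intensity $n\ge d-k$. Let $h:\mathbb{K}_s(d)\to\mathbb{R}$ be a non-negative measurable function. Then $$\mathbf{E}\,h(W_{n,d}^{(k)})=\frac{1}{\omega_{k+1}}\int_{\mathbb{G}_s(d,k)}\int_S \mathbf{E}\,h\big(Z_v(T_{n-d+k,d})\cap S\big)\,\mathcal{H}^k(\mathrm{d}v)\,\kappa_k(\mathrm{d}S),$$ where $T_{n-d+k,d}$ is a great hypersphere tessellation of $\mathbb{S}^d$ of intensity $n-d+k$ with the same directional distribution $\kappa$, and $Z_v(T_{n-d+k,d})$ is the almost surely unique cell of $T_{n-d+k,d}$ containing $v$ in its relative interior.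
   Context: $\mathbb{S}^d$ is the unit sphere of $\mathbb{R}^{d+1}$. For $k\in\{0,\ldots,d\}$, $\mathbb{G}_s(d,k)$ is the set of $k$-dimensional great subspheres of $\mathbb{S}^d$ (intersections of $\mathbb{S}^d$ with $(k+1)$-dimensional linear subspaces); elements of $\mathbb{G}_s(d,d-1)$ are great hyperspheres. $\mathcal{H}^k$ is $k$-dimensional Hausdorff measure and $\omega_{k+1}=\mathcal{H}^k(S)=2\pi^{(k+1)/2}/\Gamma(\frac{k+1}{2})$ for $S\in\mathbb{G}_s(d,k)$. $\mathbb{K}_s(d)$ is the set of all $C\cap\mathbb{S}^d$ with $C\subset\mathbb{R}^{d+1}$ a closed convex cone different from $\{0\}$, with the Borel $\sigma$-field of the spherical Hausdorff distance. A spherical polytope is $P=C\cap\mathbb{S}^d$ with $C\ne\{0\}$ a polyhedral cone; its $\ell$-dimensional faces are the intersections of $\mathbb{S}^d$ with the $(\ell+1)$-dimensional faces of $C$; $\mathcal{F}_\ell(P)$ is the set of these. Tessellation: let $\kappa^\circ$ be an even Borel probability measure on $\mathbb{S}^d$ with $\kappa^\circ(S)=0$ for every $S\in\mathbb{G}_s(d,d-1)$, and let $\kappa$ be its image under $u\mapsto u^\perp\cap\mathbb{S}^d$; such a $\kappa$ is what is meant here by a non-degenerate directional distribution. For $n\ge1$ let $S_1,\ldots,S_n$ be independent random great hyperspheres with distribution $\kappa$. The great hypersphere tessellation $T_{n,d}=T_d(S_1,\ldots,S_n)$ of intensity $n$ and directional distribution $\kappa$ is the random finite collection of spherical polytopes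 (cells) that are the closures of the connected components of $\mathbb{S}^d\setminus(S_1\cup\cdots\cup S_n)$; $T_{0,d}=\{\mathbb{S}^d\}$. Put $\mathcal{F}_k(T_{n,d})=\bigcup_{P\in T_{n,d}}\mathcal{F}_k(P)$ and ${\rm skel}_k(T_{n,d})=\bigcup_{F\in\mathcal{F}_k(T_{n,d})}F$. Weighted typical spherical $k$-face: $W_{n,d}^{(k)}$ is the almost surely unique $F\in\mathcal{F}_k(T_{n,d})$ containing in its relative interior a random point $v$ which, given $T_{n,d}$, is distributed on ${\rm skel}_k(T_{n,d})$ according to normalized $\mathcal{H}^k$. For $k\le d-1$, $\kappa_k$ is the distribution of $S_1\cap\cdots\cap S_{d-k}$ where $S_1,\ldots,S_{d-k}$ are independent with distribution $\kappa$ (it is a probability measure on $\mathbb{G}_s(d,k)$); $\kappa_d$ is the unit point mass at $\mathbb{S}^d$. *)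

(* Defs.v *)
From HB Require Import structures.
From mathcomp Require Import all_boot all_order all_algebra.
From mathcomp Require Import all_classical all_reals all_analysis.

Set Implicit Arguments.
Unset Strict Implicit.
Unset Printing Implicit Defensive.

Import Order.TTheory GRing.Theory Num.Theory.
Import numFieldNormedType.Exports.

Local Open Scope classical_set_scope.
Local Open Scope ring_scope.

(** * Euclidean geometry of [R^(d+1)]

    The norm that the library puts on ['rV[R]_d.+1] is the sup norm; it has the
    right topology, but metric notions have to go through [eucl_dist]. *)
Section euclidean.
Context {R : realType} {d : nat}.
Local Notation E := 'rV[R]_d.+1.

Definition dot (x y : E) : R := \sum_i x 0 i * y 0 i.

Definition eucl_dist (x y : E) : R := Num.sqrt (dot (x - y) (x - y)).

Definition sphere : set E := [set x | dot x x = 1].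

Definition lin_hull (A : set E) : set E :=
  [set x | forall L : {vspace E}, A `<=` [set` L] -> x \in L].

Definition has_lin_dim (A : set E) (m : nat) : Prop :=
  exists2 L : {vspace E}, lin_hull A = [set` L] & (\dim L = m)%N.

Definition pos_hull (A : set E) : set E :=
  [set z | exists2 x, A x & exists2 a : R, 0 <= a & z = a *: x].

Definition convex_cone (C : set E) : Prop :=
  C 0 /\ forall x y (a b : R), C x -> C y -> 0 <= a -> 0 <= b ->
    C (a *: x + b *: y).

(* [G] is a (possibly empty or improper) face of the convex set [C]. *)
Definition is_face (C G : set E) : Prop :=
  [/\ G `<=` C,
      forall x y (t : R), G x -> G y -> 0 <= t <= 1 ->
        G (t *: x + (1 - t) *: y) &
      forall x y (t : R), C x -> C y -> 0 < t < 1 ->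
        G (t *: x + (1 - t) *: y) -> G x /\ G y].

End euclidean.

(** * Spherical convex geometry *)
Section spherical.
Context (R : realType) (d : nat).
Local Notation E := 'rV[R]_d.+1.

Definition great_subsphere (k : nat) : set (set E) :=
  [set S | exists2 L : {vspace E}, (\dim L = k.+1)%N & S = sphere `&` [set` L]].

Definition perp_sphere (u : E) : set E := sphere `&` [set x | dot u x = 0].

(* The family K_s(d). *)
Definition convex_body : set (set E) :=
  [set K | exists C : set E,
     [/\ closed C, convex_cone C, C <> [set 0] & K = C `&` sphere]].

Definition geodesic_dist (x y : E) : R := acos (dot x y).

Definition hausdorff_excess (K L : set E) : R :=
  sup [set inf [set geodesic_dist x y | y in L] | x in K].

Definition hausdorff_dist (K L : set E) : R :=
  Num.max (hausdorff_excess K L) (hausdorff_excess L K).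

Definition hausdorff_open : set (set (set E)) :=
  [set U | U `<=` convex_body /\
     forall K, U K -> exists2 e : R, 0 < e &
       forall L, convex_body L -> hausdorff_dist K L < e -> U L].

(* The relative interior of [F] in the smallest great subsphere containing it. *)
Definition rel_int (F : set E) : set E :=
  [set x | F x /\ \forall y \near x, (sphere `&` lin_hull F) y -> F y].

(* For [P = C `&` sphere] with [C] a closed convex cone other than [[set 0]]
   and [P] nonempty, one has [C = pos_hull P]. *)
Definition faces (l : nat) (P : set E) : set (set E) :=
  [set F | exists G : set E, [/\ is_face (pos_hull P) G, has_lin_dim G l.+1
                               & F = sphere `&` G]].

Definition tessellation (n : nat) (S : 'I_n -> set E) : set (set E) :=
  let U := sphere `\` \bigcup_i S i in
  [set closure (connected_component U x) | x in U].

Definition tess_faces (k : nat) (T : set (set E)) : set (set E) :=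
  \bigcup_(P in T) faces k P.

Definition skeleton (k : nat) (T : set (set E)) : set E :=
  \bigcup_(F in tess_faces k T) F.

(* [pick_at X x] is the member of [X] having [x] in its relative interior; the
   value [set0] is only used when there is no such member. *)
Definition pick_at (X : set (set E)) (x : E) : set E :=
  xget set0 [set F | X F /\ rel_int F x].

End spherical.
Arguments great_subsphere {R d}.
Arguments convex_body {R d}.

(** * Borel sets and Hausdorff measure *)
Section hausdorff_measure.
Context (R : realType) (d : nat).
Local Notation E := 'rV[R]_d.+1.

Definition borel_space := g_sigma_algebraType (@open E).

(* Volume of the unit ball of [R^k], i.e. pi^(k/2) / Gamma(k/2 + 1). *)
Fixpoint ball_volume (k : nat) : R :=
  match k with
  | 0%N => 1
  | 1%N => 2
  | (k'.+2)%N => 2 * pi / k%:R * ball_volume k'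
  end.

Definition diam (U : set E) : R :=
  sup [set r | exists x y, [/\ U x, U y & r = eucl_dist x y]].

(* The test on [set0] matters for [k = 0], where the nonempty sets have
   gauge 1. *)
Definition hausdorff_gauge (k : nat) (U : set E) : \bar R :=
  if U == set0 then 0%E else (ball_volume k * (diam U / 2) ^+ k)%:E.

Definition hausdorff_pre (k : nat) (e : R) (A : set E) : \bar R :=
  ereal_inf [set (\sum_(0 <= i <oo) hausdorff_gauge k (U i))%E |
    U in [set U : nat -> set E | A `<=` \bigcup_i U i /\
      forall i x y, U i x -> U i y -> eucl_dist x y <= e]].

Definition hausdorff (k : nat) (A : set borel_space) : \bar R :=
  ereal_sup [set hausdorff_pre k e A | e in [set e : R | 0 < e]].

(* omega_(k+1), the value of H^k at a k-dimensional great subsphere, here the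
   one on which all coordinates of index greater than [k] vanish. *)
Definition omega (k : nat) : R :=
  fine (hausdorff k
    (sphere `&` [set x | forall i : 'I_d.+1, (k < i)%N -> x 0 i = 0])).

End hausdorff_measure.

(** * Random tessellations *)
Section random.
Context (R : realType) (d : nat).
Local Notation E := 'rV[R]_d.+1.
Local Notation borel_space := (borel_space R d).

(* Sets of points with the Borel sigma-field of the spherical Hausdorff
   distance on [convex_body]. The elements of [set E] that are not in
   [convex_body] form one additional atom. *)
Definition body_space := g_sigma_algebraType (@hausdorff_open R d).

(* Collections of bodies with the sigma-field usual for point processes,
   generated by the numbers of members in the Borel subsets of
   [convex_body]. *)
Definition collection_space := g_sigma_algebraType
  [set X : set (set body_space) | exists (B : set body_space) (m : nat),
     [/\ measurable B, B `<=` convex_body &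
         X = [set T | (T `&` B #= `I_m)%card]]].

Definition nondegenerate_direction (mu : probability borel_space R) : Prop :=
  [/\ mu sphere = 1%E,
      forall A : set borel_space, measurable A ->
        mu [set u : E | A (- u)] = mu A &
      forall S : set E, great_subsphere d.-1 S -> mu S = 0%E].

Definition hypersphere_law (mu : probability borel_space R) :
    set body_space -> \bar R :=
  pushforward mu (@perp_sphere R d : borel_space -> body_space).

Section on_a_probability_space.
Context (dO : measure_display) (Omega : measurableType dO).
Context (P : probability Omega R).

Definition iid_hyperspheres (mu : probability borel_space R) (m : nat)
    (S : 'I_m -> {RV P >-> body_space}) : Prop :=
  [/\ forall i w, great_subsphere d.-1 (S i w),
      forall i (A : set body_space), measurable A ->
        distribution P (S i) A = hypersphere_law mu A &
      forall A : 'I_m -> set body_space, (forall i, measurable (A i)) ->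
        P (\bigcap_i (S i @^-1` A i)) =
        (\prod_i fine (P (S i @^-1` A i)))%:E].

Definition random_tessellation (m : nat) (S : 'I_m -> {RV P >-> body_space})
    (w : Omega) : collection_space :=
  tessellation (fun i => S i w).

(* kappa_k; the empty intersection (case [m = 0]) is the whole sphere. *)
Definition intersection_law (m : nat) (S : 'I_m -> {RV P >-> body_space}) :
    set body_space -> \bar R :=
  pushforward P ((fun w => sphere `&` \bigcap_i S i w) : Omega -> body_space).

(* Given [T], the point [v] has law H^k, normalized, on the [k]-skeleton. *)
Definition uniform_on_skeleton (k : nat) (T : Omega -> collection_space)
    (v : {RV P >-> borel_space}) : Prop :=
  forall (X : set collection_space) (B : set borel_space),
    measurable X -> measurable B ->
    P (T @^-1` X `&` v @^-1` B) =
    (\int[P]_(w in T @^-1` X)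
       (hausdorff k (skeleton k (T w) `&` B) *
        (fine (hausdorff k (skeleton k (T w))))^-1%:E))%E.

Definition weighted_face (k : nat) (T : Omega -> collection_space)
    (v : {RV P >-> borel_space}) (w : Omega) : body_space :=
  pick_at (tess_faces k (T w)) (v w).

End on_a_probability_space.
End random.

(* Main.v *)
(** With [J] running over the
    sets of [d - k] indices, the [k]-skeleton is almost surely the union of the
    great subspheres [G_J], the intersections of the [S_i] with [i] in [J], and
    distinct ones overlap in an [H^k]-null set. Hence the law of [(T, v)] is the
    average over [J] of the laws obtained by choosing [v] uniformly on [G_J]. For
    such a [v] the face of [T] around [v] is the section by [G_J] of the cell
    around [v] of the tessellation by the remaining [n - d + k] hyperspheres,
    which is independent of [G_J]; Fubini's theorem does the rest.

    The work lies in measurability. The law of [v] given [T] only determines the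
    joint law on the product of the sigma-field of [T] with the Borel sets, so
    the face around [x] has to be a measurable function of [(T, x)] in this
    sense. *)
Require Import Defs.
From HB Require Import structures.
From mathcomp Require Import all_boot all_order all_algebra.
From mathcomp Require Import all_classical all_reals all_analysis.
From mathcomp Require Import measurable_realfun.
From mathcomp Require Import ring lra zify.

Set Implicit Arguments.
Unset Strict Implicit.
Unset Printing Implicit Defensive.

Import Order.TTheory GRing.Theory Num.Theory.
Import numFieldNormedType.Exports.

Local Open Scope classical_set_scope.
Local Open Scope ring_scope.

(** * Euclidean norm and topology *)

(** The sigma-field of a tessellation knows its cells only through the numbers of cells in Borel
    sets of bodies, without access to the normals. What is used of it is whether some cell hits one
    open set and avoids another. The face around [x] is recovered from this as the intersection of
    all closed cells containing [x]: two cells entered from [x] in opposite directions impose each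
    constraint tight at [x] with both signs. A cell containing [x] is in turn detected by small
    rational balls, because a cell that comes close enough to [x] contains it.

    Hyperspheres are handled through normal vectors, selected measurably by means of support
    functions. Independence is then a statement about boxes, and general position and the null
    overlaps both follow by fixing a point and letting one independent normal vary. The value of
    [omega] is never computed: the existence of a random point with the prescribed law already
    forces it to be positive and finite. *)

Section dot_product.
Context {R : realType} {d : nat}.
Local Notation E := 'rV[R]_d.+1.
Implicit Types (x y z u : E) (a b : R).

(** [eucl_dist x y] unfolds to [enorm (x - y)]; the two are exchanged by conversion throughout. *)
Definition enorm x := Num.sqrt (dot x x).

Lemma dotC x y : dot x y = dot y x.
Proof. by apply: eq_bigr => i _; rewrite mulrC. Qed.

Lemma dotDr u x y : dot u (x + y) = dot u x + dot u y.
Proof. by rewrite -big_split; apply: eq_bigr => i _; rewrite mxE mulrDr. Qed.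

Lemma dotZr u a x : dot u (a *: x) = a * dot u x.
Proof. by rewrite big_distrr; apply: eq_bigr => i _; rewrite mxE /= mulrCA. Qed.

Lemma dotNr u x : dot u (- x) = - dot u x.
Proof. by rewrite -scaleN1r dotZr mulN1r. Qed.

Lemma dotBr u x y : dot u (x - y) = dot u x - dot u y.
Proof. by rewrite dotDr dotNr. Qed.

Lemma dot0r u : dot u 0 = 0.
Proof. by rewrite -(scale0r u) dotZr mul0r. Qed.

Lemma dotDl u x y : dot (x + y) u = dot x u + dot y u.
Proof. by rewrite dotC dotDr !(dotC u). Qed.

Lemma dotZl u a x : dot (a *: x) u = a * dot x u.
Proof. by rewrite dotC dotZr dotC. Qed.

Lemma dotNl u x : dot (- x) u = - dot x u.
Proof. by rewrite dotC dotNr dotC. Qed.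

Lemma dotBl u x y : dot (x - y) u = dot x u - dot y u.
Proof. by rewrite dotDl dotNl. Qed.

Lemma dot0l u : dot 0 u = 0.
Proof. by rewrite dotC dot0r. Qed.

Lemma dot_sumr (I : Type) (r : seq I) (Q : pred I) u (F : I -> E) :
  dot u (\sum_(i <- r | Q i) F i) = \sum_(i <- r | Q i) dot u (F i).
Proof. exact: (big_morph (dot u) (dotDr u) (dot0r u)). Qed.

Lemma dot_ge0 x : 0 <= dot x x.
Proof. by apply: sumr_ge0 => i _; rewrite -expr2 sqr_ge0. Qed.

Lemma dot_eq0 x : (dot x x == 0) = (x == 0).
Proof.
apply/idP/eqP => [|->]; last by rewrite dot0r.
rewrite psumr_eq0; last by move=> i _; rewrite -expr2 sqr_ge0.
move=> /allP H; apply/rowP => i; rewrite mxE.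
by have := H i (mem_index_enum _); rewrite /= mulf_eq0 orbb => /eqP.
Qed.

Lemma dot_gt0 x : (0 < dot x x) = (x != 0).
Proof. by rewrite lt_def dot_eq0 dot_ge0 andbT. Qed.

Lemma enorm_ge0 x : 0 <= enorm x. Proof. exact: sqrtr_ge0. Qed.

Lemma enorm_sqr x : enorm x ^+ 2 = dot x x.
Proof. by rewrite sqr_sqrtr // dot_ge0. Qed.

Lemma enorm0 : enorm 0 = 0. Proof. by rewrite /enorm dot0r sqrtr0. Qed.

Lemma enorm_eq0 x : (enorm x == 0) = (x == 0).
Proof. by rewrite -sqrf_eq0 enorm_sqr dot_eq0. Qed.

Lemma enorm_gt0 x : (0 < enorm x) = (x != 0).
Proof. by rewrite lt_def enorm_eq0 enorm_ge0 andbT. Qed.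

Lemma enormN x : enorm (- x) = enorm x.
Proof. by rewrite /enorm dotNl dotNr opprK. Qed.

Lemma enormB x y : enorm (x - y) = enorm (y - x).
Proof. by rewrite -enormN opprB. Qed.

Lemma enormZ a x : enorm (a *: x) = `|a| * enorm x.
Proof.
by rewrite /enorm dotZl dotZr mulrA -expr2 sqrtrM ?sqr_ge0// sqrtr_sqr.
Qed.

Lemma cauchy_schwarz x y : `|dot x y| <= enorm x * enorm y.
Proof.
have [->|y0] := eqVneq y 0; first by rewrite dot0r enorm0 normr0 mulr0.
rewrite -(@ler_pXn2r _ 2) ?nnegrE ?mulr_ge0 ?enorm_ge0//.
rewrite exprMn !enorm_sqr -normrX ger0_norm ?sqr_ge0//.
have := dot_ge0 (x - (dot x y / dot y y) *: y).
rewrite dotBl !dotBr !dotZl !dotZr (dotC y x).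
have yy : 0 < dot y y by rewrite dot_gt0.
rewrite mulfVK ?gt_eqF// subrr subr0 subr_ge0 -mulrA (mulrC _^-1) mulrA -expr2.
by rewrite ler_pdivrMr.
Qed.

Lemma enormD x y : enorm (x + y) <= enorm x + enorm y.
Proof.
rewrite -(@ler_pXn2r _ 2) ?nnegrE ?addr_ge0 ?enorm_ge0//.
rewrite enorm_sqr dotDl !dotDr (dotC y x) sqrrD !enorm_sqr.
have := le_trans (ler_norm _) (cauchy_schwarz x y); nra.
Qed.

Lemma enorm_triangle y x z : enorm (x - z) <= enorm (x - y) + enorm (y - z).
Proof. by rewrite (le_trans _ (enormD _ _))// addrA subrK. Qed.

Lemma ler_enorm_sub x y : `|enorm x - enorm y| <= enorm (x - y).
Proof.
have H u v : enorm u <= enorm v + enorm (u - v).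
  by rewrite (le_trans _ (enormD _ _))// addrC subrK.
rewrite ler_norml; apply/andP; split; last by rewrite lerBlDl H.
by rewrite lerNl opprB lerBlDl enormB H.
Qed.

Lemma coord_enorm x i : `|x 0 i| <= enorm x.
Proof.
rewrite -(@ler_pXn2r _ 2) ?nnegrE ?enorm_ge0//.
rewrite enorm_sqr -normrX ger0_norm ?sqr_ge0// /dot (bigD1 i)//= -expr2 lerDl.
by apply: sumr_ge0 => j _; rewrite -expr2 sqr_ge0.
Qed.

Lemma enorm_le_sum x : enorm x <= \sum_i `|x 0 i|.
Proof.
rewrite -(@ler_pXn2r _ 2) ?nnegrE ?enorm_ge0 ?sumr_ge0//.
rewrite enorm_sqr expr2 mulr_suml; apply: ler_sum => i _.
rewrite (le_trans (ler_norm _))// normrM ler_wpM2l//.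
by rewrite (bigD1 i)//= lerDl sumr_ge0.
Qed.

Lemma sphereP x : sphere x <-> enorm x = 1.
Proof.
split=> [sx|e1]; first by rewrite /enorm sx sqrtr1.
by rewrite /sphere/= -enorm_sqr e1 expr1n.
Qed.

Lemma sphere_neq0 x : sphere x -> x != 0.
Proof. by rewrite -dot_eq0 => ->; exact: oner_neq0. Qed.

Lemma sphereN x : sphere x -> sphere (- x).
Proof. by rewrite /sphere/= dotNl dotNr opprK. Qed.

Definition unitv x := (enorm x)^-1 *: x.

Lemma unitv_sphere x : x != 0 -> sphere (unitv x).
Proof.
move=> x0; apply/sphereP; rewrite enormZ ger0_norm ?invr_ge0 ?enorm_ge0//.
by rewrite mulVf// enorm_eq0.
Qed.

Lemma unitvK x : x = enorm x *: unitv x.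
Proof.
have [->|x0] := eqVneq x 0; first by rewrite enorm0 scale0r.
by rewrite scalerA divff ?scale1r// enorm_eq0.
Qed.

Lemma unitv_id x : sphere x -> unitv x = x.
Proof. by move=> /sphereP h; rewrite /unitv h invr1 scale1r. Qed.

(** Normalizing moves [y] by [|enorm y - 1|], which is at most its distance to the unit vector [x];
    hence the factor 2. *)
Lemma unitv_near x y : sphere x -> y != 0 ->
  enorm (unitv y - x) <= 2 * enorm (y - x).
Proof.
move=> sx y0; rewrite (le_trans (enorm_triangle y _ _))// mulr2n mulrDl mul1r.
rewrite lerD2r [X in enorm (_ - X)]unitvK -[X in X - _]scale1r -scalerBl enormZ.
have /sphereP-> := unitv_sphere y0; rewrite mulr1.
have /sphereP <- := sx.
by rewrite distrC; exact: ler_enorm_sub.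
Qed.

End dot_product.

(** * Euclidean balls, compactness of the sphere, countable dense families *)

Section topology.
Context {R : realType} {d : nat}.
Local Notation E := 'rV[R]_d.+1.
Implicit Types (x y z u : E) (a b e r : R).

Definition eball x r : set E := [set y | enorm (y - x) < r].

Lemma eball_center x r : 0 < r -> eball x r x.
Proof. by rewrite /eball/= subrr enorm0. Qed.

Lemma continuous_dot2 (T : topologicalType) (f g : T -> E) :
  continuous f -> continuous g -> continuous (fun t => dot (f t) (g t)).
Proof.
move=> cf cg t; rewrite /dot.
apply: cvg_big => [|i _]; first exact: add_continuous.
apply: cvgM.
  exact: (continuous_comp (cf t) (@coord_continuous _ _ _ 0 i (f t))).
exact: (continuous_comp (cg t) (@coord_continuous _ _ _ 0 i (g t))).
Qed.

Lemma continuous_dotr u : continuous (dot u).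
Proof.
apply: (@continuous_dot2 _ (fun=> u) id); first exact: cst_continuous.
by move=> x; exact: cvg_id.
Qed.

Lemma continuous_enorm : continuous (@enorm R d).
Proof.
move=> x.
have cd : {for x, continuous (fun y : E => dot y y)}.
  by apply: (@continuous_dot2 _ id id) => {}x; exact: cvg_id.
exact: (continuous_comp cd (@sqrt_continuous _ _)).
Qed.

Lemma continuous_edist x : continuous (fun y => enorm (y - x)).
Proof.
move=> y.
have cd : {for y, continuous (fun z : E => z - x)}.
  by apply: (@continuousB _ _ _ id (cst x)); [exact: cvg_id|exact: cst_continuous].
exact: (continuous_comp cd (@continuous_enorm _)).
Qed.

Lemma open_eball x r : open (eball x r).
Proof.
have /continuousP H := @continuous_edist x.
exact: (H [set s | s < r] (@open_lt _ r)).
Qed.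

Lemma nbhs_eball x (P : set E) :
  nbhs x P <-> exists2 e, 0 < e & eball x e `<=` P.
Proof.
split=> [/nbhs_ballP[e /= e0 eP]|[e e0 eP]].
  exists e => // y; rewrite /eball/= => yx; apply: eP; split => // i j.
  rewrite ord1 /ball/= distrC (le_lt_trans _ yx)//.
  by have := coord_enorm (y - x) j; rewrite !mxE.
apply: (filterS eP); apply: open_nbhs_nbhs; split; first exact: open_eball.
exact: eball_center.
Qed.

Lemma open_eballP (O : set E) :
  open O <-> forall x, O x -> exists2 e, 0 < e & eball x e `<=` O.
Proof.
split=> [oO x Ox|H]; first by apply/nbhs_eball; exact: open_nbhs_nbhs.
by rewrite openE => x /H /nbhs_eball.
Qed.

Lemma closed_eballP (C : set E) :
  closed C <-> forall y, (forall e, 0 < e -> exists2 x, C x & enorm (x - y) < e)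
                  -> C y.
Proof.
split=> [cC y H|H].
  apply: cC => B /nbhs_eball[e e0 eB].
  by have [x Cx xy] := H e e0; exists x; split => //; exact: eB.
move=> y cy; apply: H => e e0.
have [] := cy (eball y e); first by apply/nbhs_eball; exists e.
by move=> x [Cx xy]; exists x.
Qed.

Lemma closed_sphere : closed (@sphere R d).
Proof.
have cd : continuous (fun y : E => dot y y).
  by apply: (@continuous_dot2 _ id id) => x; exact: cvg_id.
have /continuous_closedP H := cd.
exact: (H [set s | s = 1] (@closed_eq _ 1)).
Qed.

Lemma compact_sphere : compact (@sphere R d).
Proof.
apply: (@subclosed_compact _ _
    [set v : E | forall i, `[(-1)%R, 1%R]%classic (v ord0 i)]).
- exact: closed_sphere.
- apply: (@rV_compact R d.+1 (fun=> `[(-1)%R, 1%R]%classic)) => i.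
  exact: segment_compact.
move=> x /sphereP sx i /=; rewrite in_itv/= -ler_norml -sx; exact: coord_enorm.
Qed.

Lemma measurable_open (O : set (borel_space R d)) : open (O : set E) ->
  measurable O.
Proof. exact: sub_sigma_algebra. Qed.

Lemma measurable_closed (C : set (borel_space R d)) : closed (C : set E) ->
  measurable C.
Proof.
by move=> cC; rewrite -(setCK C); apply: measurableC; apply: measurable_open;
  rewrite openC.
Qed.

Definition ratvec (j : nat) : E :=
  if unpickle j is Some q then map_mx ratr (q : 'rV[rat]_d.+1) else 0.

Lemma ratvec_dense x e : 0 < e -> exists j, enorm (ratvec j - x) < e.
Proof.
(* There are [d.+1] coordinates; dividing by one more makes the sum of their errors strictly smaller
   than [e]. *)
move=> e0; pose h := e / d.+2%:R.
have h0 : 0 < h by rewrite divr_gt0.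
have H i : {q : rat | `|ratr q - x 0 i| < h}.
  apply: cid.
  have [|q] := @rat_in_itvoo R (x 0 i - h) (x 0 i + h); first by lra.
  by rewrite in_itv/= => /andP[? ?]; exists q; rewrite ltr_norml; lra.
exists (pickle (\row_i sval (H i) : 'rV[rat]_d.+1)).
rewrite /ratvec pickleK (le_lt_trans (enorm_le_sum _))//.
apply: (@le_lt_trans _ _ (\sum_(i < d.+1) h)).
  by apply: ler_sum => i _; rewrite !mxE; case: (H i) => q /= /ltW.
rewrite sumr_const card_ord -mulr_natr /h -mulrA gtr_pMr//.
by rewrite ltr_pdivrMl// mulr1 ltr_nat.
Qed.

(** If [ratvec j] is [0], so is [sphvec j]; hence the conjunct [sphere (sphvec j)] in the density
    statement below. *)
Definition sphvec (j : nat) : E := unitv (ratvec j).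

Lemma sphvec_dense x e : sphere x -> 0 < e ->
  exists j, sphere (sphvec j) /\ enorm (sphvec j - x) < e.
Proof.
(* Normalization may double the distance to [x], hence [e / 2]; a distance below [1] ensures that
   the rational vector is not [0]. *)
move=> sx e0; have m0 : 0 < Num.min (e / 2) 1 by rewrite lt_min ltr01 divr_gt0.
have [j] := ratvec_dense x m0.
rewrite lt_min => /andP[j1 j2]; exists j.
have j0 : ratvec j != 0.
  apply: contraTneq j2 => ->; rewrite sub0r enormN.
  by move/sphereP: sx => ->; rewrite ltxx.
split; first exact: unitv_sphere.
by rewrite (le_lt_trans (unitv_near sx j0))//; lra.
Qed.

End topology.

(** [S] dominates every ratio [|r i| / s i], so [(2 + S)^-1] works for all [i] at once. This is the
    tool for moving a point within a face or off hyperplanes without changing the signs that are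
    already strict. *)
Lemma small_perturbation {R : realType} (I : finType) (Q : pred I) (s r : I -> R) :
  (forall i, Q i -> 0 < s i) ->
  exists2 t, 0 < t < 1 &
    forall i t', Q i -> `|t'| <= t -> 0 < s i + t' * r i.
Proof.
move=> s0; pose S := \sum_(i | Q i) `|r i| / s i.
have S0 : 0 <= S by apply: sumr_ge0 => i /s0 si; rewrite divr_ge0// ltW.
have S2 : 0 < 2 + S by rewrite ltr_wpDr.
exists (2 + S)^-1; first by rewrite invr_gt0 S2 invf_lt1//=; lra.
move=> i t' Qi tt; have si := s0 i Qi.
have rS : `|r i| / s i <= S.
  rewrite /S (bigD1 i)//= lerDl; apply: sumr_ge0 => j /andP[/s0 sj _].
  by rewrite divr_ge0// ltW.
have rs : `|r i| <= S * s i by rewrite -ler_pdivrMr.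
suff : `|t' * r i| < s i by rewrite ltr_norml => /andP[? _]; lra.
rewrite normrM (le_lt_trans (ler_wpM2r _ tt))//.
by rewrite ltr_pdivrMl// (le_lt_trans rs)// ltr_pM2r//; lra.
Qed.

(** * Hyperplane arrangements and their faces *)

Section linear.
Context {R : realType} {d : nat}.
Local Notation E := 'rV[R]_d.+1.
Implicit Types (x y z u : E) (L : {vspace E}).

Definition dotf u (y : E) : R^o := dot u y.

Let dotf_linear u : linear (dotf u).
Proof. by move=> a x y; rewrite /dotf dotDr dotZr. Qed.
HB.instance Definition _ u :=
  GRing.isLinear.Build R E R^o _ (dotf u) (dotf_linear u).

Definition orthv u : {vspace E} := lker (linfun (dotf u)).

Lemma mem_orthv u y : (y \in orthv u) = (dot u y == 0).
Proof. by rewrite memv_ker lfunE. Qed.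

Lemma dim_capv_orthv L u :
  (\dim L <= (\dim (L :&: orthv u)).+1)%N /\
  ((exists2 y, y \in L & dot u y != 0) ->
    \dim L = (\dim (L :&: orthv u)).+1).
Proof.
have H := limg_ker_dim (linfun (dotf u)) L.
have h1 : (\dim (linfun (dotf u) @: L) <= 1)%N.
  by rewrite (leq_trans (dimvS (subvf _)))// dimvf.
split; first by rewrite -[X in (X <= _)%N]H -[X in (_ <= X)%N]addn1 leq_add2l.
move=> [y yL uy]; rewrite -[LHS]H -[RHS]addn1; congr addn.
apply/eqP; rewrite eqn_leq h1/= lt0n dimv_eq0; apply: contra uy => /eqP e0.
have := memv_img (linfun (dotf u)) yL.
by rewrite e0 memv0 lfunE.
Qed.

(** A subspace of maximal dimension inside [A] exhausts [A], since any further vector of [A] could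
    be adjoined to it. *)
Lemma vspace_of_set (A : set E) :
  A 0 -> (forall a x y, A x -> A y -> A (a *: x + y)) ->
  exists L : {vspace E}, A = [set` L].
Proof.
move=> A0 AD.
pose Q m := `[< exists2 L : {vspace E}, [set` L] `<=` A & \dim L = m >].
have exQ : exists m, Q m.
  exists 0%N; apply/asboolP; exists 0%VS; last by rewrite dimv0.
  by move=> x /=; rewrite memv0 => /eqP ->.
have ubQ m : Q m -> (m <= \dim {:E})%N.
  by move=> /asboolP[L _ <-]; rewrite dimvS// subvf.
case: (ex_maxnP exQ ubQ) => m /asboolP[L LA dL] max.
exists L; apply/seteqP; split => // x Ax /=.
apply/negPn/negP => xL.
have : Q (\dim (L + <[x]>)).
  apply/asboolP; exists (L + <[x]>)%VS => //.
  move=> _ /memv_addP[v vL [w /vlineP[a ->] ->]].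
  by rewrite addrC; apply: AD => //; exact: LA.
move=> /max; rewrite -dL leqNgt => /negP; apply.
rewrite ltnNge; apply: contra xL => le.
have e := dimv_leqif_eq (addvSl L <[x]>).
have /eqP eL : L == (L + <[x]>)%VS by rewrite -e eqn_leq le dimvS// addvSl.
by rewrite eL memvE addvSr.
Qed.

Lemma lin_hull_sub (A : set E) : A `<=` lin_hull A.
Proof. by move=> x Ax L /(_ _ Ax). Qed.

Lemma lin_hull_pos_hull (A : set E) : lin_hull (pos_hull A) = lin_hull A.
Proof.
apply/seteqP; split=> x H L AL; apply: H => y.
  by move=> [z /AL zL [a _ ->]]; exact: memvZ.
by move=> Ay; apply: AL; exists y => //; exists 1 => //; rewrite scale1r.
Qed.

Lemma lin_hull_vspace (A : set E) L : A `<=` [set` L] ->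
  (forall L', A `<=` [set` L'] -> (L <= L')%VS) -> lin_hull A = [set` L].
Proof.
move=> AL H; apply/seteqP; split=> [x /(_ L AL)//|x xL L' /H /subvP].
exact.
Qed.

End linear.

Lemma fset_ind (I : finType) (Q : {set I} -> Prop) : Q finset.set0 ->
  (forall j (J : {set I}), j \notin J -> Q J -> Q (j |: J)%SET) -> forall J, Q J.
Proof.
move=> Q0 QS J; have [m] := ubnP #|J|; elim: m J => // m IH J Jm.
have [->//|[j jJ]] := finset.set_0Vmem J.
rewrite -(finset.setD1K jJ); apply: QS; first by rewrite finset.setD11.
by apply: IH; move: Jm; rewrite (finset.cardsD1 j) jJ.
Qed.

Section arrangement.
Context {R : realType} {d n : nat}.
Local Notation E := 'rV[R]_d.+1.
Implicit Types (u : 'I_n -> E) (x y z : E) (J : {set 'I_n}).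

(* [face_at u x] is the smallest face containing [x] of the arrangement of the
   hyperplanes orthogonal to the [u i]; it is a cell when [gen u x]. *)
Definition side u x y i :=
  if dot (u i) x == 0 then dot (u i) y == 0
  else 0 <= dot (u i) x * dot (u i) y.

Definition cone_at u x : set E := [set y | forall i, side u x y i].

Definition face_at u x : set E := sphere `&` cone_at u x.

Definition gen u : set E := [set x | sphere x /\ forall i, dot (u i) x != 0].

Definition zeros u x : {set 'I_n} := finset (fun i => dot (u i) x == 0).

Definition perpv u J : {vspace E} := (\bigcap_(i in J) orthv (u i))%VS.

Definition great u J : set E := sphere `&` [set` perpv u J].

(** Dual form of: any [d.+1] or fewer of the normals are linearly independent. *)
Definition gen_position u :=
  forall J, (#|J| <= d.+1)%N -> \dim (perpv u J) = (d.+1 - #|J|)%N.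

Lemma mem_perpv u J y :
  reflect (forall i, i \in J -> dot (u i) y = 0) (y \in perpv u J).
Proof.
rewrite memvE; apply: (iffP subv_bigcapP) => H i iJ.
  by apply/eqP; rewrite -mem_orthv memvE H.
by rewrite -memvE mem_orthv H.
Qed.

Lemma perpvU1 u J j : perpv u (j |: J)%SET = (perpv u J :&: orthv (u j))%VS.
Proof.
apply/eqP; rewrite eqEsubv; apply/andP; split; apply/subvP => y.
  move/mem_perpv => H; rewrite memv_cap mem_orthv H ?setU11// eqxx andbT.
  by apply/mem_perpv => i iJ; apply: H; rewrite finset.setU1r.
rewrite memv_cap mem_orthv => /andP[/mem_perpv H /eqP uj].
by apply/mem_perpv => i /finset.setU1P[->//|]; exact: H.
Qed.

Lemma perpv0 u : perpv u finset.set0 = fullv.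
Proof. by rewrite /perpv big_set0. Qed.

Lemma dim_fullvE : \dim {:E} = d.+1.
Proof. by rewrite dimvf /dim/= mul1n. Qed.

Lemma dim_perpv_ge u J : (d.+1 <= \dim (perpv u J) + #|J|)%N.
Proof.
elim/fset_ind: J => [|j J jJ IH]; first by rewrite perpv0 dim_fullvE leq_addr.
rewrite perpvU1 cardsU1 jJ.
have [H _] := dim_capv_orthv (perpv u J) (u j).
by rewrite addnCA addnA (leq_trans IH)// leq_add2r add1n.
Qed.

Lemma side_closed u x y (z : E) (a b : R) i : side u x y i -> side u x z i ->
  0 <= a -> 0 <= b -> side u x (a *: y + b *: z) i.
Proof.
rewrite /side dotDr !dotZr; case: ifP => _; first by
  move=> /eqP-> /eqP->; rewrite !mulr0 addr0.
move=> H1 H2 a0 b0; rewrite mulrDr (mulrCA _ a) (mulrCA _ b).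
by rewrite addr_ge0// mulr_ge0.
Qed.

Lemma side_refl u x i : side u x x i.
Proof. by rewrite /side; case: ifP => // _; rewrite -expr2 sqr_ge0. Qed.

Lemma cone_atZ u x y (a : R) : 0 <= a -> cone_at u x y -> cone_at u x (a *: y).
Proof.
move=> a0 Cy i; have := side_closed (Cy i) (Cy i) a0 (lexx 0).
by rewrite scale0r addr0.
Qed.

Lemma convex_cone_at u x : convex_cone (cone_at u x).
Proof.
split; first by move=> i; rewrite /side dot0r mulr0 eqxx lexx if_same.
by move=> y z a b Cy Cz a0 b0 i; exact: side_closed.
Qed.

Lemma closed_side u x i : closed [set y | side u x y i].
Proof.
have H := @continuous_dotr R d (u i).
have [ux|ux] := eqVneq (dot (u i) x) 0.
  rewrite (_ : [set _ | _] = dot (u i) @^-1` [set s | s = 0]); last first.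
    by apply/seteqP; split => y; rewrite /side/= ux eqxx => /eqP.
  by have /continuous_closedP H' := H; exact: (H' [set s | s = 0] (@closed_eq _ 0)).
rewrite (_ : [set _ | _] = (fun y => dot (u i) x * dot (u i) y) @^-1`
    [set s | 0 <= s]); last first.
  by apply/seteqP; split => y; rewrite /side/= (negbTE ux).
have : continuous (fun y => dot (u i) x * dot (u i) y).
  move=> y; have := @continuousM _ _ (fun=> dot (u i) x) (dot (u i)) y.
  by apply; [exact: cst_continuous|exact: H].
by move=> /continuous_closedP/(_ [set s | 0 <= s] (@closed_ge _ 0)).
Qed.

Lemma closed_cone_at u x : closed (cone_at u x).
Proof.
rewrite (_ : cone_at u x = \bigcap_(i in setT) [set y | side u x y i]).
  by apply: closed_bigI => i _; exact: closed_side.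
by apply/seteqP; split => y H i; [move=> _; exact: H|exact: H].
Qed.

Lemma face_at_center u x : sphere x -> face_at u x x.
Proof. by move=> sx; split => // i; exact: side_refl. Qed.

Lemma closed_face_at u x : closed (face_at u x).
Proof. by apply: closedI; [exact: closed_sphere|exact: closed_cone_at]. Qed.

Lemma pos_hull_face_at u x : sphere x -> pos_hull (face_at u x) = cone_at u x.
Proof.
move=> sx; apply/seteqP; split => y.
  by move=> [z [_ Cz] [a a0 ->]]; exact: cone_atZ.
move=> Cy; have [->|y0] := eqVneq y 0.
  exists x; first exact: face_at_center.
  by exists 0; rewrite ?scale0r.
exists (unitv y); last by exists (enorm y); rewrite ?enorm_ge0// -unitvK.
by split; [exact: unitv_sphere|apply: cone_atZ; rewrite ?invr_ge0 ?enorm_ge0].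
Qed.

Lemma convex_body_face_at u x : sphere x -> convex_body (face_at u x).
Proof.
move=> sx; exists (cone_at u x); split.
- exact: closed_cone_at.
- exact: convex_cone_at.
- move=> C0; have : cone_at u x x by move=> i; exact: side_refl.
  by rewrite C0 /= => /eqP; apply/negP; exact: sphere_neq0.
- by rewrite setIC.
Qed.

Lemma face_at_eq u x y : face_at u x y -> gen u x -> gen u y ->
  face_at u x = face_at u y.
Proof.
move=> [_ Cxy] [_ gx] [_ gy]; congr (_ `&` _); apply/seteqP.
have H z i : side u x z i = side u y z i.
  have := Cxy i; rewrite /side (negbTE (gx i)) (negbTE (gy i)).
  have := gx i; have := gy i.
  set p := dot _ y; set q := dot _ x; set r := dot _ z => p0 q0.
  rewrite le_eqVlt eq_sym mulf_eq0 (negbTE p0) (negbTE q0)/= => pq.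
  have rw a b : 0 < a * b -> (0 <= a * r) -> (0 <= b * r).
    move=> ab ar; have a0 : a != 0 by apply: contraTneq ab => ->; rewrite mul0r ltxx.
    have a2 : 0 < a ^+ 2 by rewrite exprn_even_gt0.
    suff : 0 <= a ^+ 2 * (b * r) by rewrite pmulr_rge0.
    have -> : a ^+ 2 * (b * r) = (a * b) * (a * r) by ring.
    by rewrite mulr_ge0// ltW.
  by apply/idP/idP; apply: rw => //; rewrite mulrC.
by split => z h i; [rewrite -H|rewrite H]; exact: h.
Qed.

End arrangement.

(** * Cells as closures of open sign cells *)

Section cells.
Context {R : realType} {d n : nat}.
Local Notation E := 'rV[R]_d.+1.
Implicit Types (u : 'I_n -> E) (x y z : E).

Definition tess u := tessellation (fun i => perp_sphere (u i)).

Lemma genE u : sphere `\` \bigcup_i perp_sphere (u i) = gen u.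
Proof.
apply/seteqP; split => x.
  move=> [sx H]; split => // i; apply/eqP => ux0; apply: H.
  by exists i.
move=> [sx H]; split => // -[i _ [_ /= ux]].
by have := H i; rewrite ux eqxx.
Qed.

Definition ocell u x : set E :=
  [set y | sphere y /\ forall i, 0 < dot (u i) x * dot (u i) y].

Lemma ocell_gen u x y : ocell u x y -> gen u y.
Proof.
move=> [sy H]; split => // i; apply: contraTneq (H i) => ->.
by rewrite mulr0 ltxx.
Qed.

(** The path is the radial projection of the segment from [y] to [z]. The segment misses the origin:
    a zero at time [t] would give both summands the same norm, so [t = 1 / 2] and [z = - y]. *)
Lemma ocell_path u x y z : ocell u x y -> ocell u x z -> z != - y ->
  exists C : set E, [/\ C y, C z, C `<=` ocell u x & connected C].
Proof.
move=> [sy Hy] [sz Hz] zy.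
pose f (t : R) : E := (1 - t) *: y + t *: z.
have f0 t : 0 <= t <= 1 -> f t != 0.
  move=> /andP[t0 t1]; apply: contra zy; rewrite /f addr_eq0 => /eqP e.
  have ee : 1 - t = t.
    have : enorm ((1 - t) *: y) = enorm (- (t *: z)) by rewrite e.
    rewrite enormN !enormZ !ger0_norm ?subr_ge0//.
    by move/sphereP: sy => ->; move/sphereP: sz => ->; rewrite !mulr1.
  have t2 : t = 2^-1 by lra.
  move: e; rewrite ee -scalerN => /scalerI; rewrite t2 => e.
  by rewrite e ?invr_eq0 ?pnatr_eq0// opprK.
have cf : continuous f.
  move=> t; apply: (@continuousD _ _ _ (fun t : R => (1 - t) *: y) (fun t : R => t *: z)).
    apply: (@continuousZ _ _ _ (fun t : R => 1 - t) (fun=> y)); last exact: cst_continuous.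
    apply: (@continuousB _ _ _ (fun=> 1 : R) id); first exact: cst_continuous.
    exact: cvg_id.
  apply: (@continuousZ _ _ _ id (fun=> z)); last exact: cst_continuous.
  exact: cvg_id.
exists ((fun t => unitv (f t)) @` `[0, 1]%classic); split.
- by exists 0; rewrite /= ?in_itv/= ?lexx ?ler01// /f subr0 scale1r scale0r addr0 unitv_id.
- by exists 1; rewrite /= ?in_itv/= ?lexx ?ler01// /f subrr scale1r scale0r add0r unitv_id.
- move=> _ [t /= + <-]; rewrite in_itv/= => tt; split.
    by apply: unitv_sphere; exact: f0.
  move=> i; rewrite /unitv dotZr mulrCA mulr_gt0//.
    by rewrite invr_gt0 enorm_gt0 f0.
  rewrite /f dotDr !dotZr; have := Hy i; have := Hz i.
  set p := dot _ x; set q := dot _ y; set r := dot _ z => pr pq.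
  have -> : p * ((1 - t) * q + t * r) = (1 - t) * (p * q) + t * (p * r) by ring.
  move/andP: tt => [t0 t1]; have [t00|t00] := eqVneq t 0.
    by rewrite t00 subr0 mul1r mul0r addr0.
  apply: ltr_wpDl; first by rewrite mulr_ge0 ?subr_ge0// ltW.
  by rewrite mulr_gt0// lt_def t00.
- apply: connected_continuous_connected; first exact: segment_connected.
  apply: continuous_in_subspaceT => t; rewrite inE/= in_itv/= => tt.
  apply: (@continuousZ _ _ _ (fun t => (enorm (f t))^-1) f); last exact: cf.
  apply: continuousV; first by rewrite enorm_eq0 f0.
  exact: (continuous_comp (cf t) (@continuous_enorm _ _ _)).
Qed.

(** Antipodal points share an open cell only if there are no hyperspheres at all. A detour through a
    third point [z] then connects them; it exists because [0 < d], the sphere of dimension 0 being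
    disconnected. *)
Lemma ocell_connected u x y : (0 < d)%N -> gen u x -> ocell u x y ->
  exists C : set E, [/\ C x, C y, C `<=` ocell u x & connected C].
Proof.
move=> d0 [sx gx] Oy.
have Ox : ocell u x x.
  by split => // i; rewrite -expr2 exprn_even_gt0//= gx.
have [yx|] := eqVneq y (- x); last exact: ocell_path.
have n0 (i : 'I_n) : False.
  have [_ /(_ i)] := Oy; rewrite yx dotNr mulrN oppr_gt0 => /ltW.
  by rewrite leNgt => /negP; apply; case: Ox => _; exact.
pose e (j : 'I_d.+1) : E := delta_mx 0 j.
have se j : sphere (e j).
  rewrite /sphere/= /dot (bigD1 j)//= big1 ?addr0 ?mxE ?eqxx ?mulr1//.
  by move=> i /negbTE ij; rewrite !mxE eqxx ij mulr0.
have [z [sz zx zNx]] : exists z, [/\ sphere z, z != x & z != - x].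
  pose j1 : 'I_d.+1 := lift ord0 (Ordinal d0).
  have e01 : dot (e ord0) (e j1) = 0.
    rewrite /dot big1// => i _; rewrite !mxE eqxx/=.
    by have [->|] := eqVneq i ord0; rewrite ?mul0r// mulr0.
  have [e0|e0] := eqVneq (e ord0) x.
    exists (e j1); split => //; apply/eqP => e1.
      by move: e01; rewrite e0 e1 sx => /eqP; rewrite oner_eq0.
    by move: e01; rewrite e0 e1 dotNr sx => /eqP; rewrite oppr_eq0 oner_eq0.
  have [e0'|e0'] := eqVneq (e ord0) (- x); last by exists (e ord0).
  exists (e j1); split => //; apply/eqP => e1.
    by move: e01; rewrite e0' e1 dotNl sx => /eqP; rewrite oppr_eq0 oner_eq0.
  by move: e01; rewrite e0' e1 dotNl dotNr sx opprK => /eqP; rewrite oner_eq0.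
have Oz : ocell u x z by split => // i; case: (n0 i).
have [C1 [C1x C1z C1O C1c]] := ocell_path Ox Oz zNx.
have zy : z != - y by rewrite yx opprK.
have yz : y != - z by apply: contra zy => /eqP ->; rewrite opprK.
have [C2 [C2z C2y C2O C2c]] := ocell_path Oz Oy yz.
exists (C1 `|` C2); split; [by left|by right|by move=> ? [/C1O|/C2O]|].
by apply: connectedU => //; exists z.
Qed.

Lemma component_ocell u x : (0 < d)%N -> gen u x ->
  connected_component (gen u) x = ocell u x.
Proof.
move=> d0 gx; apply/seteqP; split => y; last first.
  move=> Oy; have [C [Cx Cy CO Cc]] := ocell_connected d0 gx Oy.
  by exists C => //; split => // z /CO /ocell_gen.
move=> [C [Cx CU Cc] Cy]; split; first by case: (CU _ Cy).
move=> i.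
have cd : continuous (fun y => dot (u i) x * dot (u i) y).
  move=> z; apply: (@continuousM _ _ (fun=> dot (u i) x) (dot (u i))).
    exact: cst_continuous.
  exact: continuous_dotr.
(* No product vanishes on [C], so the strict and the weak inequality cut out the same subset of [C],
   which is therefore both open and closed in it. *)
suff e : C `&` [set y | 0 < dot (u i) x * dot (u i) y] = C.
  have : (C `&` [set y | 0 < dot (u i) x * dot (u i) y]) y by rewrite e.
  by case.
apply: Cc.
- by exists x; split => //=; rewrite -expr2 exprn_even_gt0//=; case: gx => _; exact.
- exists [set y | 0 < dot (u i) x * dot (u i) y] => //.
  by move/continuousP: cd => /(_ [set s | 0 < s] (@open_gt _ 0)).
- exists [set y | 0 <= dot (u i) x * dot (u i) y].
    by move/continuous_closedP: cd => /(_ [set s | 0 <= s] (@closed_ge _ 0)).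
  apply/seteqP; split => z [Cz /= h]; split => //=; first exact: ltW.
  rewrite lt_def h andbT mulf_neq0//; first by case: gx => _; exact.
  by case: (CU _ Cz) => _; exact.
Qed.

Lemma closure_ocell u x : gen u x -> closure (ocell u x) = face_at u x.
Proof.
move=> [sx gx]; apply/seteqP; split.
  rewrite closureE; apply: smallest_sub; first exact: closed_face_at.
  move=> y [sy H]; split => // i.
  by rewrite /side (negbTE (gx i)) ltW.
move=> y [sy Cy]; apply: (closed_eballP _).1; first exact: closed_closure.
move=> e e0.
(* The distance from [z] to [y] is at most [2 * t], doubled by normalization, and has to stay below
   [e]; the bound [1 / 4] keeps [z] away from [0]. *)
pose t := Num.min (e / 8) (1 / 4).
have t0 : 0 < t by rewrite lt_min !divr_gt0.
have te : t <= e / 8 by rewrite ge_min lexx.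
have t4 : t <= 1 / 4 by rewrite ge_min lexx orbT.
pose z := (1 - t) *: y + t *: x.
have zy : enorm (z - y) <= 2 * t.
  rewrite (_ : z - y = t *: (x - y)); last first.
    by apply/rowP => j; rewrite /z !mxE; ring.
  rewrite enormZ ger0_norm ?(ltW t0)// mulrC ler_pM2r//.
  rewrite (le_trans (enormD _ _))// enormN.
  by move/sphereP: sy => ->; move/sphereP: sx => ->; rewrite -natr1.
have z0 : z != 0.
  apply/eqP => z0; move: zy; rewrite z0 sub0r enormN.
  move/sphereP: sy => ->; lra.
exists (unitv z); last by rewrite (le_lt_trans (unitv_near sy z0))//; lra.
apply: subset_closure; split; first exact: unitv_sphere.
move=> i; rewrite /unitv dotZr mulrCA mulr_gt0 ?invr_gt0 ?enorm_gt0//.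
rewrite /z dotDr !dotZr; have := Cy i; rewrite /side (negbTE (gx i)).
have := gx i; set p := dot _ x; set q := dot _ y => p0 pq.
have -> : p * ((1 - t) * q + t * p) = (1 - t) * (p * q) + t * p ^+ 2 by ring.
apply: ltr_wpDl; first by rewrite mulr_ge0// subr_ge0; lra.
by rewrite mulr_gt0// exprn_even_gt0.
Qed.

Lemma tessE u : (0 < d)%N -> tess u = face_at u @` gen u.
Proof.
move=> d0; rewrite /tess /tessellation genE; apply/seteqP.
split=> _ [x gx <-]; exists x => //; rewrite component_ocell ?closure_ocell//.
Qed.

End cells.

(** * Faces of cells, general position and the skeleton *)

Section faces_of_cells.
Context {R : realType} {d n : nat}.
Local Notation E := 'rV[R]_d.+1.
Implicit Types (u : 'I_n -> E) (x y z w : E) (J : {set 'I_n}) (k : nat).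

(** Up to the positive factor [a ^+ 2], the product [b * r] is [(a * b) * (a * r)]. *)
Lemma same_sign (a b r : R) : 0 < a * b -> 0 <= a * r -> 0 <= b * r.
Proof.
move=> ab ar; have a0 : a != 0 by apply: contraTneq ab => ->; rewrite mul0r ltxx.
have a2 : 0 < a ^+ 2 by rewrite exprn_even_gt0.
suff : 0 <= a ^+ 2 * (b * r) by rewrite pmulr_rge0.
have -> : a ^+ 2 * (b * r) = (a * b) * (a * r) by ring.
by rewrite mulr_ge0// ltW.
Qed.

Lemma cone_genP u x y : gen u x ->
  cone_at u x y <-> forall i, 0 <= dot (u i) x * dot (u i) y.
Proof.
by move=> [_ gx]; split => H i; have := H i; rewrite /side (negbTE (gx i)).
Qed.

Lemma zeros_cone u x0 x i : gen u x0 -> cone_at u x0 x -> dot (u i) x != 0 ->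
  0 < dot (u i) x0 * dot (u i) x.
Proof.
move=> gx0 /(cone_genP _ gx0)/(_ i) H x0'; rewrite lt_def H andbT mulf_neq0//.
by case: gx0 => _; exact.
Qed.

(** The segment from [y] to [x] extends a little beyond [x] inside the cone, as the constraints
    tight at [x] are tight at [y] too. So [x] is interior to a segment of the cone ending in [y],
    and extremality of [G] applies. *)
Lemma face_absorbs u x0 (G : set E) x y : gen u x0 ->
  is_face (cone_at u x0) G -> G x -> cone_at u x0 y ->
  (forall i, dot (u i) x = 0 -> dot (u i) y = 0) -> G y.
Proof.
move=> gx0 [GC _ Gex] Gx Cy xy; have Cx := GC _ Gx.
have [t /andP[t0 t1] Ht] := @small_perturbation R 'I_n
  (fun i => dot (u i) x != 0) (fun i => dot (u i) x0 * dot (u i) x)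
  (fun i => dot (u i) x0 * dot (u i) x - dot (u i) x0 * dot (u i) y)
  (fun i => zeros_cone gx0 Cx).
pose z := (1 + t) *: x - t *: y.
have Cz : cone_at u x0 z.
  apply/(cone_genP _ gx0) => i; rewrite /z dotBr !dotZr.
  have [x0'|x0'] := eqVneq (dot (u i) x) 0; first by rewrite xy// x0' !mulr0 subr0 mulr0.
  have := Ht i t x0'; rewrite ger0_norm ?(ltW t0)// lexx => /(_ isT) /ltW.
  by move=> h; apply: (le_trans h); rewrite le_eqVlt; apply/orP; left; apply/eqP; ring.
have t10 : 1 + t != 0 by lra.
have e : x = (1 + t)^-1 *: z + (1 - (1 + t)^-1) *: y.
  by apply/rowP => j; rewrite /z !mxE; field.
have := Gex z y (1 + t)^-1 Cz Cy; rewrite -e => H.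
have t1' : 0 < 1 + t by lra.
have tt : 0 < (1 + t)^-1 < 1 by rewrite invr_gt0 t1' invf_lt1//; lra.
by have [] := H tt Gx.
Qed.

(** From a relatively interior point [x] one can also move backwards, along [- y] for [y] in [G];
    hence a constraint tight at [x] is tight on all of [G]. Absorption gives the other inclusion.
    This is the uniqueness behind [pick_at]. *)
Lemma face_rel_int u x0 k (F : set E) x : gen u x0 ->
  faces k (face_at u x0) F -> rel_int F x -> F = face_at u x.
Proof.
move=> gx0 [G [fG _ FE]] [Fx]; have sx0 : sphere x0 by case: gx0.
move: fG; rewrite pos_hull_face_at// => fG.
have GC : G `<=` cone_at u x0 by case: fG.
have [sx Gx] : sphere x /\ G x by move: Fx; rewrite FE.
move=> /nbhs_eball[e e0 eF].
have GZ y (a : R) : 0 <= a -> G y -> G (a *: y).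
  move=> a0 Gy; apply: (face_absorbs gx0 fG Gy); first exact: cone_atZ (GC _ Gy).
  by move=> i; rewrite dotZr => ->; rewrite mulr0.
have Gz y i : G y -> dot (u i) x = 0 -> dot (u i) y = 0.
  move=> Gy ux; have [->|y0] := eqVneq y 0; first by rewrite dot0r.
  have ey : 0 < enorm y by rewrite enorm_gt0.
  (* The displacement [t * enorm y] is at most [e / 4], which normalization may double, and at most
     [1 / 2], so that [z] is not [0]. *)
  pose t := Num.min (e / 4) (1 / 2) / enorm y.
  have t0 : 0 < t by rewrite divr_gt0// lt_min !divr_gt0.
  have ty : t * enorm y <= e / 4 /\ t * enorm y <= 1 / 2.
    by rewrite /t divfK ?gt_eqF// !ge_min !lexx orbT.
  pose z := x - t *: y.
  have zx : enorm (z - x) = t * enorm y.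
    by rewrite /z addrAC subrr add0r enormN enormZ ger0_norm// ltW.
  have z0 : z != 0.
    apply/eqP => z0; move: zx; rewrite z0 sub0r enormN.
    by move/sphereP: sx => ->; lra.
  have : F (unitv z).
    apply: eF; first by rewrite /eball/= (le_lt_trans (unitv_near sx z0))//; lra.
    split; first exact: unitv_sphere.
    move=> L FL; apply: memvZ; apply: memvB; first exact: FL.
    rewrite (unitvK y) memvZ// memvZ// FL// FE; split; first exact: unitv_sphere.
    by apply: GZ => //; rewrite invr_ge0 ltW.
  rewrite FE => -[_ /GC/(cone_genP _ gx0)/(_ i)].
  rewrite /unitv dotZr mulrCA pmulr_rge0 ?invr_gt0 ?enorm_gt0//.
  rewrite /z dotBr ux dotZr sub0r mulrN mulrCA oppr_ge0 pmulr_rle0// => h1.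
  have /(cone_genP _ gx0)/(_ i) h2 := GC _ Gy.
  have /eqP : dot (u i) x0 * dot (u i) y = 0 by apply/eqP; rewrite eq_le h1 h2.
  by rewrite mulf_eq0; case: gx0 => _ /(_ i)/negbTE -> /= /eqP.
rewrite FE; apply/seteqP; split => y [sy Hy]; split => //.
  move=> i; rewrite /side; case: ifPn => [/eqP ux|ux]; first by apply/eqP; exact: Gz ux.
  apply: (same_sign (zeros_cone gx0 (GC _ Gx) ux)).
  by have /(cone_genP _ gx0) := GC _ Hy; exact.
apply: (face_absorbs gx0 fG Gx); last first.
  by move=> i ux; have := Hy i; rewrite /side ux eqxx => /eqP.
apply/(cone_genP _ gx0) => i; have := Hy i; rewrite /side.
case: ifPn => [_ /eqP->|ux]; first by rewrite mulr0.
by apply: same_sign; rewrite mulrC; exact: zeros_cone gx0 (GC _ Gx) ux.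
Qed.

Lemma perturb_cone u x w : (forall i, dot (u i) x = 0 -> dot (u i) w = 0) ->
  exists2 t, 0 < t < 1 & cone_at u x (x + t *: w).
Proof.
move=> xw.
have xx i : dot (u i) x != 0 -> 0 < dot (u i) x * dot (u i) x.
  by move=> ux; rewrite -expr2 exprn_even_gt0.
have [t /andP[t0 t1] Ht] := @small_perturbation R 'I_n
  (fun i => dot (u i) x != 0) _ (fun i => dot (u i) x * dot (u i) w) xx.
exists t; first by rewrite t0.
move=> i; rewrite /side dotDr dotZr; case: ifPn => [/eqP ux|ux].
  by rewrite ux xw// mulr0 addr0.
have := Ht i t ux; rewrite ger0_norm ?(ltW t0)// lexx => /(_ isT) /ltW.
by rewrite mulrDr (mulrCA _ t).
Qed.

Lemma mem_perp_zeros u x w : reflect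
  (forall i, dot (u i) x = 0 -> dot (u i) w = 0) (w \in perpv u (zeros u x)).
Proof.
apply: (iffP (mem_perpv _ _ _)) => H i.
  by move=> ux; apply: H; rewrite finset.inE ux.
by rewrite finset.inE => /eqP; exact: H.
Qed.

Lemma lin_hull_face_at u x : sphere x ->
  lin_hull (face_at u x) = [set` perpv u (zeros u x)].
Proof.
move=> sx; rewrite -lin_hull_pos_hull pos_hull_face_at//.
apply: lin_hull_vspace => [y Cy|L CL].
  by apply/mem_perp_zeros => i ux; have := Cy i; rewrite /side ux eqxx => /eqP.
apply/subvP => w /mem_perp_zeros /perturb_cone[t /andP[t0 _] Ct].
have xL : x \in L by apply: CL => i; exact: side_refl.
have := memvB (CL _ Ct) xL; rewrite addrAC subrr add0r => H.
by have := memvZ t^-1 H; rewrite scalerA mulVf ?gt_eqF// scale1r.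
Qed.

(** By absorption, a small move from [y] along [perpv u (zeros u y)] stays in the face, so this
    whole space lies in the linear hull of the face. *)
Lemma face_dim u x0 k (F : set E) y : gen u x0 -> faces k (face_at u x0) F ->
  F y -> (\dim (perpv u (zeros u y)) <= k.+1)%N.
Proof.
move=> gx0 [G [fG [L GL <-] ->]] [sy Gy]; have sx0 : sphere x0 by case: gx0.
move: fG; rewrite pos_hull_face_at// => fG.
have GC : G `<=` cone_at u x0 by case: fG.
apply: dimvS; apply/subvP => w /mem_perp_zeros yw.
have [t /andP[t0 t1] Ct] := perturb_cone yw.
have Gt : G (y + t *: w).
  apply: (face_absorbs gx0 fG Gy); last first.
    by move=> i uy; rewrite dotDr dotZr uy yw// mulr0 addr0.
  apply/(cone_genP _ gx0) => i; have := Ct i; rewrite /side.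
  case: ifPn => [_ /eqP->|uy]; first by rewrite mulr0.
  by apply: same_sign; rewrite mulrC; exact: zeros_cone gx0 (GC _ Gy) uy.
have GL' z : G z -> z \in L.
  by move=> /(@lin_hull_sub _ _ G); rewrite GL.
have := memvB (GL' _ Gt) (GL' _ Gy); rewrite addrAC subrr add0r => H.
by have := memvZ t^-1 H; rewrite scalerA mulVf ?gt_eqF// scale1r.
Qed.

(** By Cauchy-Schwarz, a displacement shorter than [t] changes each [dot (u i)] too little to flip a
    nonzero sign; the vanishing ones are controlled by the linear hull. *)
Lemma rel_int_face_at u x : sphere x -> rel_int (face_at u x) x.
Proof.
move=> sx; split; first exact: face_at_center.
have xx i : dot (u i) x != 0 -> 0 < dot (u i) x * dot (u i) x.
  by move=> ux; rewrite -expr2 exprn_even_gt0.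
have [t /andP[t0 t1] Ht] := @small_perturbation R 'I_n
  (fun i => dot (u i) x != 0) _ (fun i => `|dot (u i) x| * enorm (u i)) xx.
apply/nbhs_eball; exists t => // y yx [sy]; rewrite lin_hull_face_at//.
move=> /mem_perp_zeros Ly; split => // i; rewrite /side.
case: ifPn => [/eqP/Ly->//|ux].
have := Ht i (- enorm (y - x)) ux.
rewrite normrN ger0_norm ?enorm_ge0// (ltW yx) => /(_ isT)/ltW/le_trans; apply.
have -> : y = x + (y - x) by rewrite addrC subrK.
rewrite dotDr mulrDr lerD2l addrAC subrr add0r mulNr lerNl -mulrN.
rewrite (le_trans (ler_norm _))// normrM normrN mulrCA ler_wpM2l// mulrC.
exact: cauchy_schwarz.
Qed.

(** A vector space over an infinite field is not a finite union of proper subspaces. The indices are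
    treated one at a time, each correction [t *: y] being small enough to keep the earlier products
    nonzero. *)
Lemma avoid_zeros u (L : {vspace E}) (Q : pred 'I_n) :
  (forall i, Q i -> exists2 y, y \in L & dot (u i) y != 0) ->
  exists2 z, z \in L & forall i, Q i -> dot (u i) z != 0.
Proof.
move=> H.
suff [z zL Hz] : exists2 z, z \in L &
    forall i, i \in enum 'I_n -> Q i -> dot (u i) z != 0.
  by exists z => // i; apply: Hz; rewrite mem_enum.
elim: (enum _) => [|i s [z zL IH]]; first by exists 0; rewrite ?mem0v.
have [uz|uz] := boolP (Q i ==> (dot (u i) z != 0)).
  by exists z => // j; rewrite in_cons => /predU1P[->|]; [exact/implyP|exact: IH].
move: uz; rewrite negb_imply negbK => /andP[Qi /eqP uz].
have [y yL uy] := H i Qi.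
have zz j : Q j && (dot (u j) z != 0) -> 0 < dot (u j) z * dot (u j) z.
  by move=> /andP[_ ux]; rewrite -expr2 exprn_even_gt0.
have [t /andP[t0 t1] Ht] := @small_perturbation R 'I_n
  _ _ (fun i => dot (u i) z * dot (u i) y) zz.
exists (z + t *: y); first by rewrite memvD// memvZ.
move=> j; rewrite in_cons => /predU1P[-> _|js Qj].
  by rewrite dotDr uz add0r dotZr mulf_neq0// gt_eqF.
have := Ht j t; rewrite Qj IH// => /(_ isT); rewrite ger0_norm ?(ltW t0)// lexx.
move=> /(_ isT); apply: contraTneq; rewrite dotDr dotZr => h.
by rewrite mulrCA -mulrDr h mulr0 ltxx.
Qed.

Lemma gen_nearby u x z (e : R) : sphere x -> 0 < e ->
  (forall i, dot (u i) x = 0 -> dot (u i) z != 0) ->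
  exists t, [/\ 0 < t, x + t *: z != 0 &
    forall i, dot (u i) (x + t *: z) != 0 /\
      (dot (u i) x != 0 -> 0 < dot (u i) x * dot (u i) (x + t *: z))].
Proof.
move=> sx e0 xz.
have xx i : dot (u i) x != 0 -> 0 < dot (u i) x * dot (u i) x.
  by move=> ux; rewrite -expr2 exprn_even_gt0.
have [t /andP[t0 t1] Ht] := @small_perturbation R 'I_n
  (fun i => dot (u i) x != 0) _ (fun i => dot (u i) x * dot (u i) z) xx.
have ez : 0 < 2 * (enorm z + 1) by rewrite mulr_gt0// ltr_wpDl// enorm_ge0.
(* The second bound gives [s * enorm z < 1], so [x + s *: z] cannot vanish for a unit vector [x]. *)
pose s := Num.min t (2 * (enorm z + 1))^-1.
have s0 : 0 < s by rewrite lt_min t0 invr_gt0.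
have Hs i : dot (u i) x != 0 -> 0 < dot (u i) x * dot (u i) (x + s *: z).
  move=> ux; rewrite dotDr dotZr mulrDr (mulrCA _ s); apply: Ht => //.
  by rewrite ger0_norm ?ge_min ?lexx// ltW.
exists s; split => // [|i].
  rewrite addr_eq0; apply/negP => /eqP xe.
  move/sphereP: (sx) => /eqP; apply/negP; rewrite xe.
  rewrite enormN enormZ ger0_norm ?(ltW s0)// lt_eqF//.
  apply: (@le_lt_trans _ _ ((2 * (enorm z + 1))^-1 * enorm z)).
    by rewrite ler_wpM2r ?enorm_ge0// ge_min lexx orbT.
  by rewrite ltr_pdivrMl// mulr1; have := enorm_ge0 z; lra.
split; last exact: Hs.
have [ux|ux] := eqVneq (dot (u i) x) 0.
  by rewrite dotDr ux add0r dotZr mulf_neq0 ?xz// gt_eqF.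
by apply: contraTneq (Hs _ ux) => ->; rewrite mulr0 ltxx.
Qed.

(** The cell is that of a point [x0] reached from [x] by a small step along [z]. Extremality: if a
    constraint is tight at a convex combination, its two values on the cell have the same sign and a
    vanishing combination, so both vanish. *)
Lemma face_exists u x z k : sphere x -> (forall i, dot (u i) z != 0) ->
  \dim (perpv u (zeros u x)) = k.+1 ->
  exists2 x0, gen u x0 & faces k (face_at u x0) (face_at u x).
Proof.
move=> sx gz dx.
have [t [t0 xz0 Ht]] := gen_nearby sx ltr01 (fun i _ => gz i).
pose x0 := unitv (x + t *: z).
have en : 0 < (enorm (x + t *: z))^-1 by rewrite invr_gt0 enorm_gt0.
have gx0 : gen u x0.
  split=> [|i]; first exact: unitv_sphere.
  by rewrite dotZr mulf_neq0//; [rewrite gt_eqF|case: (Ht i)].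
have sx0 : sphere x0 by case: gx0.
have Hx0 i : dot (u i) x != 0 -> 0 < dot (u i) x * dot (u i) x0.
  by move=> ux; rewrite dotZr mulrCA mulr_gt0//; exact: (Ht i).2.
exists x0 => //; exists (cone_at u x); rewrite pos_hull_face_at//; split => //.
- split.
  + move=> y Cy; apply/(cone_genP _ gx0) => i; have := Cy i; rewrite /side.
    by case: ifPn => [_ /eqP->|ux]; [rewrite mulr0|apply: same_sign; exact: Hx0].
  + move=> y w s Cy Cw /andP[s0 s1] i.
    by apply: side_closed => //; rewrite subr_ge0.
  + move=> y w s /(cone_genP _ gx0) Cy /(cone_genP _ gx0) Cw /andP[s0 s1] H.
    suff K i : side u x y i /\ side u x w i by split => i; case: (K i).
    have := H i; rewrite /side; case: ifPn => [ux|ux _]; last first.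
      by split; apply: (@same_sign (dot (u i) x0)) => //; rewrite mulrC; exact: Hx0.
    rewrite dotDr !dotZr => /eqP h; have := Cy i; have := Cw i.
    have := gx0.2 i; move: h; set p := dot _ y; set q := dot _ w.
    set r := dot _ x0 => h r0 rq rp.
    have h2 : s * (r * p) + (1 - s) * (r * q) = 0.
      by rewrite -[RHS](mulr0 r) -h; ring.
    have s1' : 0 < 1 - s by rewrite subr_gt0.
    have /eqP : s * (r * p) = 0 by apply/eqP; rewrite eq_le; apply/andP; split; nra.
    have /eqP : (1 - s) * (r * q) = 0 by apply/eqP; rewrite eq_le; apply/andP; split; nra.
    by rewrite !mulf_eq0 (negbTE r0) (gt_eqF s0) (gt_eqF s1') => /= -> ->.
- exists (perpv u (zeros u x)) => //.
  by rewrite -(pos_hull_face_at u sx) lin_hull_pos_hull lin_hull_face_at.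
Qed.

(** If [perpv u J] were contained in the hyperplane orthogonal to [u i], adding [i] to [J] would not
    lower the dimension, against general position. *)
Lemma gen_position_avoid u J : gen_position u -> (#|J| <= d)%N ->
  exists2 z, z \in perpv u J & forall i, i \notin J -> dot (u i) z != 0.
Proof.
move=> gp Jd; apply: avoid_zeros => i iJ; apply: contrapT => H.
have : (perpv u J <= orthv (u i))%VS.
  apply/subvP => y yJ; rewrite mem_orthv; apply/negPn/negP => uy.
  by apply: H; exists y.
move=> /capv_idPl; rewrite -perpvU1 => e.
have c1 : #|(i |: J)%SET| = #|J|.+1 by rewrite cardsU1 iJ.
have := gp (i |: J)%SET; rewrite c1 ltnS Jd e => /(_ isT).
rewrite (gp J (leqW Jd)); move: #|J| Jd => m Jd h; lia.
Qed.

Lemma gen_position_avoid0 u : gen_position u ->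
  exists z, forall i, dot (u i) z != 0.
Proof.
move=> gp; have [|z _ Hz] := gen_position_avoid gp (J := finset.set0).
  by rewrite finset.cards0.
by exists z => i; apply: Hz; rewrite finset.inE.
Qed.

Lemma pick_face u x k : (0 < d)%N -> gen_position u -> sphere x ->
  \dim (perpv u (zeros u x)) = k.+1 ->
  pick_at (tess_faces k (tess u)) x = face_at u x.
Proof.
move=> d0 gp sx dx.
have [z gz] := gen_position_avoid0 gp.
rewrite /pick_at; apply: xget_unique.
  have [x0 gx0 fx0] := face_exists sx gz dx.
  split; last exact: rel_int_face_at.
  by exists (face_at u x0) => //; rewrite tessE//; exists x0.
move=> F [[P + fP] rF]; rewrite tessE// => -[x0 gx0 PE].
by rewrite -PE in fP; exact: face_rel_int fP rF.
Qed.

Lemma pick_cell u x : (0 < d)%N -> gen u x ->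
  pick_at (tess u) x = face_at u x.
Proof.
move=> d0 gx; have sx : sphere x by case: gx.
rewrite /pick_at; apply: xget_unique.
  split; last exact: rel_int_face_at.
  by rewrite tessE//; exists x.
move=> F [+ [Fx _]]; rewrite tessE// => -[x0 gx0 FE].
by rewrite -FE in Fx *; exact: face_at_eq.
Qed.

(** A point of a [k]-face has at least [d - k] tight constraints, by the bound on dimensions.
    Conversely, a point [x] of [great u J] is moved within [perpv u J] off all other hyperplanes;
    the face around the moved point [v] has dimension [k] and still contains [x]. *)
Lemma skeletonE u k : (0 < d)%N -> (k <= d)%N -> gen_position u ->
  skeleton k (tess u) = \bigcup_(J in [set J : {set 'I_n} | #|J| = (d - k)%N]) great u J.
Proof.
move=> d0 kd gp; apply/seteqP; split => x.
  move=> [F [P]]; rewrite tessE// => -[x0 gx0 <-] fF Fx.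
  have sx : sphere x by case: fF => G [_ _ FE]; move: Fx; rewrite FE => -[].
  have := face_dim gx0 fF Fx => dk.
  have h : (d - k <= #|zeros u x|)%N.
    by have := dim_perpv_ge u (zeros u x); move: dk kd; lia.
  have [J JE Jx] : exists2 J : {set 'I_n}, #|J| = (d - k)%N & J \subset zeros u x.
    have [s [us ss sz]] : exists s : seq 'I_n, [/\ uniq s, size s = (d - k)%N
        & {subset s <= zeros u x}].
      exists (take (d - k) (enum (zeros u x))); split.
      - by rewrite take_uniq// enum_uniq.
      - by rewrite size_take -cardE; case: ltngtP h.
      - by move=> i /mem_take; rewrite mem_enum.
    exists (finset (fun i => i \in s)).
      rewrite -ss -(card_uniqP us); apply: eq_card => i.
      by rewrite finset.inE.
    by apply/fintype.subsetP => i; rewrite finset.inE => /sz.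
  exists J => //; split => //; apply/mem_perpv => i iJ.
  by have := fintype.subsetP Jx i iJ; rewrite finset.inE => /eqP.
move=> [J /= JE [sx xJ]].
have Jd : (#|J| <= d)%N by rewrite JE leq_subr.
have [z zJ Hz] := gen_position_avoid gp Jd.
pose J' := zeros u x.
pose Q i := i \notin J.
have xx i : Q i && (dot (u i) x != 0) -> 0 < dot (u i) x * dot (u i) x.
  by move=> /andP[_ ux]; rewrite -expr2 exprn_even_gt0.
have [t /andP[t0 t1] Ht] := @small_perturbation R 'I_n
  _ _ (fun i => dot (u i) x * dot (u i) z) xx.
have ez : 0 < 2 * (enorm z + 1) by rewrite mulr_gt0// ltr_wpDl// enorm_ge0.
pose s := Num.min t (2 * (enorm z + 1))^-1.
have s0 : 0 < s by rewrite lt_min t0 invr_gt0.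
pose y := x + s *: z.
have y0 : y != 0.
  rewrite addr_eq0; apply/negP => /eqP xe.
  move/sphereP: (sx) => /eqP; apply/negP; rewrite xe.
  rewrite enormN enormZ ger0_norm ?(ltW s0)// lt_eqF//.
  apply: (@le_lt_trans _ _ ((2 * (enorm z + 1))^-1 * enorm z)).
    by rewrite ler_wpM2r ?enorm_ge0// ge_min lexx orbT.
  by rewrite ltr_pdivrMl// mulr1; have := enorm_ge0 z; lra.
have Hs i : Q i -> dot (u i) x != 0 -> 0 < dot (u i) x * dot (u i) y.
  move=> Qi ux; rewrite dotDr dotZr mulrDr (mulrCA _ s); apply: Ht; first exact/andP.
  by rewrite ger0_norm ?ge_min ?lexx// ltW.
have yJ i : (dot (u i) y == 0) = (i \in J).
  apply/idP/idP => [/eqP uy|iJ]; last first.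
    by rewrite dotDr dotZr (mem_perpv _ _ _ xJ)// (mem_perpv _ _ _ zJ)// mulr0 addr0.
  apply/negPn/negP => iJ; have [ux|ux] := eqVneq (dot (u i) x) 0.
    move/eqP: uy; rewrite dotDr ux add0r dotZr mulf_eq0 (gt_eqF s0)/=.
    by apply/negP; exact: Hz.
  by have := Hs i iJ ux; rewrite uy mulr0 ltxx.
pose v := unitv y.
have en : 0 < (enorm y)^-1 by rewrite invr_gt0 enorm_gt0.
have vJ : zeros u v = J.
  apply/setP => i; rewrite finset.inE -yJ dotZr mulf_eq0 (gt_eqF en)//.
have sv : sphere v by exact: unitv_sphere.
have dv : \dim (perpv u (zeros u v)) = k.+1.
  by rewrite vJ gp ?JE; lia.
have [w gw] := gen_position_avoid0 gp.
have [x0 gx0 fx0] := face_exists sv gw dv.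
exists (face_at u v).
  by exists (face_at u x0) => //; rewrite tessE//; exists x0.
split => // i; rewrite /side dotZr mulf_eq0 (gt_eqF en)/= yJ.
case: ifPn => [iJ|iJ]; first by rewrite (mem_perpv _ _ _ xJ).
rewrite -mulrA pmulr_rge0// mulrC.
have [->|ux] := eqVneq (dot (u i) x) 0; first by rewrite mul0r.
exact: ltW (Hs i iJ ux).
Qed.

(** The cells entered from [x] in the directions [z] and [- z] impose each constraint tight at [x]
    with both signs, hence as an equation. The face is thereby expressed through the closed cells
    alone, without their normals. *)
Lemma face_at_bigcap u x : (0 < d)%N -> (exists z, forall i, dot (u i) z != 0) ->
  sphere x -> face_at u x = \bigcap_(P in [set P | tess u P /\ P x]) P.
Proof.
move=> d0 [z gz] sx; apply/seteqP; split => y.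
  move=> [sy Cy] P [+]; rewrite tessE// => -[x0 gx0 <-{P}] [_ Cx].
  split => //; apply/(cone_genP _ gx0) => i; have := Cy i; rewrite /side.
  case: ifPn => [_ /eqP->|ux]; first by rewrite mulr0.
  by apply: same_sign; rewrite mulrC; exact: zeros_cone gx0 Cx ux.
move=> H; suff K (w : E) : (forall i, dot (u i) w != 0) -> sphere y /\
   forall i, if dot (u i) x == 0 then 0 <= dot (u i) w * dot (u i) y
             else 0 <= dot (u i) x * dot (u i) y.
  have [sy Kz] := K z gz; have [|_ Kz'] := K (- z).
    by move=> i; rewrite dotNr oppr_eq0.
  split => // i; have := Kz i; have := Kz' i; rewrite /side; case: ifP => // _.
  rewrite dotNr mulNr oppr_ge0 => h1 h2.
  have /eqP : dot (u i) z * dot (u i) y = 0 by apply/eqP; rewrite eq_le h1 h2.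
  by rewrite mulf_eq0 (negbTE (gz i)).
move=> gw.
have [t [t0 xw0 Ht]] := gen_nearby sx ltr01 (fun i _ => gw i).
pose x0 := unitv (x + t *: w).
have en : 0 < (enorm (x + t *: w))^-1 by rewrite invr_gt0 enorm_gt0.
have gx0 : gen u x0.
  split=> [|i]; first exact: unitv_sphere.
  by rewrite dotZr mulf_neq0//; [rewrite gt_eqF|case: (Ht i)].
have : face_at u x0 y.
  apply: H; split; first by rewrite tessE//; exists x0.
  split => //; apply/(cone_genP _ gx0) => i.
  have [->|ux] := eqVneq (dot (u i) x) 0; first by rewrite mulr0.
  by rewrite dotZr -mulrA mulr_ge0 ?(ltW en)// mulrC ltW//; exact: (Ht i).2.
move=> [sy /(cone_genP _ gx0) Cy]; split => // i; have := Cy i.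
rewrite dotZr -mulrA pmulr_rge0//.
case: ifPn => [/eqP ux|ux].
  by rewrite dotDr ux add0r dotZr -mulrA pmulr_rge0.
by apply: same_sign; rewrite mulrC; exact: (Ht i).2.
Qed.

End faces_of_cells.

(** * Hausdorff measure *)

Section countable_base.
Context {R : realType} {d : nat}.
Local Notation E := 'rV[R]_d.+1.

Definition bball (i : nat) : set E :=
  if unpickle i is Some p then eball (ratvec (p : nat * nat).1) p.2.+1%:R^-1
  else set0.

Lemma open_bball i : open (bball i).
Proof.
by rewrite /bball; case: unpickle => [p|]; [exact: open_eball|exact: open0].
Qed.

Lemma bball_nbhs (x : E) (e : R) : 0 < e ->
  exists i, bball i x /\ bball i `<=` eball x e.
Proof.
move=> e0; have e2 : 0 < e / 2 by rewrite divr_gt0.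
have [m _ Hm] := near_infty_natSinv_lt (PosNum e2).
have := Hm m (leqnn m) => /= {Hm} mE.
have m0 : 0 < m.+1%:R^-1 :> R by rewrite invr_gt0.
have [j jx] := ratvec_dense x m0.
exists (pickle (j, m)); rewrite /bball pickleK/=; split.
  by rewrite /eball/= enormB.
move=> y; rewrite /eball/= => yj.
rewrite (le_lt_trans (enorm_triangle (ratvec j) _ _))//.
move: mE yj jx; set c := _^-1; move: (enorm _) (enorm _) => p q h1 h2 h3; lra.
Qed.

Lemma open_bigcup_bball (O : set E) : open O ->
  O = \bigcup_(i in [set i | bball i `<=` O]) bball i.
Proof.
move=> oO; apply/seteqP; split=> [x Ox|x [i iO]]; last exact: iO.
have [e e0 eO] := (open_eballP _).1 oO x Ox.
have [i [ix ie]] := bball_nbhs x e0.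
by exists i => //; exact: subset_trans eO.
Qed.

(** A countable family of open sets fine enough to separate compact sets from the complements of
    their open neighbourhoods. *)
Definition bunion (s : seq nat) : set E := \bigcup_(i in [set` s]) bball i.

Lemma open_bunion s : open (bunion s).
Proof. by apply: bigcup_open => i _; exact: open_bball. Qed.

Lemma compact_bunion (A O : set E) : compact A -> open O -> A `<=` O ->
  exists s, A `<=` bunion s /\ bunion s `<=` O.
Proof.
rewrite compact_cover => cA oO AO.
have [||D DO AD] := cA nat [set i | bball i `<=` O] bball.
- by move=> i _; exact: open_bball.
- by move=> z /AO; rewrite {1}(open_bigcup_bball oO).
exists (finmap.enum_fset D); split => [x /AD[i iD ix]|x [i /= iD]]; first by exists i.
by have := DO i iD; rewrite inE; exact.
Qed.

End countable_base.

(** * Hausdorff measure as an outer measure, additive on separated sets *)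

Section hausdorff_outer.
Context {R : realType} {d : nat}.
Local Notation E := 'rV[R]_d.+1.
Implicit Types (A B U : set E) (e : R) (k : nat).

Lemma ball_volume_ge0 k : 0 <= ball_volume R k.
Proof.
suff : 0 <= ball_volume R k /\ 0 <= ball_volume R k.+1 by case.
elim: k => [|k [h1 h2]]; first by split; rewrite /= ?ler01 ?ler0n.
split => //=; rewrite mulr_ge0// divr_ge0// mulr_ge0//; exact: pi_ge0.
Qed.

Lemma diam_ge0 U : 0 <= diam U.
Proof.
rewrite /diam; set S := [set r | _].
have [hS|nS] := pselect (has_sup S); last by rewrite sup_out.
have [[r Sr] uS] := hS; apply: (le_trans _ (ub_le_sup uS Sr)).
by case: Sr => x [y [_ _ ->]]; exact: sqrtr_ge0.
Qed.

Lemma diam_le U (r : R) : U !=set0 ->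
  (forall x y, U x -> U y -> eucl_dist x y <= r) -> diam U <= r.
Proof.
move=> [x Ux] H; apply: ge_sup; first by exists (eucl_dist x x), x, x.
by move=> _ [y [z [Uy Uz ->]]]; exact: H.
Qed.

Lemma le_diam U (r : R) x y :
  (forall x y, U x -> U y -> eucl_dist x y <= r) -> U x -> U y ->
  eucl_dist x y <= diam U.
Proof.
move=> H Ux Uy; apply: ub_le_sup; last by exists x, y.
by exists r => _ [v [w [Uv Uw ->]]]; exact: H.
Qed.

Lemma hausdorff_gauge_ge0 k U : (0 <= hausdorff_gauge k U)%E.
Proof.
rewrite /hausdorff_gauge; case: ifP => // _; rewrite lee_fin mulr_ge0//.
  exact: ball_volume_ge0.
by rewrite exprn_ge0// divr_ge0// diam_ge0.
Qed.

Lemma hausdorff_gauge0 k : hausdorff_gauge k (set0 : set E) = 0%E.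
Proof. by rewrite /hausdorff_gauge eqxx. Qed.

Lemma le_hausdorff_gauge k U (V : set E) : (V !=set0 -> U !=set0) ->
  (V !=set0 -> diam V <= diam U) ->
  (hausdorff_gauge k V <= hausdorff_gauge k U)%E.
Proof.
move=> VU dVU; have [->|V0'] := eqVneq V set0.
  by rewrite hausdorff_gauge0 hausdorff_gauge_ge0.
have V0 : V !=set0 by apply/set0P.
rewrite /hausdorff_gauge (negbTE V0').
have /set0P U0 := VU V0; rewrite (negbTE U0).
rewrite lee_fin ler_wpM2l ?ball_volume_ge0// lerXn2r ?nnegrE ?divr_ge0 ?diam_ge0//.
by rewrite ler_pM2r ?dVU// invr_gt0.
Qed.

Definition small_sets (e : R) : set (set E) :=
  [set U | forall x y, U x -> U y -> eucl_dist x y <= e].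

(** The value [+oo] on large sets moves the size restriction from the covering into the set
    function. Over a sigma-field containing every set, [hausdorff_pre] becomes an instance of
    [mu_ext]. *)
Definition bounded_gauge k e U : \bar R :=
  if `[< small_sets e U >] then hausdorff_gauge k U else +oo%E.

Let all_sets := g_sigma_algebraType [set: set E].

Lemma hausdorff_preE k e A : hausdorff_pre k e A =
  mu_ext (bounded_gauge k e : set all_sets -> \bar R) A.
Proof.
apply/eqP; rewrite eq_le; apply/andP; split.
  apply/ereal_infP => _ [F [mF AF] <-].
  have [H|] := pselect (forall i, small_sets e (F i)).
    apply: ereal_inf_lbound; exists F => //.
    apply: eq_eseriesr => i _; rewrite /bounded_gauge asboolT//; exact: H.
  move=> /existsNP[i Hi].
  rewrite (eseries_pinfty (k := i)) ?leey//.
    by move=> j _; rewrite /bounded_gauge; case: ifP => // _;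
      rewrite gt_eqF// (lt_le_trans _ (hausdorff_gauge_ge0 _ _))// ltNy0.
  by rewrite /bounded_gauge asboolF.
apply/ereal_infP => _ [F [AF sF] <-].
apply: ereal_inf_lbound; exists F; first by split => // i; exact: sub_sigma_algebra.
apply: eq_eseriesr => i _; rewrite /bounded_gauge asboolT//; exact: sF.
Qed.

Let bg0 k e : 0 <= e -> bounded_gauge k e (set0 : set E) = 0%E.
Proof. by move=> e0; rewrite /bounded_gauge asboolT// hausdorff_gauge0. Qed.

Let bg_ge0 k e U : (0 <= bounded_gauge k e U)%E.
Proof.
by rewrite /bounded_gauge; case: ifP => // _; exact: hausdorff_gauge_ge0.
Qed.

Lemma hausdorff_pre_ge0 k e A : (0 <= hausdorff_pre k e A)%E.
Proof. by rewrite hausdorff_preE; apply: mu_ext_ge0. Qed.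

Lemma hausdorff_pre0 k e : 0 < e -> hausdorff_pre k e (set0 : set E) = 0%E.
Proof. by move=> e0; rewrite hausdorff_preE mu_ext0// bg0// ltW. Qed.

Lemma le_hausdorff_pre k e A B : A `<=` B ->
  (hausdorff_pre k e A <= hausdorff_pre k e B)%E.
Proof. by move=> AB; rewrite !hausdorff_preE; exact: le_mu_ext. Qed.

Lemma hausdorff_pre_anti k e e' A : e <= e' ->
  (hausdorff_pre k e' A <= hausdorff_pre k e A)%E.
Proof.
move=> ee; apply/ereal_inf_le_tmp => _ [U [AU Ue] <-]; exists U => //; split => //.
by move=> i x y Ux Uy; rewrite (le_trans (Ue _ _ _ Ux Uy)).
Qed.

Lemma hausdorff_pre_sigma_subadditive k e :
  sigma_subadditive (hausdorff_pre k e : set E -> \bar R).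
Proof.
move=> F; rewrite hausdorff_preE.
under eq_eseriesr do rewrite hausdorff_preE.
exact: mu_ext_sigma_subadditive.
Qed.

Lemma hausdorff_pre_le k e A : 0 < e -> (hausdorff_pre k e A <= hausdorff k A)%E.
Proof. by move=> e0; apply: ereal_sup_ubound; exists e. Qed.

Lemma hausdorff_ge0 k A : (0 <= hausdorff k A)%E.
Proof. exact: le_trans (hausdorff_pre_ge0 k 1 A) (hausdorff_pre_le _ _ ltr01). Qed.

Lemma hausdorff0 k : hausdorff k (set0 : set E) = 0%E.
Proof.
apply/eqP; rewrite eq_le hausdorff_ge0 andbT; apply/ereal_supP => _ [e /= e0 <-].
by rewrite hausdorff_pre0.
Qed.

Lemma le_hausdorff k A B : A `<=` B -> (hausdorff k A <= hausdorff k B)%E.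
Proof.
move=> AB; apply/ereal_supP => _ [e /= e0 <-].
exact: le_trans (le_hausdorff_pre _ _ AB) (hausdorff_pre_le _ _ e0).
Qed.

Lemma hausdorff_sigma_subadditive k :
  sigma_subadditive (hausdorff k : set E -> \bar R).
Proof.
move=> F; apply/ereal_supP => _ [e /= e0 <-].
apply: (le_trans (hausdorff_pre_sigma_subadditive _ _ _)).
apply: lee_nneseries => [i _ _|i _]; first exact: hausdorff_pre_ge0.
exact: hausdorff_pre_le.
Qed.

HB.instance Definition _ k := isOuterMeasure.Build R E
  (@hausdorff R d k) (@hausdorff0 k) (@hausdorff_ge0 k) (@le_hausdorff k)
  (@hausdorff_sigma_subadditive k).

Lemma hausdorff_contraction k (f : E -> E) A :
  (forall x y, A x -> A y -> eucl_dist (f x) (f y) <= eucl_dist x y) ->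
  (hausdorff k (f @` A) <= hausdorff k A)%E.
Proof.
move=> fA; apply/ereal_supP => _ [e /= e0 <-].
apply: le_trans (hausdorff_pre_le _ _ e0).
apply/ereal_infP => _ [U [AU Ue] <-].
apply: (@le_trans _ _ (\sum_(0 <= i <oo) hausdorff_gauge k (f @` (U i `&` A)))%E).
  apply: ereal_inf_lbound; exists (fun i => f @` (U i `&` A)) => //; split.
    move=> _ [x Ax <-]; have [i _ Ui] := AU _ Ax; exists i => //.
    by exists x.
  move=> i _ _ [x [Ux Ax] <-] [y [Uy Ay] <-].
  exact: le_trans (fA _ _ Ax Ay) (Ue _ _ _ Ux Uy).
apply: lee_nneseries => [i _ _|i _]; first exact: hausdorff_gauge_ge0.
apply: le_hausdorff_gauge; first by move=> [_ [x [Ux _] _]]; exists x.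
move=> H; apply: diam_le => // _ _ [x [Ux Ax] <-] [y [Uy Ay] <-].
exact: le_trans (fA _ _ Ax Ay) (le_diam (Ue i) Ux Uy).
Qed.

(** A covering set of diameter at most [e] cannot meet both [A] and [B], so a covering of the union
    splits into coverings of the two parts. *)
Lemma hausdorff_pre_far k e (e' : R) A B : e < e' ->
  (forall x y, A x -> B y -> e' <= eucl_dist x y) ->
  (hausdorff_pre k e A + hausdorff_pre k e B <= hausdorff_pre k e (A `|` B))%E.
Proof.
move=> ee AB; apply/ereal_infP => _ [U [ABU Ue] <-].
pose res (C : set E) i := if `[< (U i `&` C) !=set0 >] then U i else set0.
have resU (C : set E) : C `<=` A `|` B ->
    (hausdorff_pre k e C <= \sum_(0 <= i <oo) hausdorff_gauge k (res C i))%E.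
  move=> CAB; apply: ereal_inf_lbound; exists (res C) => //; split.
    move=> x Cx; have [i _ Ux] := ABU _ (CAB _ Cx); exists i => //.
    by rewrite /res asboolT//; exists x.
  by move=> i x y; rewrite /res; case: ifP => // _; exact: Ue.
apply: (le_trans (leeD (resU A _) (resU B _))).
- by move=> x; left.
- by move=> x; right.
rewrite -nneseriesD; last 2 first.
- by move=> i _ _; exact: hausdorff_gauge_ge0.
- by move=> i _ _; exact: hausdorff_gauge_ge0.
apply: lee_nneseries => [i _ _|i _].
  by rewrite adde_ge0 ?hausdorff_gauge_ge0.
rewrite /res; case: asboolP => [[x [Ux Ax]]|_]; last first.
  rewrite hausdorff_gauge0 add0e; case: ifP => // _.
  by rewrite hausdorff_gauge0 hausdorff_gauge_ge0.
rewrite asboolF ?hausdorff_gauge0 ?adde0// => -[y [Uy By]].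
have := le_lt_trans (le_trans (AB _ _ Ax By) (Ue _ _ _ Ux Uy)) ee.
by rewrite ltxx.
Qed.

Lemma hausdorff_far k (e' : R) A B : 0 < e' ->
  (forall x y, A x -> B y -> e' <= eucl_dist x y) ->
  (hausdorff k A + hausdorff k B <= hausdorff k (A `|` B))%E.
Proof.
move=> e'0 AB; have [Hoo|] := eqVneq (hausdorff k (A `|` B)) +oo%E.
  by rewrite Hoo leey.
rewrite -ltey => Hoo.
have fA : hausdorff k A \is a fin_num.
  rewrite ge0_fin_numE ?hausdorff_ge0// (le_lt_trans _ Hoo)//.
  by apply: le_hausdorff; left.
have H e1 e2 : 0 < e1 -> 0 < e2 ->
    (hausdorff_pre k e1 A + hausdorff_pre k e2 B <= hausdorff k (A `|` B))%E.
  move=> e10 e20; pose e := Num.min (Num.min e1 e2) (e' / 2).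
  have e0 : 0 < e by rewrite !lt_min e10 e20 divr_gt0.
  have ee : e < e'.
    by rewrite (le_lt_trans (_ : _ <= e' / 2))// ?ge_min ?lexx ?orbT//; lra.
  apply: le_trans (hausdorff_pre_le _ _ e0).
  apply: le_trans (hausdorff_pre_far _ ee AB).
  by apply: leeD; apply: hausdorff_pre_anti; rewrite !ge_min lexx ?orbT.
rewrite addeC -leeBrDr//; apply/ereal_supP => _ [e2 /= e20 <-].
have fB : hausdorff_pre k e2 B \is a fin_num.
  rewrite ge0_fin_numE ?hausdorff_pre_ge0// (le_lt_trans _ Hoo)//.
  apply: le_trans (hausdorff_pre_le _ _ e20) _.
  by apply: le_hausdorff; right.
rewrite leeBrDr// addeC -leeBrDr//; apply/ereal_supP => _ [e1 /= e10 <-].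
by rewrite leeBrDr// H.
Qed.

End hausdorff_outer.

(** * Caratheodory measurability by the metric criterion *)

Section hausdorff_measure.
Context {R : realType} {d : nat}.
Local Notation E := 'rV[R]_d.+1.
Implicit Types (A B U X : set E) (k : nat).
Local Open Scope ereal_scope.

Lemma hausdorff_far_sum k X (D : nat -> set E) :
  (forall j, D j `<=` X) ->
  (forall j, exists2 e' : R, (0 < e')%R & forall i x y, (i < j)%N -> D i x -> D j y ->
     (e' <= eucl_dist x y)%R) ->
  forall m, \sum_(j < m) hausdorff k (D j) <= hausdorff k X.
Proof.
move=> DX Dfar m.
suff : \sum_(j < m) hausdorff k (D j) <= hausdorff k (\big[setU/set0]_(j < m) D j).
  move=> h; apply: (le_trans h); apply: le_hausdorff => x.
  by rewrite -bigcup_mkord => -[j _ /DX].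
elim: m => [|m IH]; first by rewrite !big_ord0 hausdorff0.
rewrite !big_ord_recr/=; apply: (le_trans (leeD2r _ IH)).
have [e' e0 He] := Dfar m.
apply: (hausdorff_far k e0) => x y; rewrite -bigcup_mkord => -[i /= im Dx] Dy.
exact: He im Dx Dy.
Qed.

Lemma eucl_dist_lip (f : E -> R) : (forall x y, `|f x - f y| <= enorm (x - y))%R ->
  forall (a b : R) x y, (f x <= a)%R -> (b <= f y)%R -> (b - a <= eucl_dist x y)%R.
Proof.
move=> fl a b x y fx fy; rewrite (le_trans _ (fl x y))//.
by rewrite distrC (le_trans _ (ler_norm _))//; lra.
Qed.

Lemma inv_natr_lt (i j : nat) : (i < j)%N -> (j.+1%:R^-1 < i.+1%:R^-1 :> R)%R.
Proof. by move=> ij; rewrite ltf_pV2 ?posrE// ltr_nat. Qed.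

(* The shells [D j] accumulate at the boundary of the sublevel set; those of even
   index are at positive distance from each other, and so are those of odd index.
   Hence their measures are summable, and the tail is negligible. *)
Lemma sublevel_caratheodory k (f : E -> R) (c : R) :
  (forall x y, `|f x - f y| <= enorm (x - y))%R ->
  (hausdorff k).-caratheodory [set x : E | f x < c]%R.
Proof.
move=> fl; apply: le_caratheodory_measurable => X.
pose A := X `&` [set x | f x < c]%R; pose B := X `&` ~` [set x | f x < c]%R.
change (hausdorff k A + hausdorff k B <= hausdorff k X).
have [Xoo|] := eqVneq (hausdorff k X) +oo; first by rewrite Xoo leey.
rewrite -ltey => Xoo.
pose v (j : nat) : R := (c - j.+1%:R^-1)%R.
pose An n := [set x | X x /\ f x < v n]%R.
pose D j := [set x | X x /\ v j <= f x < v j.+1]%R.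
have vS i j : (i < j)%N -> (v i < v j)%R.
  by move=> ij; rewrite /v ltrD2l ltrN2 inv_natr_lt.
have vS' i j : (i <= j)%N -> (v i <= v j)%R.
  by rewrite leq_eqVlt => /predU1P[->//|/vS/ltW].
have Dpar (b : nat) m : \sum_(j < m) hausdorff k (D (j.*2 + b)%N) <= hausdorff k X.
  apply: (@hausdorff_far_sum k X (fun j => D (j.*2 + b)%N)) => [j x []//|j].
  case: j => [|j]; first by exists 1%R => // i x y; rewrite ltn0.
  exists (v (j.+1.*2 + b)%N - v (j.*2 + b).+1)%R.
    by rewrite subr_gt0 vS// doubleS !addSn.
  move=> i x y ij [_ /andP[_ xi]] [_ /andP[yj _]].
  apply: (eucl_dist_lip fl) => //; apply: ltW; apply: (lt_le_trans xi).
  by apply: vS'; rewrite ltnS leq_add2r leq_double -ltnS.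
have Dge0 j : 0 <= hausdorff k (D j) by exact: hausdorff_ge0.
have Dsum m : \sum_(j < m) hausdorff k (D j) <= hausdorff k X + hausdorff k X.
  apply: (@le_trans _ _ (\sum_(j < m.*2) hausdorff k (D j))).
    rewrite -!(big_mkord xpredT (fun j => hausdorff k (D j))).
    by apply: lee_sum_nneg_natr => //; rewrite -addnn leq_addr.
  have -> : \sum_(j < m.*2) hausdorff k (D j) =
      \sum_(j < m) hausdorff k (D (j.*2 + 0)%N) + \sum_(j < m) hausdorff k (D (j.*2 + 1)%N).
    elim: m => [|m IH]; first by rewrite !big_ord0 adde0.
    by rewrite doubleS !big_ord_recr/= IH addn0 addn1 -!addeA; congr (_ + _);
      rewrite [RHS]addeCA; congr (_ + _).
  by apply: leeD; exact: Dpar.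
have Dfin : \sum_(0 <= j <oo) hausdorff k (D j) < +oo.
  apply: (@le_lt_trans _ _ (hausdorff k X + hausdorff k X)).
    apply: lime_le; first by apply: is_cvg_nneseries => *; exact: Dge0.
    by apply: nearW => m; rewrite big_mkord.
  by rewrite lte_add_pinfty.
have tail := nneseries_tail_cvg Dfin (fun j _ => Dge0 j).
have An_far n : hausdorff k (An n) + hausdorff k B <= hausdorff k X.
  have n0 : (0 < n.+1%:R^-1 :> R)%R by rewrite invr_gt0.
  apply: (le_trans (@hausdorff_far _ _ k n.+1%:R^-1 (An n) B n0 _)).
    move=> x y [_ xn] [_ /negP]; rewrite -leNgt => cy.
    have := eucl_dist_lip fl (ltW xn) cy; rewrite /v.
    by set q := (_^-1)%R; move: (eucl_dist _ _) => p h; lra.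
  by apply: le_hausdorff => x [[]|[]].
have Asub n : hausdorff k A <= hausdorff k (An n) + \sum_(n <= j <oo) hausdorff k (D j).
  have AD : A `<=` An n `|` \bigcup_(j in ~` `I_n) D j.
    move=> x [Xx /= fx].
    have [xn|xn] := ltP (f x) (v n); first by left.
    have gap : (0 < c - f x)%R by rewrite subr_gt0.
    have [N _ HN] := near_infty_natSinv_lt (PosNum gap).
    have exm : exists m, (f x < v m)%R.
      exists N; have := HN N (leqnn N) => /=; rewrite /v.
      by set q := (_^-1)%R => h; lra.
    case: (ex_minnP exm) => -[|m] xm mmin.
      by left; split => //; apply: (lt_le_trans xm); exact: vS'.
    right; exists m.
      move=> /= mn; move: xn; rewrite leNgt => /negP; apply.
      by apply: (lt_le_trans xm); exact: vS'.
    split => //; rewrite xm andbT leNgt; apply/negP => /mmin.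
    by rewrite ltnn.
  apply: (le_trans (le_hausdorff k AD)).
  apply: (le_trans (outer_measureU2 _ _ _)); apply: leeD => //.
  exact: outer_measure_sigma_subadditive_tail.
have key n : hausdorff k A + hausdorff k B <=
    hausdorff k X + \sum_(n <= j <oo) hausdorff k (D j).
  apply: (le_trans (leeD2r _ (Asub n))).
  by rewrite addeAC leeD2r.
have cv : (hausdorff k X + \sum_(n <= j <oo) hausdorff k (D j)) @[n --> \oo] -->
    hausdorff k X + 0.
  apply: cvgeD => //; last exact: cvg_cst.
  by rewrite fin_num_adde_defl.
rewrite adde0 in cv.
by apply: (cvge_to_ge cv); apply: nearW.
Qed.

End hausdorff_measure.

Section hausdorff_borel.
Context {R : realType} {d : nat}.
Local Notation E := 'rV[R]_d.+1.
Implicit Types (k : nat).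

Lemma open_caratheodory k (O : set E) : open O -> (hausdorff k).-caratheodory O.
Proof.
move=> oO; rewrite (open_bigcup_bball oO) bigcup_mkcond.
apply: caratheodory_measurable_bigcup => i; case: ifP => _; last first.
  exact: caratheodory_measurable_set0.
rewrite /bball; case: unpickle => [p|]; last exact: caratheodory_measurable_set0.
apply: sublevel_caratheodory => x y.
rewrite (le_trans (ler_enorm_sub _ _))// opprB addrA subrK//.
Qed.

Lemma borel_caratheodory k (A : set (borel_space R d)) : measurable A ->
  (hausdorff k).-caratheodory (A : set E).
Proof.
move: A; apply: smallest_sub; last exact: open_caratheodory.
split => [|B cB|F cF].
- exact: caratheodory_measurable_set0.
- by rewrite setTD; exact: caratheodory_measurable_setC.
- exact: caratheodory_measurable_bigcup.
Qed.

Lemma hausdorff_semi_sigma_additive k :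
  semi_sigma_additive (hausdorff k : set (borel_space R d) -> \bar R).
Proof.
move=> F mF tF mbF.
have := @caratheodory_measure_sigma_additive R E
  (hausdorff k : {outer_measure set E -> \bar R}).
by apply => // [i|]; apply: borel_caratheodory.
Qed.

HB.instance Definition _ k := isMeasure.Build _ (borel_space R d) R
  (@hausdorff R d k) (@hausdorff0 R d k) (@hausdorff_ge0 R d k)
  (@hausdorff_semi_sigma_additive k).

End hausdorff_borel.

(** * Great subspheres of equal dimension have equal measure *)

Section great_subspheres.
Context {R : realType} {d : nat}.
Local Notation E := 'rV[R]_d.+1.
Implicit Types (x y : E) (k : nat).

(** Induction on the dimension: a normalized vector [w] of [L] completes an orthonormal basis of
    [L :&: orthv w]. *)
Lemma orthonormal_basis m (L : {vspace E}) : \dim L = m ->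
  exists b : 'I_m -> E, [/\ forall i, b i \in L,
    forall i j, dot (b i) (b j) = (i == j)%:R &
    forall y, y \in L -> y = \sum_i dot (b i) y *: b i].
Proof.
elim: m L => [L /eqP|m IH L dL].
  rewrite dimv_eq0 => /eqP ->; exists (fun=> 0); split => [[]//|[]//|y].
  by rewrite memv0 big_ord0 => /eqP.
have L0 : L != 0%VS by rewrite -dimv_eq0 dL.
pose w := unitv (vpick L).
have p0 : vpick L != 0 by rewrite vpick0.
have wL : w \in L by rewrite memvZ// memv_pick.
have ww : dot w w = 1 by exact: unitv_sphere.
have [_ H] := dim_capv_orthv L w.
have dL' : \dim (L :&: orthv w) = m.
  by apply/eqP; rewrite -eqSS -H ?dL//; exists w; rewrite ?ww ?oner_eq0.
have [b [bL bb bs]] := IH _ dL'.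
have bw i : dot (b i) w = 0.
  by have := bL i; rewrite memv_cap mem_orthv dotC => /andP[_ /eqP].
exists (fun i => oapp b w (unlift ord0 i)); split.
- move=> i; case: unliftP => [j _|_] //=.
  by have := bL j; rewrite memv_cap => /andP[].
- move=> i j; case: unliftP => [i' ->|->]; case: unliftP => [j' ->|->] /=.
  + by rewrite bb (inj_eq lift_inj).
  + by rewrite bw.
  + by rewrite dotC bw.
  + by rewrite ww.
- move=> y yL; rewrite big_ord_recl unlift_none/=.
  have := bs (y - dot w y *: w).
  rewrite memv_cap mem_orthv dotBr dotZr ww mulr1 subrr eqxx andbT.
  rewrite (memvB yL (memvZ _ wL)) => /(_ isT) e.
  rewrite -[LHS](subrK (dot w y *: w)) [in LHS]e addrC; congr (_ + _).
  apply: eq_bigr => i _; rewrite liftK/= dotBr dotZr bw mulr0 subr0//.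
Qed.

(** Carrying coordinates from one orthonormal basis to the other gives an isometry of [L'] onto [L].
    Exchanging [G] and [G'] turns the inequality into an equality. *)
Lemma great_subsphere_isometry k (G G' : set E) :
  great_subsphere k G -> great_subsphere k G' ->
  (hausdorff k G <= hausdorff k G')%E.
Proof.
move=> [L dL ->] [L' dL' ->].
have [b [bL bb bs]] := orthonormal_basis dL.
have [c [cL cc cs]] := orthonormal_basis dL'.
have dots (p q : 'I_k.+1 -> R) (a : 'I_k.+1 -> E) :
    (forall i j, dot (a i) (a j) = (i == j)%:R) ->
    dot (\sum_i p i *: a i) (\sum_i q i *: a i) = \sum_i p i * q i.
  move=> aa; rewrite dot_sumr; apply: eq_bigr => i _.
  rewrite dotZr dotC dot_sumr (bigD1 i)//= dotZr aa eqxx mulr1 big1.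
    by rewrite addr0 mulrC.
  by move=> j ji; rewrite dotZr aa eq_sym (negbTE ji) mulr0.
pose f y : E := \sum_i dot (c i) y *: b i.
have fB y z : f y - f z = f (y - z).
  by rewrite /f -sumrB; apply: eq_bigr => i _; rewrite dotBr scalerBl.
have fdot y : y \in L' -> dot (f y) (f y) = dot y y.
  by move=> yL; rewrite /f dots// [in RHS](cs y yL) dots.
have fL y : f y \in L by apply: memv_suml => i _; exact: memvZ.
have : (sphere `&` [set` L]) `<=` f @` (sphere `&` [set` L']).
  move=> x [sx xL]; pose y : E := \sum_i dot (b i) x *: c i.
  have yL : y \in L' by apply: memv_suml => i _; exact: memvZ.
  have fy : f y = x.
    rewrite [RHS](bs x xL); apply: eq_bigr => i _; congr (_ *: _).
    rewrite /y dot_sumr (bigD1 i)//= dotZr cc eqxx mulr1 big1 ?addr0// => j ji.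
    by rewrite dotZr cc eq_sym (negbTE ji) mulr0.
  by exists y => //; split => //; rewrite /sphere/= -(fdot _ yL) fy.
move=> /(le_hausdorff k)/le_trans; apply; apply: hausdorff_contraction => y z.
by move=> [_ yL] [_ zL]; rewrite /eucl_dist fB fdot// memvB.
Qed.

Lemma coordinate_great_subsphere k : (k <= d)%N ->
  great_subsphere k
    (sphere `&` [set x : E | forall i : 'I_d.+1, (k < i)%N -> x 0 i = 0]).
Proof.
move=> kd; pose e (i : 'I_d.+1) : E := delta_mx 0 i.
have ex i x : dot (e i) x = x 0 i.
  rewrite /dot (bigD1 i)//= mxE !eqxx mul1r big1 ?addr0// => j ji.
  by rewrite mxE (negbTE ji) andbF mul0r.
pose J m : {set 'I_d.+1} := finset (fun i : 'I_d.+1 => (m <= i)%N).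
exists (perpv e (J k.+1)); last first.
  congr (_ `&` _); apply/seteqP; split => x /=.
    by move=> H; apply/mem_perpv => i; rewrite finset.inE ex => /H.
  by move=> /mem_perpv H i ki; rewrite -ex H// finset.inE.
suff H m : (m <= d.+1)%N -> \dim (perpv e (J (d.+1 - m)%N)) = (d.+1 - m)%N.
  by have := H (d - k)%N; rewrite (_ : d.+1 - (d - k) = k.+1)%N; last lia; apply; lia.
elim: m => [_|m IH md].
  rewrite subn0 (_ : J _ = finset.set0) ?perpv0 ?dim_fullvE//.
  by apply/setP => i; rewrite !finset.inE leqNgt ltn_ord.
have j0 : (d.+1 - m.+1 < d.+1)%N by lia.
pose j := Ordinal j0.
have -> : J (d.+1 - m.+1)%N = (j |: J (d.+1 - m)%N)%SET.
  apply/setP => i; rewrite !finset.inE -val_eqE/=; lia.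
rewrite perpvU1; have [_ H] := dim_capv_orthv (perpv e (J (d.+1 - m)%N)) (e j).
have := IH (ltnW md); rewrite H; first by lia.
exists (e j); last by rewrite ex mxE !eqxx oner_eq0.
apply/mem_perpv => i; rewrite finset.inE ex mxE => ij.
by rewrite eqxx/= -val_eqE/=; case: eqP => // ji; move: ij; rewrite ji/=; lia.
Qed.

Lemma great_subsphere_measure k (G : set E) : (k <= d)%N ->
  great_subsphere k G ->
  hausdorff k G = hausdorff k
    (sphere `&` [set x : E | forall i : 'I_d.+1, (k < i)%N -> x 0 i = 0]).
Proof.
move=> kd gG; apply/eqP; rewrite eq_le.
by rewrite !great_subsphere_isometry//; exact: coordinate_great_subsphere.
Qed.

End great_subspheres.

(** * Open covers and the Hausdorff measure of compact sets *)

Section open_covers.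
Context {R : realType} {d : nat}.
Local Notation E := 'rV[R]_d.+1.
Implicit Types (A U : set E) (k : nat).

(** The open neighbourhood of radius [h] has diameter larger by at most [2 * h], and the gauge of a
    nonempty set is a continuous function of its diameter. *)
Lemma gauge_enlarge k U (e e' r : R) : small_sets e U -> e < e' -> 0 < r ->
  exists V, [/\ open V, U `<=` V, small_sets e' V &
    (hausdorff_gauge k V <= hausdorff_gauge k U + r%:E)%E].
Proof.
move=> Ue ee r0; have [->|U0] := eqVneq U set0.
  exists set0; split; [exact: open0|by []|by move=> ? ? []|].
  by rewrite hausdorff_gauge0 add0e lee_fin ltW.
have neU : U !=set0 by exact/set0P.
pose c := ball_volume R k; have c0 : 0 <= c by exact: ball_volume_ge0.
pose f (s : R) : R := c * (s / 2) ^+ k.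
have cf : continuous f.
  move=> s; apply: (@continuousM _ _ (fun=> c) (fun s : R => (s / 2) ^+ k)).
    exact: cst_continuous.
  apply: (@continuous_comp _ _ _ (fun s : R => s / 2) (fun s : R => s ^+ k)).
    by apply: (@continuousM _ _ id (fun=> 2^-1)); [exact: cvg_id|exact: cst_continuous].
  exact: exprn_continuous.
have /cvgrPdist_lt/(_ _ r0)/nbhs_ballP[dl /= dl0 Hdl] := cf (diam U).
(* The first bound gives [2 * h < dl], the range where continuity of [f] applies; the second keeps
   the enlarged set within diameter [e']. *)
pose h := Num.min (dl / 4) ((e' - e) / 2).
have h0 : 0 < h by rewrite lt_min !divr_gt0// subr_gt0.
have hd : h <= dl / 4 by rewrite ge_min lexx.
have he : h <= (e' - e) / 2 by rewrite ge_min lexx orbT.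
pose V : set E := \bigcup_(y in U) eball y h.
have VU x y : V x -> V y -> exists x' y', [/\ U x', U y' &
    eucl_dist x y <= eucl_dist x' y' + 2 * h].
  move=> [x' Ux xx] [y' Uy yy]; exists x', y'; split => //.
  have h1 := enorm_triangle x' x y; have h2 := enorm_triangle y' x' y.
  move: xx yy; rewrite /eball/= => xx yy; rewrite enormB in yy.
  change (enorm (x - y) <= enorm (x' - y') + 2 * h).
  move: (enorm (x - y)) (enorm (x - x')) (enorm (x' - y)) (enorm (x' - y'))
    (enorm (y' - y)) h1 h2 xx yy => p1 p2 p3 p4 p5 *; lra.
have UV : U `<=` V by move=> x Ux; exists x => //; exact: eball_center.
have [u0 Uu0] := neU.
exists V; split => //.
- by apply: bigcup_open => y _; exact: open_eball.
- move=> x y /VU/[apply] -[x' [y' [Ux Uy le]]].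
  by rewrite (le_trans le)//; have := Ue _ _ Ux Uy; lra.
- rewrite /hausdorff_gauge (negbTE U0) ifF; last first.
    by apply/negbTE/set0P; exists u0; exact: UV.
  have dV : diam V <= diam U + 2 * h.
    apply: diam_le; first by exists u0; exact: UV.
    move=> x y /VU/[apply] -[x' [y' [Ux Uy le]]].
    by rewrite (le_trans le)// lerD2r; exact: le_diam Ue Ux Uy.
  have dU0 := diam_ge0 U; have dV0 := diam_ge0 V.
  have fV : f (diam V) <= f (diam U + 2 * h).
    rewrite ler_wpM2l// lerXn2r ?nnegrE ?divr_ge0//; last first.
      by rewrite ler_pM2r ?invr_gt0.
    by rewrite addr_ge0// mulr_ge0// ltW.
  have := Hdl (diam U + 2 * h); rewrite /ball/= opprD addrA subrr sub0r normrN.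
  rewrite ger0_norm; last by rewrite mulr_ge0// ltW.
  move=> /(_ _); rewrite distrC => Hd.
  have hdl : 2 * h < dl by lra.
  have := le_lt_trans (ler_norm _) (Hd hdl).
  rewrite -EFinD lee_fin -/c -/(f (diam V)) -/(f (diam U)); lra.
Qed.

(** The strict inequality leaves a slack [r], of which the share [r / 2 ^ i.+1] is spent on
    enlarging the [i]-th covering set to an open one. *)
Lemma hausdorff_pre_open k A (e e' : R) (b : \bar R) : e < e' ->
  (hausdorff_pre k e A < b)%E ->
  exists O, [/\ open O, A `<=` O & (hausdorff_pre k e' O < b)%E].
Proof.
move=> ee /ereal_inf_ltP[_ [U [AU Ue] <-] lt].
have [r r0 Hr] : exists2 r : R, 0 < r &
    ((\sum_(0 <= i <oo) hausdorff_gauge k (U i)) + r%:E < b)%E.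
  have S0 : (0 <= \sum_(0 <= i <oo) hausdorff_gauge k (U i))%E.
    by apply: nneseries_ge0 => i _ _; exact: hausdorff_gauge_ge0.
  move: lt S0; set S := (\sum_(0 <= i <oo) _)%E.
  case: S => [s||]; [|by rewrite ltNge leey|by []].
  case: b => [b||]; last by [].
    2: by move=> _ _; exists 1 => //; rewrite -EFinD ltry.
  rewrite lte_fin => sb _; exists ((b - s) / 2); first by rewrite divr_gt0// subr_gt0.
  by rewrite -EFinD lte_fin; lra.
have H i : {V | [/\ open V, U i `<=` V, small_sets e' V &
    (hausdorff_gauge k V <= hausdorff_gauge k (U i) + (r / (2 ^ i.+1)%:R)%:E)%E]}.
  apply: cid; apply: (@gauge_enlarge k (U i) e e') => //; first exact: Ue.
  by rewrite divr_gt0// ltr0n expn_gt0.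
exists (\bigcup_i sval (H i)); split.
- by apply: bigcup_open => i _; case: (svalP (H i)).
- move=> x /AU[i _ Ux]; exists i => //; by case: (svalP (H i)) => _ /(_ _ Ux).
- apply: le_lt_trans Hr.
  apply: (@le_trans _ _ (\sum_(0 <= i <oo) hausdorff_gauge k (sval (H i)))%E).
    apply: ereal_inf_lbound; exists (fun i => sval (H i)) => //; split => //.
    by move=> i x y; case: (svalP (H i)) => _ _ + _; exact.
  apply: le_trans (epsilon_trick _ _ (ltW r0)); last first.
    by move=> i; exact: hausdorff_gauge_ge0.
  apply: lee_nneseries => [i _ _|i _]; first exact: hausdorff_gauge_ge0.
  by case: (svalP (H i)).
Qed.

(** An open neighbourhood of a compact set can be shrunk to a finite union of basic balls. An upper
    bound on the Hausdorff measure thus becomes a countable condition in which [A] occurs only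
    through inclusions in open sets. *)
Lemma hausdorff_compact_le k A (a : R) : compact A ->
  (hausdorff k A <= a%:E)%E <-> forall m : nat, exists2 s : seq nat,
    (hausdorff_pre k m.+1%:R^-1 (bunion s : set E) < (a + m.+1%:R^-1)%:E)%E &
    A `<=` bunion s.
Proof.
have m0 m : 0 < m.+1%:R^-1 :> R by rewrite invr_gt0.
move=> cA; split => [H m|H].
  have m20 : 0 < m.+1%:R^-1 / 2 :> R by rewrite divr_gt0.
  have [||O [oO AO HO]] := @hausdorff_pre_open k A (m.+1%:R^-1 / 2) m.+1%:R^-1
      (a + m.+1%:R^-1)%:E.
  - by rewrite gtr_pMr// invf_lt1// ltr1n.
  - apply: (@le_lt_trans _ _ a%:E); last by rewrite lte_fin ltrDl.
    exact: le_trans (hausdorff_pre_le _ _ m20) H.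
  have [s [As sO]] := compact_bunion cA oO AO.
  by exists s => //; apply: le_lt_trans HO; exact: le_hausdorff_pre.
apply/ereal_supP => _ [e /= e0 <-]; apply/lee_addgt0Pr => r r0.
have e1 : 0 < Num.min e r by rewrite lt_min e0.
have [m _ Hm] := near_infty_natSinv_lt (PosNum e1).
have := Hm m (leqnn m); rewrite /= lt_min => /andP[me mr].
have [s hs As] := H m.
apply: (le_trans (hausdorff_pre_anti k A (ltW me))).
apply: (le_trans (le_hausdorff_pre _ _ As)); apply: (le_trans (ltW hs)).
by rewrite -EFinD lee_fin lerD2l ltW.
Qed.

End open_covers.

(** * Measurability of maps into the space of convex bodies *)

Section convex_bodies.
Context {R : realType} {d : nat}.
Local Notation E := 'rV[R]_d.+1.
Implicit Types (x y : E) (K L O C : set E).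

Lemma cone_scale C x (a : R) : convex_cone C -> C x -> 0 <= a -> C (a *: x).
Proof.
by move=> [_ H] Cx a0; have := H x x a 0 Cx Cx a0 (lexx 0); rewrite scale0r addr0.
Qed.

Lemma convex_body_sphere K : convex_body K -> K `<=` sphere.
Proof. by move=> [C [_ _ _ ->]] x []. Qed.

Lemma convex_body_closed K : convex_body K -> closed K.
Proof.
by move=> [C [cC _ _ ->]]; apply: closedI => //; exact: closed_sphere.
Qed.

Lemma convex_body_compact K : convex_body K -> compact K.
Proof.
move=> bK; apply: subclosed_compact (compact_sphere) (convex_body_sphere bK).
exact: convex_body_closed.
Qed.

Lemma convex_body_neq0 K : convex_body K -> K !=set0.
Proof.
move=> [C [cC ccC C0 ->]].
have [x [Cx x0]] : exists x, C x /\ x != 0.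
  apply: contrapT => H; apply: C0; apply/seteqP; split => [x Cx /=|_ ->].
    by apply/eqP/negPn/negP => x0; apply: H; exists x.
  by case: ccC.
exists (unitv x); split; last exact: unitv_sphere.
by apply: cone_scale => //; rewrite invr_ge0 enorm_ge0.
Qed.

Lemma dot_sphere x y : sphere x -> sphere y ->
  dot x y = 1 - enorm (x - y) ^+ 2 / 2.
Proof.
by move=> sx sy; rewrite enorm_sqr dotBl !dotBr sx sy (dotC y x); field.
Qed.

Lemma dot_sphere_itv x y : sphere x -> sphere y -> -1 <= dot x y <= 1.
Proof.
move=> /sphereP sx /sphereP sy; rewrite -ler_norml.
by rewrite (le_trans (cauchy_schwarz x y))// sx sy mulr1.
Qed.

(** Angle and chord determine each other: the cosine of [geodesic_dist x y] is
    [1 - enorm (x - y) ^+ 2 / 2], and [cos] decreases on [[0, pi]]. With the next lemma, the two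
    distances are uniformly equivalent on the sphere. *)
Lemma geodesic_small (e : R) : 0 < e -> exists2 dl, 0 < dl &
  forall x y, sphere x -> sphere y -> enorm (x - y) < dl -> geodesic_dist x y < e.
Proof.
move=> e0; pose e' := Num.min e pi.
have e'0 : 0 < e' by rewrite lt_min e0 pi_gt0.
have e'pi : e' <= pi by rewrite ge_min lexx orbT.
have e'I : e' \in `[0, pi] by rewrite in_itv/= e'pi ltW.
have I0 : (0 : R) \in `[0, pi] by rewrite in_itv/= lexx pi_ge0.
have c1 : cos e' < 1 by rewrite -(@cos0 R) ltr_cos.
(* For [0 <= t < 1] one has [t ^+ 2 / 2 <= t], so that [t < 1 - cos e'] suffices and no square root
   is needed. *)
exists (Num.min 1 (1 - cos e')); first by rewrite lt_min ltr01 subr_gt0.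
move=> x y sx sy; rewrite lt_min => /andP[d1 d2].
have [/andP[g0 gpi] cg] := acos_def (dot_sphere_itv sx sy).
have gI : geodesic_dist x y \in `[0, pi] by rewrite in_itv/= g0.
apply: (@lt_le_trans _ _ e'); last by rewrite ge_min lexx.
rewrite -ltr_cos// /geodesic_dist cg dot_sphere//.
have := enorm_ge0 (x - y); move: (enorm (x - y)) d1 d2 => t; nra.
Qed.

Lemma geodesic_enorm (dl : R) : 0 < dl -> exists2 e, 0 < e &
  forall x y, sphere x -> sphere y -> geodesic_dist x y < e -> enorm (x - y) < dl.
Proof.
(* The truncation at [0] keeps the argument of [acos] in its domain when [dl] is large. *)
move=> dl0; pose c := Num.max 0 (1 - dl ^+ 2 / 2).
have c0 : 0 <= c by rewrite le_max lexx.
have c1 : c < 1 by rewrite gt_max ltr01/= ltrBlDl ltrDr divr_gt0// exprn_gt0.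
have cI : -1 <= c <= 1 by rewrite (le_trans _ c0) ?lerN10//= ltW.
have [/andP[a0 api] ca] := acos_def cI.
exists (acos c); first by apply: acos_gt0; rewrite c1 andbT (le_trans _ c0)// lerN10.
move=> x y sx sy gc.
have [/andP[g0 gpi] cg] := acos_def (dot_sphere_itv sx sy).
have gI : geodesic_dist x y \in `[0, pi] by rewrite in_itv/= g0.
have aI : acos c \in `[0, pi] by rewrite in_itv/= a0.
have : cos (acos c) < cos (geodesic_dist x y) by rewrite ltr_cos.
rewrite ca /geodesic_dist cg dot_sphere// gt_max => /andP[_ h].
rewrite -(@ltr_pXn2r _ 2) ?nnegrE ?enorm_ge0 ?(ltW dl0)//; lra.
Qed.

Lemma geodesic_ge0 x y : sphere x -> sphere y -> 0 <= geodesic_dist x y.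
Proof. by move=> sx sy; apply: acos_ge0; exact: dot_sphere_itv. Qed.

Lemma geodesic_lepi x y : sphere x -> sphere y -> geodesic_dist x y <= pi.
Proof. by move=> sx sy; apply: acos_lepi; exact: dot_sphere_itv. Qed.

Lemma has_inf_geodesic x L : sphere x -> convex_body L ->
  has_inf [set geodesic_dist x y | y in L].
Proof.
move=> sx bL; have [y Ly] := convex_body_neq0 bL.
split; first by exists (geodesic_dist x y), y.
by exists 0 => _ [z Lz <-]; apply: geodesic_ge0 => //; exact: convex_body_sphere Lz.
Qed.

Lemma hausdorff_excess_lt K L (e : R) : convex_body K -> convex_body L ->
  hausdorff_excess K L < e -> forall x, K x -> exists2 y, L y & geodesic_dist x y < e.
Proof.
move=> bK bL lt x Kx; have sx := convex_body_sphere bK Kx.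
have hi := has_inf_geodesic sx bL.
have : inf [set geodesic_dist x y | y in L] < e.
  apply: le_lt_trans lt; apply: ub_le_sup; last by exists x.
  exists pi => _ [z Kz <-]; have sz := convex_body_sphere bK Kz.
  have [y Ly] := convex_body_neq0 bL.
  apply: (@le_trans _ _ (geodesic_dist z y)).
    apply: ge_inf; last by exists y.
    by case: (has_inf_geodesic sz bL).
  by apply: geodesic_lepi => //; exact: convex_body_sphere Ly.
move=> h; have h0 : 0 < e - inf [set geodesic_dist x y | y in L] by rewrite subr_gt0.
have [_ [y Ly <-]] := inf_adherent h0 hi.
by rewrite addrC subrK => ?; exists y.
Qed.

Lemma hausdorff_excess_le K L (e : R) : convex_body K -> convex_body L ->
  (forall x, K x -> exists2 y, L y & geodesic_dist x y <= e) ->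
  hausdorff_excess K L <= e.
Proof.
move=> bK bL H; apply: ge_sup.
  have [x Kx] := convex_body_neq0 bK.
  by exists (inf [set geodesic_dist x y | y in L]), x.
move=> _ [x Kx <-]; have [y Ly xy] := H x Kx; apply: le_trans xy.
have sx := convex_body_sphere bK Kx.
by apply: ge_inf; [case: (has_inf_geodesic sx bL)|exists y].
Qed.

Definition hits O : set (body_space R d) :=
  [set K | convex_body K /\ K `&` O !=set0].

(** The condition asks that the points of [K] be near [L], which one half of the Hausdorff distance
    controls. It serves for lower semicontinuous properties: hitting an open set, spanning a given
    dimension. *)
Lemma hausdorff_open_near (Q : set (set E)) :
  (forall K, convex_body K -> Q K -> exists2 dl : R, 0 < dl &
    forall L, convex_body L ->
      (forall x, K x -> exists2 y, L y & enorm (x - y) < dl) -> Q L) ->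
  hausdorff_open [set K | convex_body K /\ Q K].
Proof.
move=> H; split => [K []//|K [bK QK]].
have [dl dl0 Hdl] := H K bK QK; have [e e0 He] := geodesic_enorm dl0.
exists e => // L bL; rewrite gt_max => /andP[KL _]; split => //.
apply: Hdl => // x Kx.
have [y Ly xy] := hausdorff_excess_lt bK bL KL Kx; exists y => //.
by apply: He => //; [exact: convex_body_sphere Kx|exact: convex_body_sphere Ly].
Qed.

Lemma hausdorff_open_hits O : open O -> hausdorff_open (hits O).
Proof.
move=> oO; apply: hausdorff_open_near => K bK [x [Kx Ox]].
have [e e0 eO] := (open_eballP _).1 oO x Ox.
exists e => // L bL /(_ x Kx)[y Ly xy]; exists y; split => //.
by apply: eO; rewrite /eball/= enormB.
Qed.

Lemma measurable_hits O : open O -> measurable (hits O).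
Proof. by move=> oO; apply: sub_sigma_algebra; exact: hausdorff_open_hits. Qed.

Lemma measurable_convex_body : measurable (convex_body : set (body_space R d)).
Proof.
apply: sub_sigma_algebra; split => // K _; exists 1 => //.
Qed.

(** A compact [K] that misses the closed set [C] misses one of its neighbourhoods of radius
    [m.+1%:R^-1]; otherwise points of [K] ever closer to [C] would cluster at a common point. *)
Lemma measurable_avoids C : closed C ->
  measurable ([set K | convex_body K /\ K `&` C = set0] : set (body_space R d)).
Proof.
move=> cC.
pose N m : set E := \bigcup_(y in C) eball y (m.+1%:R^-1).
have -> : [set K | convex_body K /\ K `&` C = set0] =
    \bigcup_m ((convex_body : set (body_space R d)) `\` hits (N m)).
  apply/seteqP; split=> [K [bK KC]|K [m _ [bK nh]]]; last first.
    split => //; apply/seteqP; split => // x [Kx Cx]; apply: nh; split => //.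
    by exists x; split => //; exists x => //; apply: eball_center; rewrite invr_gt0.
  apply: contrapT => H.
  have {}H m : exists x, K x /\ N m x.
    apply: contrapT => nx; apply: H; exists m => //; split => // -[_ [x xx]].
    by apply: nx; exists x.
  have [x xP] := choice H.
  have cK := convex_body_compact bK.
  have [|y [Ky cly]] := cK (x @ \oo) _.
    by exists 0%N => // m _ /=; case: (xP m).
  suff Cy : C y by have : (K `&` C) y by []; rewrite KC.
  apply: (closed_eballP _).1 cC _ _ => e e0.
  have e2 : 0 < e / 2 by rewrite divr_gt0.
  have [M _ HM] := near_infty_natSinv_lt (PosNum e2).
  have [] := cly [set z | exists2 m, (M <= m)%N & z = x m] (eball y (e / 2)).
  - by exists M => // m /= Mm; exists m.
  - by apply/nbhs_eball; exists (e / 2).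
  move=> _ [[m Mm ->] xy]; have [_ [c Cc xc]] := xP m; exists c => //.
  have := HM m Mm; move: xc xy; rewrite /eball/= => xc xy mE.
  rewrite (le_lt_trans (enorm_triangle (x m) _ _))// enormB.
  move: xc xy mE; set q := _^-1; move: (enorm _) (enorm _) => p p' *; lra.
apply: bigcupT_measurable => m; apply: measurableD; first exact: measurable_convex_body.
by apply: measurable_hits; apply: bigcup_open => y _; exact: open_eball.
Qed.

Lemma sphere_net (r : R) : 0 < r -> exists N, forall x, sphere x ->
  exists2 j : 'I_N, sphere (sphvec (j : nat) : E) & enorm (x - sphvec j) < r.
Proof.
move=> r0; have := @compact_sphere R d; rewrite compact_cover.
move=> /(_ nat [set j | sphere (sphvec j : E)] (fun j => eball (sphvec j) r)) [].
- by move=> i _; exact: open_eball.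
- move=> x sx; have [j [sj jx]] := sphvec_dense sx r0; exists j => //.
  by rewrite /eball/= enormB.
move=> D DS cD; exists (\max_(i <- finmap.enum_fset D) i).+1 => x /cD[i /= iD xi].
have iN : (i < (\max_(i <- finmap.enum_fset D) i).+1)%N.
  by rewrite ltnS (big_rem i)//= leq_maxl.
by exists (Ordinal iN) => //=; have := DS i iD; rewrite inE.
Qed.

End convex_bodies.

(** * A measurability criterion for body-valued maps *)

Section measurable_bodies.
Context {R : realType} {d : nat} {dX : measure_display} {X : measurableType dX}.
Local Notation E := 'rV[R]_d.+1.

Definition ball_pattern (m N : nat) (K : set E) : {set 'I_N} :=
  finset (fun j : 'I_N => `[< K `&` eball (sphvec j) m.+1%:R^-1 !=set0 >]).

(** Two bodies that hit the same small balls around the points of a net are close in Hausdorff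
    distance. So the preimage of a Hausdorff-open set is a countable union over finite hitting
    patterns, each of them a finite combination of hitting events. *)
Lemma body_measurable (D : set X) (f : X -> body_space R d) : measurable D ->
  (forall x, D x -> convex_body (f x)) ->
  (forall O, open O -> measurable (D `&` [set x | f x `&` O !=set0])) ->
  measurable_fun D f.
Proof.
move=> mD fb fO.
apply: (@measurability _ _ _ _ D f (@hausdorff_open R d)) => //.
move=> _ [V [Vb oV] <-].
pose valid m N (p : {set 'I_N}) :=
  forall K, convex_body K -> ball_pattern m N K = p -> V K.
have -> : D `&` f @^-1` V = \bigcup_m \bigcup_N
    \bigcup_(p in [set p : {set 'I_N} | valid m N p])
      (D `&` [set x | ball_pattern m N (f x) = p]).
  apply/seteqP; split=> [x [Dx /= Vx]|x [m _ [N _ [p vp [Dx px]]]]]; last first.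
    by split => //; apply: vp px; exact: fb.
  have [e e0 He] := oV _ Vx; have e2 : 0 < e / 2 by rewrite divr_gt0.
  have [dl dl0 Hdl] := geodesic_small (d := d) e2.
  have dl2 : 0 < dl / 2 by rewrite divr_gt0.
  have [m _ Hm] := near_infty_natSinv_lt (PosNum dl2).
  have /= mdl := Hm m (leqnn m).
  have m0 : 0 < m.+1%:R^-1 :> R by rewrite invr_gt0.
  have [N HN] := sphere_net (d := d) m0.
  exists m => //; exists N => //; exists (ball_pattern m N (f x)) => //.
  move=> L bL pL; apply: He => //.
  have close (A B : set E) : convex_body A -> convex_body B ->
      ball_pattern m N A = ball_pattern m N B ->
      hausdorff_excess A B <= e / 2.
    move=> bA bB pAB; apply: hausdorff_excess_le => // y Ay.
    have sy := convex_body_sphere bA Ay.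
    have [j sj yj] := HN y sy.
    have : j \in ball_pattern m N A by rewrite finset.inE; apply/asboolP; exists y.
    rewrite pAB finset.inE => /asboolP[z [Bz zj]]; exists z => //.
    apply/ltW/Hdl => //; first exact: convex_body_sphere Bz.
    rewrite (le_lt_trans (enorm_triangle (sphvec j) _ _))//.
    rewrite (enormB (sphvec j)); move: zj yj mdl; rewrite /eball/=.
    set q := _^-1; move: (enorm _) (enorm _) => p p' *; lra.
  have bx := fb _ Dx.
  apply: (@le_lt_trans _ _ (e / 2)); last by lra.
  by rewrite ge_max !close.
apply: bigcupT_measurable => m; apply: bigcupT_measurable => N.
apply: fin_bigcup_measurable; first exact: finite_finset.
move=> p _.
have -> : D `&` [set x | ball_pattern m N (f x) = p] =
    D `&` \bigcap_(j in [set: 'I_N]) (if j \in p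
      then D `&` [set x | f x `&` eball (sphvec j) m.+1%:R^-1 !=set0]
      else D `\` (D `&` [set x | f x `&` eball (sphvec j) m.+1%:R^-1 !=set0])).
  apply/seteqP; split => x [Dx H]; split => //.
    move=> j _; rewrite -H finset.inE; case: asboolP => h; first by split.
    by split => // -[].
  apply/setP => j; have := H j Logic.I; rewrite finset.inE.
  case: (boolP (j \in p)) => jp [Dx' h]; first exact/asboolP.
  by apply/negbTE/negP => /asboolP h'; apply: h.
apply: measurableI => //; apply: fin_bigcap_measurable; first exact: finite_finset.
move=> j _; have mj := fO _ (@open_eball R d (sphvec j) m.+1%:R^-1).
by case: ifP => _ //; apply: measurableD.
Qed.

End measurable_bodies.

(** * Set-valued maps measurable by approximation *)

Section approximable.
Context {R : realType} {d : nat} {dX : measure_display} {X : measurableType dX}.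
Local Notation E := 'rV[R]_d.+1.
Implicit Types (D : set X) (f : X -> set E).

(* [A r q] is a countable-resolution surrogate for "[f x] comes within about
   [1/r] of [q]"; compactness turns it into measurability of [f] itself. *)
Definition approximates D f (A : nat -> E -> set X) :=
  [/\ forall r q, measurable (D `&` A r q),
      forall x y r, D x -> f x y -> \forall q \near y, A r q x &
      forall x y, D x -> (forall r (U : set E), nbhs y U ->
        exists r' q, [/\ (r <= r')%N, U q & A r' q x]) -> f x y].

Definition approximable D f := exists A, approximates D f A.

(** If for every [r] some rational point near [C] satisfies the surrogate, the nearby points of [C]
    cluster at a point of [C], which the last clause of [approximates] puts in [f x]. *)
Lemma approximable_compact_hits D f (C : set E) : measurable D -> compact C ->
  approximable D f -> measurable (D `&` [set x | f x `&` C !=set0]).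
Proof.
move=> mD cC [A [mA sA cA]].
have -> : D `&` [set x | f x `&` C !=set0] =
    D `&` \bigcap_r \bigcup_(j in [set j | exists2 c, C c &
                        enorm (ratvec j - c) < r.+1%:R^-1]) (D `&` A r (ratvec j)).
  apply/seteqP; split=> [x [Dx [y [fy Cy]]]|x [Dx H]]; split => //.
    move=> r _; have [e e0 He] := (nbhs_eball _ _).1 (sA x y r Dx fy).
    have e10 : 0 < Num.min e r.+1%:R^-1 by rewrite lt_min e0 invr_gt0/=.
    have [j] := ratvec_dense y e10; rewrite lt_min => /andP[j1 j2].
    by exists j; [exists y|split => //; exact: He].
  have H' r : exists qc : E * E, [/\ C qc.2,
      enorm (qc.1 - qc.2) < r.+1%:R^-1 & A r qc.1 x].
    by have [j [c Cc jc] [_ Ar]] := H r Logic.I; exists (ratvec j, c).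
  have [qc qcP] := choice H'.
  have [|y [Cy cly]] := cC ((snd \o qc) @ \oo) _.
    by exists 0%N => // m _ /=; case: (qcP m).
  exists y; split => //; apply: cA => // r U /nbhs_eball[e e0 eU].
  have e2 : 0 < e / 2 by rewrite divr_gt0.
  have [M _ HM] := near_infty_natSinv_lt (PosNum e2).
  have [] := cly [set z | exists2 m, (maxn r M <= m)%N & z = (qc m).2] (eball y (e / 2)).
  - by exists (maxn r M) => // m /= Mm; exists m.
  - by apply/nbhs_eball; exists (e / 2).
  move=> _ [[m Mm ->] xy]; exists m, (qc m).1.
  move: Mm; rewrite geq_max => /andP[rm Mm]; split => //; last by case: (qcP m).
  apply: eU; rewrite /eball/=.
  have [_ h1 _] := qcP m; have /= h2 := HM m Mm.
  rewrite (le_lt_trans (enorm_triangle (qc m).2 _ _))//.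
  move: h1 xy h2; rewrite /eball/=; set q := _^-1.
  move: (enorm _) (enorm _) => p p' *; lra.
apply: measurableI => //; apply: bigcapT_measurable => r.
by apply: bigcup_measurable => j _; exact: mA.
Qed.

(** An open set is a countable union of closed basic balls; on the sphere these are compact, so the
    compact case decides whether the body hits it. *)
Lemma approximable_body_measurable D (f : X -> body_space R d) : measurable D ->
  (forall x, D x -> convex_body (f x)) -> approximable D f ->
  measurable_fun D f.
Proof.
move=> mD fb af; apply: body_measurable => // O oO.
pose B i : set E := sphere `&` closure (bball i).
have cB i : compact (B i).
  apply: subclosed_compact (compact_sphere) _; last by move=> x [].
  by apply: closedI; [exact: closed_sphere|exact: closed_closure].
have -> : D `&` [set x | f x `&` O !=set0] =
    \bigcup_(i in [set i | closure (bball i) `<=` O])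
      (D `&` [set x | f x `&` B i !=set0]).
  apply/seteqP; split=> [x [Dx [y [fy Oy]]]|x [i iO [Dx [y [fy [_ By]]]]]]; last first.
    by split => //; exists y; split => //; exact: iO.
  have [e e0 eO] := (open_eballP _).1 oO y Oy.
  have e2 : 0 < e / 2 by rewrite divr_gt0.
  have [i [iy ie]] := bball_nbhs y e2.
  exists i.
    move=> z /= cz; apply: eO.
    have [|w [/ie wy wz]] := cz (eball z (e / 2)).
      by apply/nbhs_eball; exists (e / 2).
    rewrite /eball/= (le_lt_trans (enorm_triangle w _ _))// enormB.
    by move: wy wz; rewrite /eball/=; move: (enorm _) (enorm _) => p p' *; lra.
  split => //; exists y; split => //; split; last exact: subset_closure.
  exact: convex_body_sphere (fb _ Dx) _ fy.
by apply: bigcup_measurable => i _; exact: approximable_compact_hits.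
Qed.

(** This stability is the reason for the notion: that two sets both hit [O] says nothing about their
    intersection, whereas surrogates satisfied at the same [q] close up to a common point. *)
Lemma approximableI D f g : approximable D f -> approximable D g ->
  approximable D (fun x => f x `&` g x).
Proof.
move=> [A [mA sA cA]] [B [mB sB cB]].
exists (fun r q => A r q `&` B r q); split.
- move=> r q; rewrite (_ : _ `&` _ = (D `&` A r q) `&` (D `&` B r q)).
    exact: measurableI.
  by apply/seteqP; split=> [x [? []]|x [[? ?] []]].
- by move=> x y r Dx [fy gy]; apply: filterI; [exact: sA|exact: sB].
- move=> x y Dx H; split.
    by apply: cA => // r U /(H r)[r' [q [? ? []]]]; exists r', q.
  by apply: cB => // r U /(H r)[r' [q [? ? []]]]; exists r', q.
Qed.

Lemma approximable_forall (I : finType) D (f : I -> X -> set E) : measurable D ->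
  (forall i, approximable D (f i)) ->
  approximable D (fun x => [set y | forall i, f i x y]).
Proof.
move=> mD /choice[A AP].
exists (fun r q => [set x | forall i, A i r q x]); split.
- move=> r q; have -> : D `&` [set x | forall i, A i r q x] =
      D `&` \bigcap_(i in [set: I]) (D `&` A i r q).
    apply/seteqP; split=> [x [Dx H]|x [Dx H]]; split => // i.
    by have [] := H i Logic.I.
  apply: measurableI => //; apply: fin_bigcap_measurable => [|i _].
    exact: finite_finset.
  by have [] := AP i.
- move=> x y r Dx fy; have H i : \forall q \near y, A i r q x by have [_ h _] := AP i; exact: h.
  exact: (@filter_forall _ _ _ _ (nbhs_filter y) H).
- move=> x y Dx H i; have [_ _] := AP i; apply => // r U /(H r)[r' [q [? ? Ai]]].
  by exists r', q.
Qed.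

Lemma approximable_body D (g : X -> body_space R d) : measurable D ->
  (forall x, D x -> convex_body (g x)) -> measurable_fun D g ->
  approximable D g.
Proof.
move=> mD bg mg; exists (fun r q => [set x | g x `&` eball q r.+1%:R^-1 !=set0]).
split.
- move=> r q; have := mg mD _ (measurable_hits (@open_eball R d q r.+1%:R^-1)).
  congr measurable; apply/seteqP; split=> [x [Dx [_ H]]|x [Dx H]]; split => //.
  by split => //; exact: bg.
- move=> x y r Dx gy; apply/nbhs_eball; exists r.+1%:R^-1; first by rewrite invr_gt0.
  by move=> q yq /=; exists y; split => //; rewrite /eball/= enormB.
- move=> x y Dx H; apply: (closed_eballP _).1 (convex_body_closed (bg _ Dx)) _ _ => e e0.
  have e2 : 0 < e / 2 by rewrite divr_gt0.
  have [M _ HM] := near_infty_natSinv_lt (PosNum e2).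
  have [|r' [q [Mr qy [z [gz zq]]]]] := H M (eball y (e / 2)).
    by apply/nbhs_eball; exists (e / 2).
  exists z => //; have /= h2 := HM r' Mr.
  rewrite (le_lt_trans (enorm_triangle q _ _))//.
  move: zq qy h2; rewrite /eball/=; set w := _^-1.
  move: (enorm _) (enorm _) => p p' *; lra.
Qed.

(** Relaxing the inequality by [r.+1%:R^-1] makes it an open condition on the point; the relaxation
    vanishes as [r] grows. *)
Lemma approximable_ge0 D (c : X -> E -> R) : measurable D ->
  (forall q, measurable_fun D (c ^~ q)) -> (forall x, D x -> continuous (c x)) ->
  approximable D (fun x => [set y | 0 <= c x y]).
Proof.
move=> mD mc cc; exists (fun r q => [set x | - r.+1%:R^-1 < c x q]); split.
- move=> r q; have := mc q mD _ (measurable_itv `]- r.+1%:R^-1, +oo[).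
  by congr measurable; apply/seteqP; split=> x [Dx]; rewrite /= in_itv/= andbT.
- move=> x y r Dx /= c0; have /cvgrPdist_lt/(_ r.+1%:R^-1) := cc x Dx y.
  rewrite invr_gt0 => /(_ (ltr0Sn _ _)); apply: filterS => q /=.
  rewrite ltr_norml => /andP[_]; set w := _^-1; lra.
- move=> x y Dx H; rewrite /= leNgt; apply/negP => c0.
  have c2 : 0 < - c x y / 2 by rewrite divr_gt0// oppr_gt0.
  have [M _ HM] := near_infty_natSinv_lt (PosNum c2).
  have /cvgrPdist_lt/(_ _ c2) := cc x Dx y => /(H M)[r' [q [Mr cq Aq]]].
  have := HM r' Mr; move: Aq cq => /=.
  rewrite ltr_norml => Aq /andP[cq _]; move: Aq cq; set w := _^-1; lra.
Qed.

Lemma approximable_sphere D : measurable D -> approximable D (fun=> sphere).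
Proof.
move=> mD.
(* An equation is put in the required form by taking minus an absolute value. *)
rewrite (_ : (fun=> _) = (fun=> [set y : E | 0 <= - `|dot y y - 1|])); last first.
  apply/funext => x; apply/seteqP; split => y /=.
    by rewrite /sphere/= => ->; rewrite subrr normr0 oppr0.
  by rewrite oppr_ge0 normr_le0 subr_eq0 => /eqP.
apply: approximable_ge0 => // x _ y.
have cd : continuous (fun y : E => dot y y).
  by apply: (@continuous_dot2 _ _ _ id id) => z; exact: cvg_id.
apply: (@continuousN _ _ _ (fun y : E => `|dot y y - 1|)).
apply: (@continuous_comp _ _ _ (fun y : E => dot y y - 1) (fun s : R => `|s|)).
  by apply: (@continuousB _ _ _ (fun y : E => dot y y) (fun=> 1)); [exact: cd|exact: cst_continuous].
exact: norm_continuous.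
Qed.

End approximable.

(** * Borel measurability of vectors and of families of vectors *)

Section measurable_vectors.
Context {R : realType} {d : nat}.
Local Notation E := 'rV[R]_d.+1.

Lemma measurable_enorm_dist dX (X : measurableType dX) (D : set X)
    (f : X -> borel_space R d) (q : E) :
  (forall i, measurable_fun D (fun x => (f x : E) 0 i)) ->
  measurable_fun D (fun x => enorm ((f x : E) - q)).
Proof.
move=> mf; have mD : measurable_fun D (fun x => dot ((f x : E) - q) ((f x : E) - q)).
  apply: measurable_sum => i.
  have H : measurable_fun D (fun x => ((f x : E) - q) 0 i).
    rewrite (_ : (fun x => _) = (fun x => (f x : E) 0 i - q 0 i)).
      by apply: measurable_funB => //; exact: mf.
    by apply/funext => x; rewrite !mxE.
  exact: measurable_funM.
apply: (@measurableT_comp _ _ _ _ _ _ (@Num.sqrt R) _ _ _ mD).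
by apply: continuous_measurable_fun; exact: sqrt_continuous.
Qed.

Lemma coord_measurable dX (X : measurableType dX) (D : set X)
    (f : X -> borel_space R d) : measurable D ->
  (forall i, measurable_fun D (fun x => (f x : E) 0 i)) -> measurable_fun D f.
Proof.
move=> mD mf; apply: (@measurability _ _ _ _ D f (@open E)) => //.
move=> _ [U oU <-].
rewrite (open_bigcup_bball oU) preimage_bigcup setI_bigcupr.
apply: bigcup_measurable => i _; rewrite /bball; case: unpickle => [p|]; last first.
  by rewrite preimage_set0 setI0.
have := measurable_enorm_dist (ratvec p.1) mf mD (measurable_itv `]-oo, p.2.+1%:R^-1[).
by congr measurable; apply/seteqP; split=> x [Dx] /=; rewrite in_itv.
Qed.

Lemma measurable_coord i :
  measurable_fun [set: borel_space R d] (fun x => (x : E) 0 i).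
Proof.
move=> mT; apply: (measurability _ (RGenOInfty.measurableE R)) => //.
move=> _ [_ [x ->] <-]; rewrite setTI; apply: measurable_open.
have /continuousP H := @coord_continuous R 1 d.+1 0 i.
apply: H; rewrite set_itvoy; exact: open_gt.
Qed.

Lemma measurable_dot dX (X : measurableType dX) (D : set X)
    (f g : X -> borel_space R d) :
  measurable_fun D f -> measurable_fun D g ->
  measurable_fun D (fun x => dot (f x : E) (g x : E)).
Proof.
move=> mf mg; apply: measurable_sum => i; apply: measurable_funM.
  exact: (measurableT_comp (measurable_coord i) mf).
exact: (measurableT_comp (measurable_coord i) mg).
Qed.

End measurable_vectors.

Section vector_families.
Context {R : realType} {d : nat}.
Local Notation E := 'rV[R]_d.+1.

Definition box n (A : 'I_n -> set (borel_space R d)) : set ('I_n -> E) :=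
  [set u | forall i, A i (u i)].

Definition boxes n : set (set ('I_n -> E)) :=
  [set box A | A in [set A | forall i, measurable (A i)]].

(** The generating boxes are stable under intersection, so a finite measure is determined by its
    values on them. *)
Definition vecs n := g_sigma_algebraType (@boxes n).

Lemma measurable_box n (A : 'I_n -> set (borel_space R d)) :
  (forall i, measurable (A i)) -> measurable (box A : set (vecs n)).
Proof. by move=> mA; apply: sub_sigma_algebra; exists A. Qed.

Lemma measurable_nth n (i : 'I_n) :
  measurable_fun setT ((fun u => u i) : vecs n -> borel_space R d).
Proof.
move=> _ B mB; rewrite setTI.
rewrite (_ : _ @^-1` _ = box (fun j => if j == i then B else setT)).
  by apply: measurable_box => j; case: ifP.
apply/seteqP; split => u /= H; last by have := H i; rewrite eqxx.
by move=> j; case: eqP => [->|].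
Qed.

Lemma measurable_to_vecs dX (X : measurableType dX) n (f : X -> vecs n) :
  (forall i, measurable_fun setT ((fun x => f x i) : X -> borel_space R d)) ->
  measurable_fun setT f.
Proof.
move=> mf; apply: (@measurability _ _ _ (vecs n) setT f (@boxes n)) => //.
move=> _ [_ [A mA <-] <-]; rewrite setTI.
rewrite (_ : _ @^-1` _ = \bigcap_(i in [set: 'I_n])
    ((fun x => f x i) @^-1` (A i))).
  apply: fin_bigcap_measurable => [|i _]; first exact: finite_finset.
  by rewrite -[X in measurable X]setTI; exact: mf.
by apply/seteqP; split=> x H i //=; apply: H.
Qed.

End vector_families.

Section measurable_faces.
Context {R : realType} {d : nat} {dX : measure_display} {X : measurableType dX}.
Local Notation E := 'rV[R]_d.+1.

Definition greatv n (u : 'I_n -> E) : set E :=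
  sphere `&` [set y | forall i, dot (u i) y = 0].

Lemma measurable_dotl (D : set X) (f : X -> borel_space R d) (q : E) :
  measurable_fun D f -> measurable_fun D (fun x => dot (f x : E) q).
Proof. by move=> mf; apply: (measurable_dot mf); exact: measurable_cst. Qed.

Lemma approximable_greatv n (D : set X) (u : 'I_n -> X -> borel_space R d) :
  measurable D -> (forall i, measurable_fun D (u i)) ->
  approximable D (fun t => greatv (fun i => u i t : E)).
Proof.
move=> mD mu; apply: approximableI; first exact: approximable_sphere.
apply: (@approximable_forall _ _ _ _ _ D
  (fun i t => [set y : E | dot (u i t : E) y = 0])) => // i.
rewrite (_ : (fun t => _) = (fun t => [set y : E | 0 <= - `|dot (u i t : E) y|])); last first.
  apply/funext => t; apply/seteqP; split => y /=.
    by move=> ->; rewrite normr0 oppr0.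
  by rewrite oppr_ge0 normr_le0 => /eqP.
apply: approximable_ge0 => // [q|x _ y].
  apply: measurable_funN; apply: (measurableT_comp (@normr_measurable R setT)).
  exact: measurable_dotl.
apply: (@continuousN _ _ _ (fun y : E => `|dot (u i x : E) y|)).
apply: (@continuous_comp _ _ _ (dot (u i x : E)) (fun s : R => `|s|)).
  exact: continuous_dotr.
exact: norm_continuous.
Qed.

Lemma approximable_face_at n (D : set X) (u : 'I_n -> X -> borel_space R d)
    (p : X -> borel_space R d) :
  measurable D -> (forall i, measurable_fun D (u i)) -> measurable_fun D p ->
  approximable D (fun t => face_at (fun i => u i t : E) (p t : E)).
Proof.
move=> mD mu mp; apply: approximableI; first exact: approximable_sphere.
(* One inequality encodes both branches of [side]: if the product with [p t] is [0], only minus the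
   absolute value remains and forces an equation; otherwise the indicator vanishes. *)
pose c i t (y : E) : R := dot (u i t : E) (p t : E) * dot (u i t : E) y -
  \1_[set 0] (dot (u i t : E) (p t : E)) * `|dot (u i t : E) y|.
rewrite (_ : (fun t => _) = (fun t => [set y : E | forall i, 0 <= c i t y])); last first.
  apply/funext => t; apply/seteqP; split => y H i; have := H i.
    rewrite /c /side indicE; case: eqVneq => [->|u0].
      by move=> /eqP ->; rewrite mem_set// mul0r mul1r normr0 subrr.
    by rewrite memNset ?mul0r ?subr0//; exact/eqP.
  rewrite /c /side indicE; case: eqVneq => [->|u0].
    by rewrite mem_set// mul0r mul1r sub0r oppr_ge0 normr_le0.
  by rewrite memNset ?mul0r ?subr0//; exact/eqP.
apply: (@approximable_forall _ _ _ _ _ D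
  (fun i t => [set y : E | 0 <= c i t y])) => // i.
apply: approximable_ge0 => // [q|x _ y].
  have m1 : measurable_fun D (fun t => dot (u i t : E) (p t : E)) by exact: measurable_dot.
  have m2 : measurable_fun D (fun t => dot (u i t : E) q) by exact: measurable_dotl.
  apply: measurable_funB; apply: measurable_funM => //.
    apply: (@measurableT_comp _ _ _ _ _ _ (\1_[set 0] : R -> R) _ _ _ m1).
    by apply: measurable_indic; exact: measurable_set1.
  exact: (measurableT_comp (@normr_measurable R setT)).
have cd := @continuous_dotr R d (u i x : E) y.
apply: (@continuousB _ _ _ (fun y => dot (u i x : E) (p x : E) * dot (u i x : E) y)
  (fun y => \1_[set 0] (dot (u i x : E) (p x : E)) * `|dot (u i x : E) y|)).
  by apply: (@continuousM _ _ (fun=> _) (dot (u i x : E))); [exact: cst_continuous|].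
apply: (@continuousM _ _ (fun=> _) (fun y => `|dot (u i x : E) y|)).
  exact: cst_continuous.
apply: (@continuous_comp _ _ _ (dot (u i x : E)) (fun s : R => `|s|)) => //.
exact: norm_continuous.
Qed.

End measurable_faces.

(** * Dimension and the measurability of the set of great subspheres *)

Section dimension.
Context {R : realType} {d : nat}.
Local Notation E := 'rV[R]_d.+1.
Implicit Types (K L : set E).

(** The vectors [f i] represent the coordinate forms of [X]. Applied to a vanishing combination of
    [Y], they bound the sum [S] of the absolute values of its coefficients by [M / (M + 1) * S], so
    [S] is [0]. *)
Lemma free_near (X : seq E) : free X -> exists2 e : R, 0 < e &
  forall Y : seq E, size Y = size X ->
    (forall i, (i < size X)%N -> enorm (X`_i - Y`_i) < e) -> free Y.
Proof.
move=> fX; pose m := size X; pose tX : m.-tuple E := in_tuple X.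
pose f (i : 'I_m) : E := \row_j coord tX i (delta_mx 0 j).
have fE i v : coord tX i v = dot (f i) v.
  rewrite {1}(row_sum_delta v) linear_sum; apply: eq_bigr => j _.
  by rewrite linearZ/= mxE mulrC.
pose M := \sum_i enorm (f i).
have M0 : 0 <= M by apply: sumr_ge0 => i _; exact: enorm_ge0.
have M1 : 0 < M + 1 by rewrite ltr_wpDl.
exists (M + 1)^-1; first by rewrite invr_gt0.
move=> Y sY XY; pose tY : m.-tuple E := tcast sY (in_tuple Y).
have tYE : (tY : seq E) = Y by rewrite /tY val_tcast.
rewrite -tYE; apply/freeP => c c0 i.
pose S := \sum_i `|c i|.
have cE j : c j = \sum_l c l * dot (f j) (X`_l - Y`_l).
  rewrite -[LHS](coord_sum_free c j (fX : free tX)).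
  have -> : \sum_l c l *: tX`_l = \sum_l c l *: (X`_l - Y`_l).
    apply/eqP; rewrite -subr_eq0 -sumrB; apply/eqP; rewrite -[RHS]c0.
    by apply: eq_bigr => l _; rewrite tYE scalerBr opprB addrC subrK.
  by rewrite linear_sum; apply: eq_bigr => l _; rewrite linearZ/= fE.
have cS j : `|c j| <= enorm (f j) * (M + 1)^-1 * S.
  rewrite {1}cE (le_trans (ler_norm_sum _ _ _))// /S mulr_sumr.
  apply: ler_sum => l _; rewrite normrM mulrC ler_wpM2r//.
  rewrite (le_trans (cauchy_schwarz _ _))// ler_wpM2l ?enorm_ge0// ltW//.
  exact: XY.
have S0 : 0 <= S by apply: sumr_ge0.
have : S <= M * (M + 1)^-1 * S.
  by rewrite {1}/S /M !mulr_suml; apply: ler_sum => j _; exact: cS.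
have M11 : M * (M + 1)^-1 < 1 by rewrite ltr_pdivrMr// mul1r; lra.
move=> SS; have S00 : S = 0 by apply/eqP; rewrite eq_le S0 andbT; nra.
have /eqP := S00; rewrite psumr_eq0// => /allP/(_ i (mem_index_enum _)).
by rewrite /= normr_eq0 => /eqP.
Qed.

Definition dim_ge m K := forall V : {vspace E}, K `<=` [set` V] -> (m <= \dim V)%N.

Lemma dim_ge_free m K : dim_ge m K -> exists X : seq E,
  [/\ free X, size X = m & forall i, (i < m)%N -> K X`_i].
Proof.
move=> Km; suff H j : (j <= m)%N -> exists X : seq E,
    [/\ free X, size X = j & forall i, (i < j)%N -> K X`_i] by exact: H.
elim: j => [_|j IH jm]; first by exists [::]; rewrite nil_free.
have [X [fX sX KX]] := IH (ltnW jm).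
have [x [Kx xX]] : exists x, K x /\ x \notin <<X>>%VS.
  apply: contrapT => H; have := Km <<X>>%VS.
  have -> : \dim <<X>> = j by move: fX; rewrite /free sX => /eqP.
  rewrite leqNgt jm => /(_ _)/negP; apply => //= x Kx.
  by apply/negPn/negP => xX; apply: H; exists x.
exists (x :: X); split; rewrite ?free_cons ?xX//= ?sX//.
by case=> [|i] //= ij; exact: KX.
Qed.

(** Lower semicontinuity of the dimension: points of [L] close enough to [m] independent points of
    [K] are independent. *)
Lemma measurable_dim_ge m :
  measurable ([set K | convex_body K /\ dim_ge m K] : set (body_space R d)).
Proof.
apply: sub_sigma_algebra; apply: hausdorff_open_near => K bK Km.
have [X [fX sX KX]] := dim_ge_free Km.
have [e e0 He] := free_near fX; exists e => // L bL KL V LV.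
have H (i : 'I_m) : exists y, L y /\ enorm (X`_i - y) < e.
  by have [y Ly xy] := KL _ (KX _ (ltn_ord i)); exists y.
have [y yP] := choice H.
pose Y := map y (enum 'I_m).
have sY : size Y = m by rewrite size_map size_enum_ord.
have nthY i (im : (i < m)%N) : Y`_i = y (Ordinal im).
  rewrite (nth_map (Ordinal im)) ?size_enum_ord//; congr y.
  by apply/val_inj; rewrite /= nth_enum_ord.
have fY : free Y.
  apply: He => [|i]; rewrite ?sY ?sX// => im.
  by rewrite (nthY i im); case: (yP (Ordinal im)).
move/eqP: fY; rewrite sY => <-.
apply: dimvS; apply/span_subvP => _ /mapP[i _ ->].
by apply: LV; case: (yP i).
Qed.

(** The projection [p] fixes [V] and has Lipschitz constant at most [\dim V]; so [y - p y] is at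
    most [1 + \dim V] times the distance from [y] to any point of [V]. *)
Lemma vspace_closed (V : {vspace E}) : closed [set` V].
Proof.
have [b [bV bb bs]] := orthonormal_basis (erefl (\dim V)).
pose p (y : E) : E := \sum_i dot (b i) y *: b i.
have pB y z : p y - p z = p (y - z).
  by rewrite /p -sumrB; apply: eq_bigr => i _; rewrite dotBr scalerBl.
have pn y : enorm (p y) <= (\dim V)%:R * enorm y.
  have H (r : seq 'I_(\dim V)) : enorm (\sum_(i <- r) dot (b i) y *: b i) <=
      (size r)%:R * enorm y.
    elim: r => [|i r IH]; first by rewrite big_nil enorm0 mul0r.
    rewrite big_cons (le_trans (enormD _ _))//= -natr1 mulrDl mul1r addrC lerD//.
    have b1 : enorm (b i) = 1 by apply/sphereP; rewrite /sphere/= bb eqxx.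
    by rewrite enormZ b1 mulr1 (le_trans (cauchy_schwarz _ _))// b1 mul1r.
  have <- : \sum_(i <- enum 'I_(\dim V)) dot (b i) y *: b i = p y by rewrite big_enum.
  by rewrite (le_trans (H _))// size_enum_ord.
have pV y : p y \in V by apply: memv_suml => i _; exact: memvZ.
apply/closed_eballP => y H /=.
suff -> : y = p y by [].
apply/eqP; rewrite -subr_eq0 -enorm_eq0 eq_le enorm_ge0 andbT leNgt.
apply/negP => h0.
have c0 : 0 < 1 + (\dim V)%:R :> R by rewrite ltr_wpDr.
have [|x xV xy] := H (enorm (y - p y) / (1 + (\dim V)%:R)).
  by rewrite divr_gt0.
have : enorm (y - p y) <= (1 + (\dim V)%:R) * enorm (x - y).
  rewrite (le_trans (enorm_triangle x _ _))// mulrDl mul1r enormB lerD2l.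
  by rewrite {1}(bs x xV) -/(p x) pB.
move: xy; rewrite ltr_pdivlMr// mulrC => h1 h2.
by have := le_lt_trans h2 h1; rewrite ltxx.
Qed.

Lemma great_subsphere_convex_body k (G : set E) : great_subsphere k G ->
  convex_body G.
Proof.
move=> [V dV ->]; exists [set` V]; split; last by rewrite setIC.
- exact: vspace_closed.
- split; first exact: mem0v.
  by move=> x y a b xV yV _ _; rewrite /= memvD ?memvZ.
- move=> V0; have : V == 0%VS.
    rewrite -subv0; apply/subvP => x xV; rewrite memv0; apply/eqP.
    by have : [set` V] x by []; rewrite V0.
  by rewrite -dimv_eq0 dV.
Qed.

Lemma dim_ge_great m (V : {vspace E}) :
  dim_ge m (sphere `&` [set` V]) <-> (m <= \dim V)%N.
Proof.
split=> [H|mV W VW]; first by apply: H => x [].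
apply: (leq_trans mV); apply: dimvS; apply/subvP => x xV.
have [->|x0] := eqVneq x 0; first exact: mem0v.
rewrite (unitvK x); apply: memvZ; apply: VW; split; first exact: unitv_sphere.
exact: memvZ.
Qed.

(** A convex cone stable under negation is a linear subspace. So the great subspheres are the
    symmetric bodies, and the two dimension tests pin the dimension to [k.+1]. *)
Lemma great_subsphereP k : great_subsphere k =
  ([set K | convex_body K /\ dim_ge k.+1 K] `\`
   [set K | convex_body K /\ dim_ge k.+2 K]) `&`
  [set K | convex_body K /\ forall x, K x -> K (- x)] :> set (set E).
Proof.
apply/seteqP; split => [G gG|K [[[bK d1] d2] [_ sK]]].
  have bG := great_subsphere_convex_body gG.
  have [V dV GE] := gG.
  split; [split; [split=> //|]|split => //]; rewrite GE.
  - by apply/dim_ge_great; rewrite dV.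
  - by move=> [_ /dim_ge_great]; rewrite dV ltnn.
  - move=> x [sx xV]; split; first exact: sphereN.
    by rewrite /= memvN.
have [C [cC ccC C0 KE]] := bK.
have CN x : C x -> C (- x).
  move=> Cx; have [->|x0] := eqVneq x 0; first by rewrite oppr0; case: ccC.
  rewrite (unitvK x) -scalerN; apply: cone_scale => //; last exact: enorm_ge0.
  have : K (unitv x).
    rewrite KE; split; last exact: unitv_sphere.
    by apply: cone_scale => //; rewrite invr_ge0 enorm_ge0.
  by move=> /sK; rewrite KE => -[].
have CZ (a : R) x : C x -> C (a *: x).
  move=> Cx; have [a0|a0] := leP 0 a; first exact: cone_scale.
  rewrite -[a]opprK scaleNr -scalerN; apply: cone_scale => //; first exact: CN.
  by rewrite oppr_ge0 ltW.
have [V CV] : exists V : {vspace E}, C = [set` V].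
  apply: vspace_of_set; first by case: ccC.
  move=> a x y Cx Cy; have [_ H] := ccC.
  by have := H (a *: x) y 1 1 (CZ _ _ Cx) Cy ler01 ler01; rewrite !scale1r.
have KV : K = sphere `&` [set` V] by rewrite KE CV setIC.
exists V => //; apply/eqP; rewrite eqn_leq; apply/andP; split.
  rewrite leqNgt; apply/negP => h; apply: d2; split => //.
  by rewrite KV; apply/dim_ge_great.
by move: d1; rewrite KV => /dim_ge_great.
Qed.

Lemma measurable_great_subsphere k :
  measurable (great_subsphere k : set (body_space R d)).
Proof.
rewrite great_subsphereP; apply: measurableI.
  by apply: measurableD; exact: measurable_dim_ge.
have oN i : open [set x : E | bball i (- x)].
  have := @open_bball R d i; apply: (continuousP _).1.
  by move=> x; apply: (@continuousN _ _ _ id); exact: cvg_id.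
(* For closed sets, symmetry can be tested on the countable base: a body that hits a ball has to hit
   its reflection. *)
rewrite (_ : [set K | _] = (convex_body : set (body_space R d)) `&`
    \bigcap_i (~` (hits (bball i)) `|` hits [set x | bball i (- x)])).
  apply: measurableI; first exact: measurable_convex_body.
  apply: bigcapT_measurable => i; apply: measurableU.
    by apply: measurableC; apply: measurable_hits; exact: open_bball.
  exact: measurable_hits.
apply/seteqP; split => K [bK H]; split => //.
  move=> i _; have [[_ [x [Kx ix]]]|] := pselect (hits (bball i) K); last by left.
  by right; split => //; exists (- x); split; [exact: H|rewrite /= opprK].
move=> x Kx; apply: (closed_eballP _).1 (convex_body_closed bK) _ _ => e e0.
have [i [ix ie]] := bball_nbhs x e0.
have [nh|[_ [y [Ky iy]]]] := H i Logic.I; first by case: nh; split => //; exists x.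
exists y => //; have := ie _ iy; rewrite /eball/= opprK.
by rewrite -(enormN (y + x)) opprD.
Qed.

End dimension.

(** * Measurable normal vectors *)

Section normal_vectors.
Context {R : realType} {d : nat}.
Local Notation E := 'rV[R]_d.+1.
Implicit Types (x y u a : E) (K : set E).

Definition supdot a K : R := sup [set dot a y | y in K].

Lemma has_sup_supdot a K : convex_body K -> has_sup [set dot a y | y in K].
Proof.
move=> bK; split.
  by have [y Ky] := convex_body_neq0 bK; exists (dot a y), y.
exists (enorm a) => _ [y Ky <-].
rewrite (le_trans (ler_norm _))// (le_trans (cauchy_schwarz _ _))//.
by have /sphereP -> := convex_body_sphere bK Ky; rewrite mulr1.
Qed.

(** [supdot a] is the support function; on a body it exceeds [c] exactly when the body hits the open
    half-space where [dot a] exceeds [c]. *)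
Lemma measurable_supdot a :
  measurable_fun (convex_body : set (body_space R d)) (supdot a).
Proof.
move=> mD; apply: (measurability _ (RGenOInfty.measurableE R)) => //.
move=> _ [_ [c ->] <-].
rewrite (_ : _ `&` _ = hits [set y | c < dot a y]).
  apply: measurable_hits.
  have /continuousP H := @continuous_dotr R d a.
  exact: (H [set s | c < s] (@open_gt _ c)).
apply/seteqP; split => K [bK H]; split => //; have [ne ub] := has_sup_supdot a bK.
  move: H; rewrite /= in_itv/= andbT => /(sup_gt ne)[_ [y Ky <-] cy].
  by exists y.
have [y [Ky /= cy]] := H; rewrite /= in_itv/= andbT (lt_le_trans cy)//.
by apply: ub_le_sup => //; exists y.
Qed.

Definition sqdot a K : R := dot a a - supdot a K ^+ 2.

Definition basis_vec (i : 'I_d.+1) : E := delta_mx 0 i.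

Lemma dot_basis_vec i x : dot (basis_vec i) x = x 0 i.
Proof.
rewrite /dot (bigD1 i)//= mxE !eqxx mul1r big1 ?addr0// => j ji.
by rewrite mxE (negbTE ji) andbF mul0r.
Qed.

(* If [K] is the great hypersphere orthogonal to the unit vector [u], then
   [sqdot a K] is the square of [dot u a], and polarization recovers the rank
   one matrix [u^T *m u]; its first nonzero row is a normal vector. *)
Definition gram (i j : 'I_d.+1) K : R :=
  (sqdot (basis_vec i + basis_vec j) K - sqdot (basis_vec i) K
   - sqdot (basis_vec j) K) / 2.

(** The product of indicators switches off every row after the first one with a nonzero diagonal
    entry; for a great hypersphere the rows before it are zero. *)
Definition normal K : E := \row_(i < d.+1) \sum_(j < d.+1)
  (\prod_(l : 'I_d.+1 | (l < j)%N) \1_[set 0] (gram l l K)) * gram j i K.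

Lemma measurable_gram i j :
  measurable_fun (convex_body : set (body_space R d)) (gram i j).
Proof.
have ms a : measurable_fun (convex_body : set (body_space R d)) (sqdot a).
  apply: measurable_funB; first exact: measurable_cst.
  by apply: measurable_funX; exact: measurable_supdot.
apply: measurable_funM; last exact: measurable_cst.
by apply: measurable_funB => //; apply: measurable_funB.
Qed.

Lemma measurable_normal :
  measurable_fun (convex_body : set (body_space R d))
    (normal : body_space R d -> borel_space R d).
Proof.
apply: coord_measurable => [|i]; first exact: measurable_convex_body.
rewrite (_ : (fun t => _) = (fun K => \sum_(j < d.+1)
    (\prod_(l : 'I_d.+1 | (l < j)%N) \1_[set 0] (gram l l K)) * gram j i K)); last first.
  by apply/funext => K; rewrite mxE.
apply: measurable_sum => j; apply: measurable_funM; last exact: measurable_gram.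
rewrite [X in measurable_fun _ X](_ : _ = (fun t : body_space R d => \prod_(l < d.+1)
    (if (l < j)%N then \1_[set 0] (gram l l t) else 1))); last first.
  by apply/funext => t; rewrite big_mkcond.
apply: measurable_prod => l _; case: (l < j)%N; last exact: measurable_cst.
apply: (@measurableT_comp _ _ _ _ _ _ (\1_[set 0] : R -> R) _ _ _ (measurable_gram l l)).
by apply: measurable_indic; exact: measurable_set1.
Qed.

Lemma perp_sphereZ (c : R) u : c != 0 -> perp_sphere (c *: u) = perp_sphere u.
Proof.
move=> c0; congr (_ `&` _); apply/seteqP; split => y /=; rewrite dotZl.
  by move=> /eqP; rewrite mulf_eq0 (negbTE c0) => /eqP.
by move=> ->; rewrite mulr0.
Qed.

Lemma perp_sphere_great u : u != 0 -> (0 < d)%N -> great_subsphere d.-1 (perp_sphere u).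
Proof.
move=> u0 d0; exists (orthv u).
  have [_ H] := dim_capv_orthv fullv u.
  have Hu : exists2 y, y \in {:E}%VS & dot u y != 0.
    by exists u; rewrite ?memvf// dot_eq0.
  by have := H Hu; rewrite capfv dim_fullvE prednK// => -[<-].
by congr (_ `&` _); apply/seteqP; split => y /=; rewrite mem_orthv => /eqP.
Qed.

(** The supremum is the length of [b], the orthogonal projection of [a] on the hyperplane, attained
    at [unitv b] unless [b] is [0]; Pythagoras gives its square. *)
Lemma supdot_perp_sphere a u : (0 < d)%N -> sphere u ->
  supdot a (perp_sphere u) ^+ 2 = dot a a - dot u a ^+ 2.
Proof.
move=> d0 su.
have bK : convex_body (perp_sphere u).
  apply: great_subsphere_convex_body; apply: perp_sphere_great => //.
  exact: sphere_neq0.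
have [ne ub] := has_sup_supdot a bK.
pose b : E := a - dot u a *: u.
have ub0 : dot u b = 0 by rewrite dotBr dotZr su mulr1 subrr.
have ab y : dot u y = 0 -> dot a y = dot b y.
  by move=> uy; rewrite dotBl dotZl uy mulr0 subr0.
have bb : dot b b = dot a a - dot u a ^+ 2.
  by rewrite -ab// dotBr dotZr (dotC a u) expr2.
suff -> : supdot a (perp_sphere u) = enorm b by rewrite enorm_sqr.
apply/eqP; rewrite eq_le; apply/andP; split.
  apply: ge_sup => // _ [y [sy uy] <-]; rewrite ab//.
  rewrite (le_trans (ler_norm _))// (le_trans (cauchy_schwarz _ _))//.
  by move/sphereP: sy => ->; rewrite mulr1.
have [b0|b0] := eqVneq b 0.
  have [y Ky] := convex_body_neq0 bK; have [sy uy] := Ky.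
  rewrite b0 enorm0; have <- : dot a y = 0 by rewrite ab// b0 dot0l.
  by apply: ub_le_sup => //; exists y.
apply: ub_le_sup => //; exists (unitv b).
  by split; [exact: unitv_sphere|rewrite /= dotZr ub0 mulr0].
rewrite ab ?dotZr ?ub0 ?mulr0// -enorm_sqr expr2 mulrA mulVf ?mul1r//.
by rewrite enorm_eq0.
Qed.

Lemma gram_perp_sphere i j u : (0 < d)%N -> sphere u ->
  gram i j (perp_sphere u) = u 0 i * u 0 j.
Proof.
move=> d0 su; rewrite /gram /sqdot !supdot_perp_sphere// !subKr.
by rewrite dotDr !(dotC u) !dot_basis_vec; field.
Qed.

Lemma normal_perp_sphere u : (0 < d)%N -> u != 0 ->
  exists2 c : R, c != 0 & normal (perp_sphere u) = c *: u.
Proof.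
move=> d0 u0; pose v := unitv u; have sv : sphere v by exact: unitv_sphere.
have nu : (enorm u)^-1 != 0 by rewrite invr_eq0 enorm_eq0.
rewrite -(perp_sphereZ u nu) -/(unitv u) -/v.
have exj : exists m : nat, [exists j : 'I_d.+1, (j == m :> nat) && (v 0 j != 0)].
  apply: contrapT => H; have /eqP := sphere_neq0 sv; apply.
  apply/rowP => j; rewrite [RHS]mxE; apply/eqP/negPn/negP => vj; apply: H.
  by exists (nat_of_ord j); apply/existsP; exists j; rewrite eqxx; exact: vj.
case: (ex_minnP exj) => m /existsP[j /andP[/eqP jm vj]] jmin.
have jmin' (l : 'I_d.+1) : (l < j)%N -> v 0 l = 0.
  move=> lj; apply/eqP/negPn/negP => vl.
  have := jmin l; rewrite -jm leqNgt lj => /(_ _)/negP; apply => //.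
  by apply/existsP; exists l; rewrite eqxx.
exists (v 0 j * (enorm u)^-1); first exact: mulf_neq0.
rewrite -scalerA -/(unitv u) -/v; apply/rowP => i; rewrite [LHS]mxE [RHS]mxE (bigD1 j)//=.
rewrite big1 ?mul1r; last first.
  by move=> l lj; rewrite indicE mem_set// gram_perp_sphere// jmin'// mul0r.
rewrite gram_perp_sphere// big1 ?addr0// => l lj.
rewrite gram_perp_sphere//; case: (ltngtP l j) => [lj'|lj'|/val_inj e].
- by rewrite (jmin' _ lj') mul0r mulr0.
- rewrite (bigD1 j)//= indicE memNset ?mul0r//.
  by rewrite /= gram_perp_sphere// => /eqP; rewrite mulf_eq0 orbb (negbTE vj).
- by move: lj; rewrite e eqxx.
Qed.

Lemma great_hypersphereP (s : set E) : (0 < d)%N -> great_subsphere d.-1 s ->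
  exists2 u, u != 0 & s = perp_sphere u.
Proof.
move=> d0 [L]; rewrite prednK// => dL ->.
have [b [bL bb bs]] := orthonormal_basis dL.
have [x xL] : exists x, x \notin L.
  apply: contrapT => H; have : (fullv <= L)%VS.
    apply/subvP => x _; apply/negPn/negP => xL; apply: H; by exists x.
  by move/dimvS; rewrite dim_fullvE dL ltnn.
pose p : E := \sum_i dot (b i) x *: b i.
have pL : p \in L by apply: memv_suml => i _; exact: memvZ.
pose u := x - p.
have u0 : u != 0 by apply: contraNneq xL => /eqP; rewrite subr_eq0 => /eqP ->.
have ub i : dot u (b i) = 0.
  rewrite dotC dotBr /p dot_sumr (bigD1 i)//= dotZr bb eqxx mulr1 big1 ?addr0 ?subrr//.
  by move=> j ji; rewrite dotZr bb eq_sym (negbTE ji) mulr0.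
exists u => //; congr (_ `&` _).
suff -> : L = orthv u by apply/seteqP; split => y /=; rewrite mem_orthv => /eqP.
apply/eqP; rewrite eqEdim; apply/andP; split.
  apply/subvP => y yL; rewrite mem_orthv (bs y yL) dot_sumr big1// => i _.
  by rewrite dotZr ub mulr0.
have [_ H] := dim_capv_orthv fullv u.
have Hu : exists2 y, y \in {:E}%VS & dot u y != 0.
  by exists u; rewrite ?memvf// dot_eq0.
by have := H Hu; rewrite capfv dim_fullvE dL => -[<-].
Qed.

Lemma normalK (s : set E) : (0 < d)%N -> great_subsphere d.-1 s ->
  s = perp_sphere (normal s) /\ normal s != 0.
Proof.
move=> d0 gs; have [u u0 ->] := great_hypersphereP d0 gs.
have [c c0 ->] := normal_perp_sphere d0 u0.
by rewrite perp_sphereZ// scaler_eq0 (negbTE c0).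
Qed.

End normal_vectors.

Section greatv_bodies.
Context {R : realType} {d : nat}.
Local Notation E := 'rV[R]_d.+1.

Lemma greatvE n (u : 'I_n -> E) : greatv u = great u [set: 'I_n]%SET.
Proof.
congr (_ `&` _); apply/seteqP; split => y /=.
  by move=> H; apply/mem_perpv => i _.
by move=> /mem_perpv H i; apply: H; rewrite finset.inE.
Qed.

Lemma greatv_convex_body n (u : 'I_n -> E) : (n <= d)%N -> convex_body (greatv u).
Proof.
move=> nd; rewrite greatvE.
apply: (@great_subsphere_convex_body _ _ (\dim (perpv u [set: 'I_n]%SET)).-1).
exists (perpv u [set: 'I_n]%SET) => //.
by have := dim_perpv_ge u [set: 'I_n]%SET; rewrite cardsT card_ord; lia.
Qed.

Lemma measurable_greatv n : (n <= d)%N ->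
  measurable_fun setT (@greatv R d n : vecs n -> body_space R d).
Proof.
move=> nd; apply: approximable_body_measurable => //.
  by move=> u _; exact: greatv_convex_body.
apply: (@approximable_greatv _ _ _ (vecs n) n setT (fun i u => u i)) => // i.
exact: measurable_nth.
Qed.

End greatv_bodies.

(** * Hausdorff measure on great subspheres as a kernel *)

Section sphere_kernel.
Context {R : realType} {d : nat}.
Local Notation E := 'rV[R]_d.+1.
Implicit Types (k : nat) (G : set E).

(** [omega R d k] unfolds to [fine (hausdorff k (ref_sphere k))]. *)
Definition ref_sphere k : set E :=
  sphere `&` [set x : E | forall i : 'I_d.+1, (k < i)%N -> x 0 i = 0].

Definition finite_great k : set (body_space R d) :=
  [set G | [/\ great_subsphere k G, (k <= d)%N & (hausdorff k (ref_sphere k) < +oo)%E]].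

Lemma measurable_great k G : great_subsphere k G ->
  measurable (G : set (borel_space R d)).
Proof.
move=> gG; apply: measurable_closed; apply: convex_body_closed.
exact: great_subsphere_convex_body gG.
Qed.

Lemma measurable_finite_great k : measurable (finite_great k).
Proof.
have [kd|kd] := leqP k d; last first.
  rewrite (_ : finite_great k = set0)//.
  by apply/seteqP; split => // G [_]; rewrite leqNgt kd.
have [h|h] := boolP (hausdorff k (ref_sphere k) < +oo)%E; last first.
  rewrite (_ : finite_great k = set0)//.
  by apply/seteqP; split => // G [_ _]; rewrite (negbTE h).
rewrite (_ : finite_great k = great_subsphere k); first exact: measurable_great_subsphere.
by apply/seteqP; split => [G []|G gG]//; split.
Qed.

(* Finiteness is part of the test so that this is a finite kernel without knowing
   the value of [omega]. *)
Definition sphere_kernel k (G : body_space R d) :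
    {measure set (borel_space R d) -> \bar R} :=
  match pselect (finite_great k G) with
  | left h => let: And3 g _ _ := h in
     mrestr (@hausdorff R d k : {measure set (borel_space R d) -> \bar R})
       (measurable_great g)
  | right _ => mzero
  end.

Lemma sphere_kernelE k G B : finite_great k G ->
  sphere_kernel k G B = hausdorff k (B `&` G).
Proof. by move=> h; rewrite /sphere_kernel; case: pselect => // -[]. Qed.

Lemma sphere_kernelN k G B : ~ finite_great k G -> sphere_kernel k G B = 0%E.
Proof. by move=> h; rewrite /sphere_kernel; case: pselect. Qed.

Lemma sphere_kernelT k G : finite_great k G ->
  sphere_kernel k G setT = hausdorff k (ref_sphere k).
Proof.
by move=> h; rewrite sphere_kernelE// setTI; case: h => g kd _;
  exact: great_subsphere_measure.
Qed.

(** By [hausdorff_compact_le] the bound means that suitable finite unions [bunion s] contain the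
    compact set [C] intersected with [G]; equivalently, [G] avoids the closed remainder of [C],
    which is a measurable condition on [G]. *)
Let kernel_le k (C : set E) (a : R) : closed C ->
  measurable ([set G | convex_body G /\ (hausdorff k (C `&` G) <= a%:E)%E]
    : set (body_space R d)).
Proof.
move=> cC; pose Q m (s : seq nat) :=
  (hausdorff_pre k m.+1%:R^-1 (bunion s : set E) < (a + m.+1%:R^-1)%:E)%E.
rewrite (_ : [set G | _] = \bigcap_m \bigcup_(s in [set s | Q m s])
    [set G | convex_body G /\ G `&` (C `\` bunion s) = set0]).
  apply: bigcapT_measurable => m.
  rewrite bigcup_mkcond; apply: countable_bigcupT_measurable => // s.
  case: ifP => _ //.
  apply: measurable_avoids; rewrite setDE; apply: closedI => //.
  by apply: open_closedC; exact: open_bunion.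
have sub (A B D : set E) : B `&` A `<=` D <-> A `&` (B `\` D) = set0.
  split=> [H|H x [Bx Ax]].
    by apply/seteqP; split => // x [Ax [Bx]]; apply; apply: H.
  apply: contrapT => Dx; have : (A `&` (B `\` D)) x by [].
  by rewrite H.
have comp G : convex_body G -> compact (C `&` G).
  move=> bG; apply: subclosed_compact (convex_body_compact bG) _; last by move=> x [].
  by apply: closedI => //; exact: convex_body_closed.
apply/seteqP; split => [G [bG /hausdorff_compact_le H] m _|G H].
  by have [s Qs Gs] := H (comp _ bG) m; exists s => //; split => //; exact/sub.
have bG : convex_body G by have [s _ []] := H 0%N Logic.I.
split => //; apply/hausdorff_compact_le; first exact: comp.
by move=> m; have [s Qs [_ Gs]] := H m Logic.I; exists s => //; exact/sub.
Qed.

Let kernel_closed k (C : set E) : closed C ->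
  measurable_fun setT (sphere_kernel k ^~ (C : set (borel_space R d))).
Proof.
move=> cC mT; apply: (measurability _ (ErealGenOInfty.measurableE R)) => //.
move=> _ [_ [a ->] <-]; rewrite setTI -[X in measurable X]setCK; apply: measurableC.
rewrite (_ : ~` _ = [set G | (sphere_kernel k G C <= a%:E)%E]); last first.
  apply/seteqP; split => G /=; rewrite in_itv/= andbT => /negP; first by rewrite -leNgt.
  by move=> /negP h; apply/negP; rewrite -leNgt.
have [a0|a0] := leP 0 a; last first.
  rewrite (_ : [set _ | _] = set0)//; apply/seteqP; split => // G /=.
  by rewrite leNgt (lt_le_trans _ (measure_ge0 _ _))// lte_fin.
rewrite (_ : [set _ | _] = (~` finite_great k) `|` (finite_great k `&`
  [set G | convex_body G /\ (hausdorff k (C `&` G) <= a%:E)%E])).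
  apply: measurableU; first by apply: measurableC; exact: measurable_finite_great.
  by apply: measurableI; [exact: measurable_finite_great|exact: kernel_le].
apply/seteqP; split => G /=.
  have [h|h] := pselect (finite_great k G); last by left.
  rewrite sphere_kernelE//; right; split => //; split => //.
  by case: h => g _ _; exact: great_subsphere_convex_body g.
by move=> [h|[h [_]]]; [rewrite sphere_kernelN// lee_fin|rewrite sphere_kernelE].
Qed.

Lemma sphere_kernel_uub k : measure_fam_uub (sphere_kernel k).
Proof.
exists (fine (hausdorff k (ref_sphere k)) + 1)%R => G.
have [h|h] := pselect (finite_great k G); last first.
  rewrite sphere_kernelN// lte_fin ltr_wpDl// fine_ge0//; exact: hausdorff_ge0.
rewrite sphere_kernelT// EFinD fineK ?lteDl ?lte01//; case: h => _ _ h;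
by rewrite ge0_fin_numE// hausdorff_ge0.
Qed.

(** Dynkin induction from the closed sets, a generator stable under intersection; the finite total
    mass allows subtraction for complements. *)
Lemma measurable_sphere_kernel k (B : set (borel_space R d)) : measurable B ->
  measurable_fun setT (sphere_kernel k ^~ B).
Proof.
have E1 : @measurable _ (borel_space R d) = <<s (@closed E) >>.
  apply/seteqP; split.
    apply: smallest_sub; first exact: smallest_sigma_algebra.
    move=> U oU; rewrite -[U]setCK -setTD; apply: sigma_algebraCD.
    by apply: sub_sigma_algebra; rewrite closedC.
  apply: smallest_sub; first exact: sigma_algebra_measurable.
  by move=> C cC; exact: measurable_closed.
rewrite E1; move: B; apply: (@dynkin_induction _ (borel_space R d) (@closed E)
  (fun B => measurable_fun setT (sphere_kernel k ^~ B))) => //.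
- by move=> A B; exact: closedI.
- by apply: kernel_closed; exact: closedT.
- by move=> C; exact: kernel_closed.
- move=> B mB mk.
  rewrite (_ : sphere_kernel k ^~ _ = (fun G : body_space R d => sphere_kernel k G setT -
      sphere_kernel k G B)%E); last first.
    apply/funext => G; rewrite -setTD measureD// ?setTI//.
    have [r Hr] := sphere_kernel_uub k; exact: lt_trans (Hr G) (ltry _).
  by apply: emeasurable_funB => //; apply: kernel_closed; exact: closedT.
- move=> F mF tF mk.
  rewrite (_ : sphere_kernel k ^~ _ = (fun G : body_space R d => \sum_(0 <= i <oo)
      sphere_kernel k G (F i))%E); last first.
    by apply/funext => G; rewrite measure_bigcup//; under eq_eseriesl do rewrite in_setT.
  by apply: ge0_emeasurable_sum.
Qed.

HB.instance Definition _ k := isKernel.Build _ _ (body_space R d) (borel_space R d) R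
  (sphere_kernel k) (@measurable_sphere_kernel k).

HB.instance Definition _ k := Kernel_isFinite.Build _ _ (body_space R d)
  (borel_space R d) R (sphere_kernel k) (sphere_kernel_uub k).

(** The same measure under a name that carries the structure of a finite measure, as needed for
    exchanging integrals. *)
Definition sphere_measure k G : set (borel_space R d) -> \bar R := sphere_kernel k G.

HB.instance Definition _ k G := Measure.on (sphere_measure k G).

Let sphere_measure_fin k G : fin_num_fun (sphere_measure k G).
Proof.
have [r Hr] := sphere_kernel_uub k; apply: lty_fin_num_fun.
exact: (lt_trans (Hr G) (ltry r)).
Qed.

HB.instance Definition _ k G :=
  Measure_isFinite.Build _ _ _ (sphere_measure k G) (sphere_measure_fin k G).

End sphere_kernel.

(** * Independence and general position *)

Section bundling.
Context {d d' : measure_display} {T : measurableType d} {T' : measurableType d'}.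

Definition bundle_mfun (f : T -> T') (mf : measurable_fun setT f) :
  {mfun T >-> T'} := HB.pack f (isMeasurableFun.Build d d' T T' f mf).

End bundling.

Section box_laws.
Context {R : realType} {d : nat}.
Local Notation E := 'rV[R]_d.+1.
Local Open Scope ereal_scope.

Lemma box_measure_unique n (m1 m2 : {measure set (@vecs R d n) -> \bar R}) :
  m1 setT < +oo ->
  (forall A, (forall i, measurable (A i)) -> m1 (box A) = m2 (box A)) ->
  forall A, measurable A -> m1 A = m2 A.
Proof.
move=> m1T m12 A mA.
have BT : [set: 'I_n -> E] = box (fun=> setT) by apply/seteqP; split.
have bsub : @boxes R d n `<=` @measurable _ (@vecs R d n).
  by move=> B bB; exact: sub_sigma_algebra.
have bI : setI_closed (@boxes R d n).
  move=> _ _ [B mB <-] [C mC <-]; exists (fun i => B i `&` C i).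
    by move=> i; apply: measurableI; [exact: mB|exact: mC].
  by apply/seteqP; split => u; [move=> H; split=> i; case: (H i)|move=> [H1 H2] i].
have bT : forall k : nat, @boxes R d n [set: 'I_n -> E] by move=> _; exists (fun=> setT).
have bm B : @boxes R d n B -> m1 B = m2 B by move=> [C mC <-]; exact: m12.
have bc : \bigcup_(k in [set: nat]) [set: @vecs R d n] = setT by rewrite bigcup_const.
have bmt : forall k : nat, m1 [set: @vecs R d n] < +oo by [].
exact: (@g_sigma_algebra_measure_unique _ R (@vecs R d n) (@boxes R d n) bsub
  (fun=> setT) bT bc m1 m2 bI bm bmt A mA).
Qed.

(** Independence with common marginal [rho], tested on boxes. Sharing [rho] is what links families
    of different sizes on different probability spaces. *)
Definition box_law (rho : set (borel_space R d) -> R) n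
    (m : set (@vecs R d n) -> \bar R) :=
  forall A, (forall i, measurable (A i)) -> m (box A) = (\prod_i rho (A i))%:E.

End box_laws.

(** * Splitting an independent family into two blocks *)

Section independent_split.
Context {R : realType} {d : nat} (rho : set (borel_space R d) -> R).
Context {dO dO1 dO2 : measure_display} {Omega : measurableType dO}
  {Omega1 : measurableType dO1} {Omega2 : measurableType dO2}.
Context (P : probability Omega R) (P1 : probability Omega1 R)
  (P2 : probability Omega2 R).
Context {n a m : nat} (U : {mfun Omega >-> @vecs R d n})
  (U1 : {mfun Omega1 >-> @vecs R d a}) (U2 : {mfun Omega2 >-> @vecs R d m}).
Context (sg : 'I_a -> 'I_n) (tau : 'I_m -> 'I_n).
Local Notation E := 'rV[R]_d.+1.
Local Open Scope ereal_scope.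

Context (rhoT : rho setT = 1%R).
Context (lU : box_law rho (distribution P U)).
Context (lU1 : box_law rho (distribution P1 U1)).
Context (lU2 : box_law rho (distribution P2 U2)).
Context (sgI : injective sg) (tauI : injective tau).
Context (sgtau : forall j l, sg j != tau l).

Lemma measurable_subfam q (s : 'I_q -> 'I_n) :
  measurable_fun setT (fun w => (fun j => U w (s j)) : @vecs R d q).
Proof.
apply: measurable_to_vecs => i.
exact: (measurableT_comp (@measurable_nth R d n (s i)) (measurable_funPT U)).
Qed.

Definition subfam q (s : 'I_q -> 'I_n) : {mfun Omega >-> @vecs R d q} :=
  bundle_mfun (measurable_subfam s).

Let split_box (A : 'I_a -> set (borel_space R d)) (B : 'I_m -> set (borel_space R d)) :
  (forall i, measurable (A i)) -> (forall i, measurable (B i)) ->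
  P (subfam sg @^-1` box A `&` subfam tau @^-1` box B) =
  distribution P1 U1 (box A) * distribution P2 U2 (box B).
Proof.
(* [C i] is [A j] at [i = sg j], [B l] at [i = tau l], and everything at the remaining indices,
   where the factor is [rho setT = 1]. *)
move=> mA mB; pose C i := [set x : E | (forall j, sg j = i -> A j x) /\
                                        (forall l, tau l = i -> B l x)].
have mC i : measurable (C i : set (borel_space R d)).
  rewrite (_ : C i = (\bigcap_(j in [set j | sg j = i]) A j) `&`
     (\bigcap_(l in [set l | tau l = i]) B l)).
    by apply: measurableI; apply: fin_bigcap_measurable => // ; exact: finite_finset.
  by apply/seteqP; split => x [H1 H2].
rewrite (_ : _ `&` _ = U @^-1` box C); last first.
  apply/seteqP; split => w.
    by move=> [HA HB] i; split=> j <-; [exact: HA|exact: HB].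
  move=> H; split => [j|l]; first by case: (H (sg j)) => h _; exact: h.
  by case: (H (tau l)) => _ h; exact: h.
rewrite -[LHS]/(distribution P U (box C)) lU// lU1// lU2// -EFinM; congr EFin.
have Csg j : C (sg j) = A j.
  apply/seteqP; split => [x [H _]|x Ax]; first exact: H.
  split => [j' /sgI -> //|l tl]; by have := sgtau j l; rewrite tl eqxx.
have Ctau l : C (tau l) = B l.
  apply/seteqP; split => [x [_ H]|x Ax]; first exact: H.
  split => [j tl|l' /tauI -> //]; by have := sgtau j l; rewrite tl eqxx.
rewrite (bigID (mem (sg @: [set: 'I_a])%SET))/=; congr (_ * _)%R.
  rewrite big_imset/=; last by move=> ? ? _ _; exact: sgI.
  by apply: eq_big => [j|j _]; rewrite ?finset.inE ?Csg.
rewrite (bigID (mem (tau @: [set: 'I_m])%SET))/= [X in (_ * X)%R]big1 ?mulr1.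
  rewrite (eq_bigl (mem (tau @: [set: 'I_m])%SET)).
    rewrite big_imset/=; last by move=> ? ? _ _; exact: tauI.
    by apply: eq_big => [j|j _]; rewrite ?finset.inE ?Ctau.
  move=> i /=; rewrite andb_idl// => /finset.imsetP[l _ ->].
  by apply/finset.imsetP => -[j _ e]; have := sgtau j l; rewrite e eqxx.
move=> i /andP[isg itau]; rewrite (_ : C i = setT)//.
apply/seteqP; split => // x _; split => [j ji|l li].
  by move: isg; rewrite -ji finset.imset_f// finset.inE.
by move: itau; rewrite -li finset.imset_f// finset.inE.
Qed.

Let msg A : measurable A -> measurable (subfam sg @^-1` A).
Proof. by move=> mA; rewrite -[X in measurable X]setTI; exact: measurable_funPT. Qed.

Let mtau A : measurable A -> measurable (subfam tau @^-1` A).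
Proof. by move=> mA; rewrite -[X in measurable X]setTI; exact: measurable_funPT. Qed.

(** Uniqueness of measures is used twice: with a box fixed in the second block, to pass to all [A];
    then with [A] fixed, to pass to all [B]. *)
Lemma independent_subfam A B : measurable A -> measurable B ->
  P (subfam sg @^-1` A `&` subfam tau @^-1` B) =
  distribution P1 U1 A * distribution P2 U2 B.
Proof.
move=> mA mB.
have fin1 : distribution P1 U1 A \is a fin_num by exact: fin_num_measure.
have step1 (B' : 'I_m -> set (borel_space R d)) : (forall i, measurable (B' i)) ->
    forall A', measurable A' ->
    P (subfam sg @^-1` A' `&` subfam tau @^-1` box B') =
    distribution P1 U1 A' * distribution P2 U2 (box B').
  move=> mB' A' mA'; have mbB := measurable_box mB'.
  have fin2 : distribution P2 U2 (box B') \is a fin_num by exact: fin_num_measure.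
  have c0 : (0 <= fine (distribution P2 U2 (box B')))%R by rewrite fine_ge0.
  rewrite -[X in _ * X]fineK// muleC.
  apply: (@box_measure_unique R d a
    (pushforward (mrestr P (mtau mbB)) (subfam sg))
    (mscale (NngNum c0) (distribution P1 U1))) => //.
    rewrite /pushforward /mrestr/= (le_lt_trans (probability_le1 P _)) ?ltry//.
    by apply: measurableI; [exact: msg|exact: mtau].
  move=> A'' mA''.
  rewrite -[LHS]/(P (subfam sg @^-1` box A'' `&` subfam tau @^-1` box B')).
  rewrite -[RHS]/((fine (distribution P2 U2 (box B')))%:E * distribution P1 U1 (box A'')).
  by rewrite split_box// muleC fineK.
rewrite -[X in X * _]fineK//.
have c0 : (0 <= fine (distribution P1 U1 A))%R by rewrite fine_ge0.
rewrite setIC.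
apply: (@box_measure_unique R d m
    (pushforward (mrestr P (msg mA)) (subfam tau))
    (mscale (NngNum c0) (distribution P2 U2))) => //.
  rewrite /pushforward /mrestr/= (le_lt_trans (probability_le1 P _)) ?ltry//.
  by apply: measurableI; [exact: mtau|exact: msg].
move=> B' mB'.
rewrite -[LHS]/(P (subfam tau @^-1` box B' `&` subfam sg @^-1` A)).
rewrite -[RHS]/((fine (distribution P1 U1 A))%:E * distribution P2 U2 (box B')).
by rewrite setIC step1// fineK.
Qed.

(** The pair of blocks has a product law, and the two factors may be realized on other probability
    spaces. This is the only link between the three families of hyperspheres in the theorem. *)
Lemma integral_independent_split (f : @vecs R d a * @vecs R d m -> \bar R) :
  measurable_fun setT f -> (forall z, 0 <= f z) ->
  \int[P]_w f (subfam sg w, subfam tau w) =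
  \int[P1]_w1 \int[P2]_w2 f (U1 w1, U2 w2).
Proof.
move=> mf f0.
pose V : Omega -> @vecs R d a * @vecs R d m := fun w => (subfam sg w, subfam tau w).
have mV : measurable_fun setT V by exact: measurable_fun_pair.
pose MV := bundle_mfun mV.
rewrite -[LHS]/(\int[P]_w (f \o MV) w) -ge0_integral_distribution//.
transitivity (\int[distribution P1 U1 \x distribution P2 U2]_z f z).
  apply: eq_measure_integral => X mX _; apply/esym.
  apply: (@product_measure_unique _ _ _ _ _ _ _ (distribution P MV)) => // A B mA mB.
  by rewrite -independent_subfam.
rewrite fubini_tonelli1// /fubini_F ge0_integral_distribution//.
- apply: eq_integral => w1 _ /=; rewrite ge0_integral_distribution//.
  by apply: measurableT_comp => //; exact: measurable_pair1.
- by apply: measurable_fun_fubini_tonelli_F.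
- by move=> u; apply: integral_ge0.
Qed.

End independent_split.

Lemma ge0_integral_eq0_ae (R : realType) dT (T : measurableType dT)
    (mu : {measure set T -> \bar R}) (f : T -> \bar R) :
  measurable_fun setT f -> (forall x, (0 <= f x)%E) -> (\int[mu]_x f x = 0)%E ->
  {ae mu, forall x, f x = 0%E}.
Proof.
move=> mf f0 If; have := (ae_eq_integral_abs mu measurableT mf).1.
under eq_integral do rewrite gee0_abs//.
by move=> /(_ If); apply: filterS => x; apply.
Qed.

Section kernel_pullback.
Context {dX dY dZ : measure_display} {X : measurableType dX}
  {Y : measurableType dY} {Z : measurableType dZ} {R : realType}.
Context (k : R.-fker Y ~> Z) (g : X -> Y) (mg : measurable_fun setT g).

(* The proof of measurability is a dummy argument, needed by the kernel
   instances below. *)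
Definition kernel_pullback (_ : measurable_fun setT g) (x : X) :
  {measure set Z -> \bar R} := k (g x).

Let pb := kernel_pullback mg.

Let measurable_pb U : measurable U -> measurable_fun setT (pb ^~ U).
Proof.
by move=> mU; apply: (measurableT_comp (measurable_kernel k U mU) mg).
Qed.

HB.instance Definition _ := isKernel.Build _ _ X Z R (kernel_pullback mg) measurable_pb.

Let pb_uub : measure_fam_uub pb.
Proof. by have [r Hr] := measure_uub k; exists r => x; exact: Hr. Qed.

HB.instance Definition _ := Kernel_isFinite.Build _ _ X Z R (kernel_pullback mg) pb_uub.

Lemma measurable_integral_pullback (f : X * Z -> \bar R) :
  measurable_fun setT f -> (forall z, (0 <= f z)%E) ->
  measurable_fun setT (fun x => \int[k (g x)]_z f (x, z))%E.
Proof.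
by move=> mf f0; exact: (measurable_fun_integral_finite_kernel _ (kernel_pullback mg)).
Qed.

End kernel_pullback.

(** * The law of the normal vectors of random hyperspheres *)

Section hypersphere_normals.
Context {R : realType} {d : nat} (d_gt0 : (0 < d)%N)
  (kappa0 : probability (borel_space R d) R)
  (kappa0_nondeg : nondegenerate_direction kappa0).
Local Notation E := 'rV[R]_d.+1.

(** The law of [normal (perp_sphere u)] for [u] with law [kappa0]; for nonzero [u] this is a nonzero
    multiple of [u], in general not a unit vector. *)
Definition normal_law (A : set (borel_space R d)) : R :=
  fine (kappa0 ((@perp_sphere R d : borel_space R d -> body_space R d) @^-1`
    [set K | convex_body K /\ A (normal K)])).

Lemma perp_sphere_convex_body (u : E) : convex_body (perp_sphere u).
Proof.
have [->|u0] := eqVneq u 0; last first.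
  exact: great_subsphere_convex_body (perp_sphere_great u0 d_gt0).
apply: (@great_subsphere_convex_body _ _ d); exists fullv; first by rewrite dim_fullvE.
by congr (_ `&` _); apply/seteqP; split => x /=; rewrite ?memvf// dot0l.
Qed.

Lemma normal_lawT : normal_law setT = 1.
Proof.
rewrite /normal_law (_ : _ @^-1` _ = setT) ?probability_setT//.
by apply/seteqP; split => // u _; split => //; exact: perp_sphere_convex_body.
Qed.

(** Orthogonality is symmetric: a unit vector [u] is orthogonal to [x] iff it lies on the great
    hypersphere [perp_sphere x], which is null by nondegeneracy. *)
Lemma normal_law_perp (x : E) : sphere x ->
  normal_law [set v : E | dot v x = 0] = 0.
Proof.
move=> sx; rewrite /normal_law; set Q := _ @^-1` _.
pose N : set (borel_space R d) := [set u : E | dot u x = 0].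
have nperp (u : E) : u != 0 -> Q u <-> N u.
  move=> u0; have [c c0 e] := normal_perp_sphere d_gt0 u0.
  rewrite /Q /N /= e dotZl; split => [[_ /eqP]|->]; last first.
    by rewrite mulr0; split => //; exact: perp_sphere_convex_body.
  by rewrite mulf_eq0 (negbTE c0) => /eqP.
have mN : measurable N.
  apply: measurable_closed; rewrite (_ : (N : set E) = dot x @^-1` [set s | s = 0]).
    have /continuous_closedP H := @continuous_dotr R d x.
    exact: (H [set s | s = 0] (@closed_eq _ 0)).
  by apply/seteqP; split => u; rewrite /N /= dotC.
have m0 : measurable ([set 0 : E] : set (borel_space R d)).
  apply: measurable_closed; apply/closed_eballP => y H /=.
  apply/eqP/negPn/negP => y0; have [|z ->] := H (enorm y); first by rewrite enorm_gt0.
  by rewrite sub0r enormN ltxx.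
have [mu1 _ nd] := kappa0_nondeg.
have N0 : kappa0 N = 0%E.
  have := nd _ (perp_sphere_great (sphere_neq0 sx) d_gt0).
  have msph : measurable (sphere : set (borel_space R d)).
    by apply: measurable_closed; exact: closed_sphere.
  have -> : perp_sphere x = sphere `&` N.
    by congr (_ `&` _); apply/seteqP; split => u; rewrite /N /= dotC.
  move=> h; apply/eqP; rewrite eq_le measure_ge0 andbT.
  have cs : kappa0 (~` sphere) = 0%E by rewrite probability_setC ?mu1 ?subee.
  have : (kappa0 N <= kappa0 (sphere `&` N) + kappa0 (~` sphere))%E.
    apply: le_trans (measureU2 _ _ _) => //.
    - apply: le_measure; rewrite ?inE//; last first.
        by move=> u Nu; have [su|su] := pselect (sphere u); [left|right].
      apply: measurableU; first exact: measurableI.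
      exact: measurableC.
    - exact: measurableI.
    - exact: measurableC.
  by rewrite h cs adde0.
(* [perp_sphere 0] is the whole sphere, where nothing is known about [normal]. In either case [Q]
   agrees with the null set [N] up to the point [0]. *)
have [Q0|Q0] := pselect (Q 0).
  rewrite (_ : Q = N) ?N0//; apply/seteqP; split => u.
    by have [->|/nperp[]] := eqVneq u 0; rewrite /N/= ?dot0l.
  by have [->|/nperp[]] := eqVneq u 0.
rewrite (_ : Q = N `\` [set 0]); last first.
  apply/seteqP; split => u.
    by have [->//|u0 Qu] := eqVneq u 0; split; [exact/nperp|exact/eqP].
  by move=> [Nu /eqP u0]; exact/(nperp _ u0).
apply/eqP; rewrite fine_eq0; last by apply: fin_num_measure; exact: measurableD.
rewrite eq_le measure_ge0 andbT -[X in (_ <= X)%E]N0 le_measure ?inE//.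
exact: measurableD.
Qed.

Section normals_of_spheres.
Context {dO : measure_display} {Omega : measurableType dO}
  (P : probability Omega R) {n : nat} (S : 'I_n -> {RV P >-> body_space R d})
  (S_iid : iid_hyperspheres kappa0 S).

Let S_convex i w : convex_body (S i w).
Proof.
by case: S_iid => gS _ _; exact: great_subsphere_convex_body (gS i w).
Qed.

Lemma measurable_normals :
  measurable_fun setT (fun w => (fun i => normal (S i w)) : @vecs R d n).
Proof.
apply: measurable_to_vecs => i.
apply: (@measurable_comp _ _ _ Omega (body_space R d) (borel_space R d)
  convex_body normal setT (S i)).
- exact: measurable_convex_body.
- by move=> _ [w _ <-]; exact: S_convex.
- exact: measurable_normal.
- exact: measurable_funPT.
Qed.

Definition normals : {mfun Omega >-> @vecs R d n} := bundle_mfun measurable_normals.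

Lemma normalsE i w : S i w = perp_sphere (normals w i : E) /\ (normals w i : E) != 0.
Proof.
by case: S_iid => gS _ _; have [h1 h2] := normalK d_gt0 (gS i w); split.
Qed.

Lemma normals_box_law : box_law normal_law (distribution P normals).
Proof.
move=> A mA; pose Q i : set (body_space R d) := [set K | convex_body K /\ A i (normal K)].
have mQ i : measurable (Q i).
  exact: (@measurable_normal R d measurable_convex_body _ (mA i)).
have [_ lS iS] := S_iid.
rewrite /distribution /pushforward.
rewrite (_ : _ @^-1` _ = \bigcap_i (S i @^-1` Q i)); last first.
  apply/seteqP; split => w H i; first by move=> _; split => //; exact: H.
  by have [] := H i Logic.I.
rewrite iS//; congr EFin; apply: eq_bigr => i _.
by rewrite -[P _]/(distribution P (S i) (Q i)) lS.
Qed.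

End normals_of_spheres.
End hypersphere_normals.

(** * Almost sure general position and null overlaps *)

Section almost_sure_position.
Context {R : realType} {d : nat} (rho : set (borel_space R d) -> R).
Local Notation E := 'rV[R]_d.+1.
Context (rhoT : rho setT = 1)
  (rho_perp : forall x : E, sphere x -> rho [set v : E | dot v x = 0] = 0).
Context {dO : measure_display} {Omega : measurableType dO}
  (P : probability Omega R) {n : nat} (U : {mfun Omega >-> @vecs R d n})
  (lU : box_law rho (distribution P U)).

Lemma great_enum_val (u : 'I_n -> E) (J : {set 'I_n}) :
  greatv (fun i : 'I_#|J| => u (enum_val i)) = great u J.
Proof.
congr (_ `&` _); apply/seteqP; split => y /= H.
  by apply/mem_perpv => i iJ; rewrite -(enum_rankK_in iJ iJ); exact: H.
by move=> i; move/mem_perpv: H; apply; exact: enum_valP.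
Qed.

Lemma subfam_box_law q (s : 'I_q -> 'I_n) : injective s ->
  box_law rho (distribution P (subfam U s)).
Proof.
move=> sI A mA.
pose C i := [set x : E | forall j, s j = i -> A j x].
have mC i : measurable (C i : set (borel_space R d)).
  rewrite (_ : C i = \bigcap_(j in [set j | s j = i]) A j)//.
  by apply: fin_bigcap_measurable => //; exact: finite_finset.
rewrite [LHS](_ : _ = distribution P U (box C)); last first.
  rewrite /distribution /pushforward; congr (P _); apply/seteqP; split => w H.
    by move=> i j <-; exact: H.
  by move=> j; exact: (H (s j) j erefl).
rewrite lU//; congr EFin.
have CS j : C (s j) = A j.
  by apply/seteqP; split => [x H|x Ax j' /sI ->//]; exact: H.
rewrite (bigID (mem (s @: [set: 'I_q])%SET))/= [X in _ * X]big1 ?mulr1.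
  rewrite big_imset/=; last by move=> ? ? _ _; exact: sI.
  by apply: eq_big => [j|j _]; rewrite ?finset.inE ?CS.
move=> i isg; rewrite (_ : C i = setT)//.
apply/seteqP; split => // x _ j ji.
by move: isg; rewrite -ji finset.imset_f// finset.inE.
Qed.

Lemma coordinate_perp_null (j : 'I_n) (x : E) : sphere x ->
  P [set w | dot (U w j : E) x = 0] = 0%E.
Proof.
move=> sx; pose N : set (borel_space R d) := [set v : E | dot v x = 0].
have mN : measurable N.
  apply: measurable_closed; rewrite (_ : (N : set E) = dot x @^-1` [set s | s = 0]).
    have /continuous_closedP H := @continuous_dotr R d x.
    exact: (H [set s | s = 0] (@closed_eq _ 0)).
  by apply/seteqP; split => u; rewrite /N /= dotC.
have mA (i : 'I_n) : measurable (if i == j then N else setT) by case: ifP.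
transitivity (distribution P U (box (fun i => if i == j then N else setT))); last first.
  by rewrite lU// (bigD1 j)//= eqxx rho_perp// mul0r.
congr (P _); apply/seteqP; split => w /= H; last by have := H j; rewrite eqxx.
by move=> i; case: eqP => [->|].
Qed.

(** The splitting formula with both blocks realized on the original space: the normal of index [j]
    may be treated as an independent copy while the block of [J] is held fixed. *)
Lemma integral_split_self (J : {set 'I_n}) (j : 'I_n)
    (f : @vecs R d #|J| * @vecs R d 1 -> \bar R) : j \notin J ->
  measurable_fun setT f -> (forall z, (0 <= f z)%E) ->
  (\int[P]_w f (subfam U (@enum_val _ (mem J)) w, subfam U (fun=> j) w) =
   \int[P]_w1 \int[P]_w2 f (subfam U (@enum_val _ (mem J)) w1,
                            subfam U (fun=> j) w2))%E.
Proof.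
move=> jJ mf f0.
have i1 : injective (fun _ : 'I_1 => j) by move=> x y _; rewrite !ord1.
apply: (integral_independent_split rhoT lU) => //.
- by apply: subfam_box_law; exact: enum_val_inj.
- exact: subfam_box_law.
- exact: enum_val_inj.
- by move=> i l; apply: contraNneq jJ => <-; exact: enum_valP.
Qed.

(** With the block of [J] fixed, its great subsphere is nonempty because [#|J| <= d]; a fixed point
    of it is orthogonal to the independent normal of index [j] with probability [0]. *)
Lemma ae_not_perp (J : {set 'I_n}) (j : 'I_n) : j \notin J -> (#|J| <= d)%N ->
  {ae P, forall w, exists2 y, y \in perpv (U w) J & dot (U w j : E) y != 0}.
Proof.
move=> jJ Jd.
pose Z := (@vecs R d #|J| * @vecs R d 1)%type.
pose N : set Z := [set z | forall y, greatv z.1 y -> dot (z.2 ord0 : E) y = 0].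
have mN : measurable N.
  pose c r (z : Z) (y : E) : R := `|dot (z.2 ord0 : E) y| - r.+1%:R^-1.
  rewrite -[N]setCK; apply: measurableC.
  (* Outside [N] some product is nonzero, so its absolute value reaches [r.+1%:R^-1] for some [r];
     for fixed [r] this is a closed condition, tested on the compact sphere. *)
  rewrite (_ : ~` N = \bigcup_r ([set: Z] `&` [set z |
      (greatv z.1 `&` [set y | 0 <= c r z y]) `&` sphere !=set0])).
    apply: bigcupT_measurable => r; apply: approximable_compact_hits => //.
      exact: compact_sphere.
    apply: approximableI.
      apply: (@approximable_greatv _ _ _ Z #|J| setT (fun i z => z.1 i)) => // i.
      exact: (measurableT_comp (@measurable_nth R d _ i) measurable_fst).
    apply: approximable_ge0 => // [q|z _ y].
      apply: measurable_funB; last exact: measurable_cst.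
      apply: (measurableT_comp (@normr_measurable R setT)).
      apply: measurable_dotl.
      exact: (measurableT_comp (@measurable_nth R d _ ord0) measurable_snd).
    apply: (@continuousB _ _ _ (fun y : E => `|dot (z.2 ord0 : E) y|) (fun=> _)).
      apply: (@continuous_comp _ _ _ (dot (z.2 ord0 : E)) (fun s : R => `|s|)).
        exact: continuous_dotr.
      exact: norm_continuous.
    exact: cst_continuous.
  apply/seteqP; split => [z Nz|z [r _ [_ [y [[gy cy] _]]]] Nz]; last first.
    by move: cy; rewrite /c /= Nz// normr0 sub0r oppr_ge0 leNgt invr_gt0 ltr0n.
  have [y [gy y0]] : exists y, greatv z.1 y /\ dot (z.2 ord0 : E) y != 0.
    apply: contrapT => H; apply: Nz => y gy; apply/eqP/negPn/negP => y0.
    by apply: H; exists y.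
  have y0' : 0 < `|dot (z.2 ord0 : E) y| by rewrite normr_gt0.
  have [r _ Hr] := near_infty_natSinv_lt (PosNum y0').
  exists r => //; split => //; exists y; split; last by case: gy.
  by split => //; rewrite /c /= subr_ge0 ltW//; exact: (Hr r (leqnn r)).
have mN1 : measurable_fun setT (fun z => (\1_N z : R)%:E).
  by apply/measurable_EFinP; exact: measurable_indic.
have N10 z : (0 <= (\1_N z : R)%:E)%E by rewrite lee_fin.
have := integral_split_self jJ mN1 N10.
rewrite [X in _ = X -> _]integral0_eq; last first.
  move=> w _.
  have mV : measurable_fun setT (fun w2 => (subfam U (@enum_val _ (mem J)) w, subfam U (fun=> j) w2) : Z).
    by apply: measurable_fun_pair; [exact: measurable_cst|exact: measurable_funPT].
  pose N' : set Omega := (fun w2 => (subfam U (@enum_val _ (mem J)) w, subfam U (fun=> j) w2) : Z) @^-1` N.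
  have mN' : measurable N' by rewrite -[X in measurable X]setTI; exact: mV.
  rewrite (eq_integral (fun w2 => (\1_N' w2 : R)%:E))//.
  rewrite integral_indic// setIT.
  have [y gy] := convex_body_neq0
    (greatv_convex_body (subfam U (@enum_val _ (mem J)) w) Jd).
  have sy : sphere y by case: gy.
  apply/eqP; rewrite eq_le measure_ge0 andbT.
  rewrite -[X in (_ <= X)%E](coordinate_perp_null j sy) le_measure ?inE//.
    rewrite -[X in measurable X]setTI.
    have := measurable_dotl y (measurableT_comp (@measurable_nth R d n j) (measurable_funPT U)).
    by move=> /(_ measurableT [set 0] (measurable_set1 _)).
  by move=> w2 /= Nw; exact: Nw.
have mV : measurable_fun setT (fun w => (subfam U (@enum_val _ (mem J)) w, subfam U (fun=> j) w) : Z).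
  by apply: measurable_fun_pair; exact: measurable_funPT.
have m1V := measurableT_comp mN1 mV.
move=> /(ge0_integral_eq0_ae m1V (fun w => N10 _)).
apply: filterS => w /= [] /eqP; rewrite indicE pnatr_eq0 eqb0 notin_setE => Nw.
apply: contrapT => H; apply: Nw => y; rewrite -/(greatv _) => gy.
apply/eqP/negPn/negP => uy; apply: H; exists y => //.
by move: gy; rewrite /= great_enum_val => -[].
Qed.

Lemma ae_gen_position : {ae P, forall w, gen_position (U w : 'I_n -> E)}.
Proof.
have H : {ae P, forall w, forall J : {set 'I_n}, forall j : 'I_n,
    j \notin J -> (#|J| <= d)%N ->
    exists2 y, y \in perpv (U w) J & dot (U w j : E) y != 0}.
  apply: filter_forall => J; apply: filter_forall => j.
  have [jJ|jJ] := boolP (j \notin J); last first.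
    by apply: (@filterS _ _ _ setT); [move=> w _ h; case/negP: jJ|exact: filterT].
  have [Jd|Jd] := leqP #|J| d; last first.
    by apply: (@filterS _ _ _ setT); [move=> w _ _|exact: filterT].
  by apply: filterS (ae_not_perp jJ Jd) => w h _ _.
apply: filterS H => w H J; elim/fset_ind: J => [|j J jJ IH].
  by rewrite perpv0 dim_fullvE finset.cards0 subn0.
rewrite cardsU1 jJ => Jd; rewrite perpvU1.
have [_ dc] := dim_capv_orthv (perpv (U w) J) (U w j : E).
have := dc (H J j jJ Jd); rewrite IH ?(leq_trans _ Jd)//.
by move: Jd; rewrite ltnS => Jd; rewrite subSn// => -[<-]; rewrite add1n subSS.
Qed.

(** By Tonelli, since each fixed point of the great subsphere is orthogonal to the independent
    normal with probability [0]. No statement on the [k]-dimensional measure of lower-dimensional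
    subspheres is involved. *)
Lemma ae_overlap_null k (J : {set 'I_n}) (j : 'I_n) : j \notin J -> (#|J| <= d)%N ->
  {ae P, forall w, sphere_kernel k (great (U w) J)
    [set x : E | dot (U w j : E) x = 0] = 0%E}.
Proof.
move=> jJ Jd.
pose Z := (@vecs R d #|J| * @vecs R d 1)%type.
pose g (z : Z) : body_space R d := greatv z.1.
have mg : measurable_fun setT g.
  exact: (measurableT_comp (measurable_greatv Jd) measurable_fst).
pose D : set (Z * borel_space R d) :=
  [set zx | dot (zx.1.2 ord0 : E) zx.2 = 0 /\ sphere zx.2].
have mdot : measurable_fun setT (fun zx : Z * borel_space R d => dot (zx.1.2 ord0 : E) (zx.2 : E)).
  apply: measurable_dot; last exact: measurable_snd.
  have m1 : measurable_fun setT (fun zx : Z * borel_space R d => zx.1.2).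
    exact: (measurableT_comp measurable_snd measurable_fst).
  exact: (measurableT_comp (@measurable_nth R d 1 ord0) m1).
have msph : measurable (sphere : set (borel_space R d)).
  by apply: measurable_closed; exact: closed_sphere.
have mD : measurable D.
  have := mdot measurableT [set 0] (measurable_set1 _); rewrite setTI => m1.
  have := @measurable_snd _ _ Z (borel_space R d) measurableT _ msph.
  by rewrite setTI => m2; exact: measurableI.
have mD1 : measurable_fun setT (fun zx => (\1_D zx : R)%:E).
  by apply/measurable_EFinP; exact: measurable_indic.
have D10 zx : (0 <= (\1_D zx : R)%:E)%E by rewrite lee_fin.
pose f (z : Z) : \bar R := (\int[sphere_kernel k (g z)]_x (\1_D (z, x) : R)%:E)%E.
have mf : measurable_fun setT f.
  exact: (@measurable_integral_pullback _ _ _ _ _ _ _ _ g mg (fun zx => (\1_D zx : R)%:E)).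
have f0 z : (0 <= f z)%E by apply: integral_ge0.
have fE z : f z = sphere_kernel k (g z) (xsection D z).
  rewrite /f (eq_integral (fun x => (\1_(xsection D z) x : R)%:E)).
    by rewrite integral_indic ?setIT//; exact: (measurable_xsection z mD).
  by move=> x _; rewrite !indicE mem_xsection.
have := integral_split_self jJ mf f0.
rewrite [X in _ = X -> _]integral0_eq; last first.
  move=> w _; pose G : body_space R d := greatv (subfam U (@enum_val _ (mem J)) w).
  pose h (wx : Omega * borel_space R d) : \bar R :=
    (\1_D ((subfam U (@enum_val _ (mem J)) w, subfam U (fun=> j) wx.1), wx.2) : R)%:E.
  have mh : measurable_fun setT h.
    apply: (measurableT_comp mD1); apply: measurable_fun_pair; last exact: measurable_snd.
    apply: measurable_fun_pair; first exact: measurable_cst.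
    exact: (measurableT_comp (measurable_funPT _) measurable_fst).
  have h0 wx : (0 <= h wx)%E by exact: D10.
  transitivity (\int[P]_w2 \int[sphere_measure k G]_x h (w2, x))%E; first by [].
  rewrite fubini_tonelli//; apply: integral0_eq => x _.
  have [sx|sx] := pselect (sphere (x : E)); last first.
    apply: integral0_eq => w2 _; rewrite /h indicE memNset// => -[_].
    by [].
  rewrite (eq_integral (fun w2 => (\1_([set w2 | dot (U w2 j : E) x = 0]) w2 : R)%:E)).
    rewrite integral_indic ?setIT//; first exact: coordinate_perp_null.
    rewrite -[X in measurable X]setTI.
    have := measurable_dotl x (measurableT_comp (@measurable_nth R d n j) (measurable_funPT U)).
    by move=> /(_ measurableT [set 0] (measurable_set1 _)).
  move=> w2 _; rewrite /h !indicE; congr (_%:R%:E); congr nat_of_bool.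
  by apply/idP/idP; rewrite !inE => // -[].
have mV : measurable_fun setT (fun w => (subfam U (@enum_val _ (mem J)) w, subfam U (fun=> j) w) : Z).
  by apply: measurable_fun_pair; exact: measurable_funPT.
move=> /(ge0_integral_eq0_ae (measurableT_comp mf mV) (fun w => f0 _)).
apply: filterS => w /=; rewrite fE.
rewrite /g /= great_enum_val => <-.
have [h|h] := pselect (finite_great k (great (U w) J)); last by rewrite !sphere_kernelN.
rewrite !sphere_kernelE//; congr hausdorff; apply/seteqP.
split => x [H [sx gx]]; split => //; rewrite /xsection/=.
  by rewrite inE.
by move: H; rewrite /xsection /= inE => -[].
Qed.

End almost_sure_position.

(** * The sigma-field of a tessellation and a point *)

Section cells_and_dense_points.
Context {R : realType} {d n : nat}.
Local Notation E := 'rV[R]_d.+1.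
Implicit Types (u : 'I_n -> E) (x y z : E) (O : set E).

Lemma nonzero_avoid u : (forall i, u i != 0) -> exists z, forall i, dot (u i) z != 0.
Proof.
move=> u0; have [i _|z _ Hz] := @avoid_zeros _ _ _ u fullv predT.
  by exists (u i); rewrite ?memvf// dot_eq0.
by exists z => i; exact: Hz.
Qed.

Lemma ocell_dense u x O : gen u x -> open O -> face_at u x `&` O !=set0 ->
  exists l, [/\ sphere (sphvec l : E), O (sphvec l) & ocell u x (sphvec l)].
Proof.
move=> gx oO [y [fy Oy]].
have [e e0 eO] := (open_eballP _).1 oO y Oy.
rewrite -(closure_ocell gx) in fy.
have [|z [[sz zx] yz]] := fy (eball y (e / 2)).
  by apply/nbhs_eball; exists (e / 2) => //; rewrite divr_gt0.
have H : \forall z' \near z, forall i, 0 < dot (u i) x * dot (u i) z'.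
  suff Hi i : \forall z' \near z, 0 < dot (u i) x * dot (u i) z'.
    exact: (@filter_forall _ _ _ _ (nbhs_filter z) Hi).
  have cd : {for z, continuous (fun z => dot (u i) x * dot (u i) z)}.
    apply: (@continuousM _ _ (fun=> dot (u i) x) (dot (u i))).
      exact: cst_continuous.
    exact: continuous_dotr.
  apply: (cd [set s | 0 < s]); apply: open_nbhs_nbhs.
  by split; [exact: (@open_gt _ 0)|exact: zx].
have [dl dl0 Hdl] := (nbhs_eball _ _).1 H.
have m0 : 0 < Num.min dl (e / 2) by rewrite lt_min dl0 divr_gt0.
have [l [sl]] := sphvec_dense sz m0; rewrite lt_min => /andP[l1 l2].
exists l; split => //; last by split => //; exact: Hdl.
apply: eO; rewrite /eball/= (le_lt_trans (enorm_triangle z _ _))//.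
by move: l2 yz; rewrite /eball/=; move: (enorm _) (enorm _) => p p' *; lra.
Qed.

Lemma ocell_face u x y : ocell u x y -> face_at u x y.
Proof.
move=> [sy H]; split => // i; rewrite /side ifF ?ltW//.
by apply/negbTE; apply: contraTneq (H i) => ->; rewrite mul0r ltxx.
Qed.

(** A cell is the closure of its open cell, so hitting an open set is witnessed by a dense point.
    Existence of a cell becomes a countable union, avoidance a countable intersection. *)
Lemma cell_hit_avoid u O1 O2 : (0 < d)%N -> open O1 -> open O2 ->
  (exists2 P, tess u P & P `&` O1 !=set0 /\ ~ (P `&` O2 !=set0)) <->
  exists2 j, O1 (sphvec j) & gen u (sphvec j) /\
    forall l, O2 (sphvec l) -> sphere (sphvec l : E) -> ~ ocell u (sphvec j) (sphvec l).
Proof.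
move=> d0 o1 o2; split=> [[P]|[j jO1 [gj H]]].
  rewrite tessE// => -[x gx <-] [h1 h2].
  have [j [sj jO1 cj]] := ocell_dense gx o1 h1.
  have gj := ocell_gen cj; exists j => //; split => // l lO2 sl cl.
  apply: h2; exists (sphvec l); split => //.
  by rewrite (face_at_eq (ocell_face cj) gx gj); exact: ocell_face.
exists (face_at u (sphvec j)); first by rewrite tessE//; exists (sphvec j).
split=> [|h2].
  by exists (sphvec j); split => //; apply: face_at_center; case: gj.
by have [l [sl lO2 cl]] := ocell_dense gj o2 h2; exact: (H l).
Qed.

(** Near [x] the constraints that are not tight at [x] keep their signs, and tight ones do not
    exclude [x] from any cell. The radius is the same for all cells. *)
Lemma cell_near u x : sphere x -> exists2 dl : R, 0 < dl &
  forall x0 y, gen u x0 -> face_at u x0 y -> enorm (y - x) < dl -> face_at u x0 x.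
Proof.
move=> sx.
have H : \forall y \near x, forall i, dot (u i) x != 0 -> 0 < dot (u i) x * dot (u i) y.
  suff Hi i : \forall y \near x, dot (u i) x != 0 -> 0 < dot (u i) x * dot (u i) y.
    exact: (@filter_forall _ _ _ _ (nbhs_filter x) Hi).
  have [ux|ux] := eqVneq (dot (u i) x) 0.
    by apply: (@filterS _ _ _ setT) => //; exact: filterT.
  have cd : {for x, continuous (fun z => dot (u i) x * dot (u i) z)}.
    apply: (@continuousM _ _ (fun=> dot (u i) x) (dot (u i))).
      exact: cst_continuous.
    exact: continuous_dotr.
  have : nbhs x [set z | 0 < dot (u i) x * dot (u i) z].
    apply: (cd [set s | 0 < s]); apply: open_nbhs_nbhs.
    split; first exact: (@open_gt _ 0).
    by rewrite /= -expr2 exprn_even_gt0.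
  by apply: filterS => z hz _.
have [dl dl0 Hdl] := (nbhs_eball _ _).1 H.
exists dl => // x0 y gx0 [_ /(cone_genP _ gx0) Cy] yx; split => //.
apply/(cone_genP _ gx0) => i.
have [->|ux] := eqVneq (dot (u i) x) 0; first by rewrite mulr0.
rewrite mulrC; apply: (@same_sign _ (dot (u i) y)); last by rewrite mulrC.
by rewrite mulrC; exact: Hdl.
Qed.

End cells_and_dense_points.

(** * Events of the tessellation and the face around a point *)

Section tessellation_events.
Context {R : realType} {d : nat} (d_gt0 : (0 < d)%N).
Context {dO : measure_display} {Omega : measurableType dO} {n : nat}.
Local Notation E := 'rV[R]_d.+1.
Context (U : {mfun Omega >-> @vecs R d n}).
Context (T : Omega -> collection_space R d)
  (TE : forall w, T w = tess (U w : 'I_n -> E)).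

Definition cell_event (O1 O2 : set E) : set Omega :=
  [set w | exists2 K, T w K & K `&` O1 !=set0 /\ ~ (K `&` O2 !=set0)].

Let mU i : measurable_fun setT (fun w => U w i : borel_space R d).
Proof. exact: (measurableT_comp (@measurable_nth R d n i) (measurable_funPT U)). Qed.

Let measurable_lt0 (f : Omega -> R) : measurable_fun setT f ->
  measurable [set w | 0 < f w].
Proof.
move=> mf; have := mf measurableT _ (measurable_itv `]0, +oo[).
by rewrite setTI; congr measurable; apply/seteqP; split => w; rewrite /= in_itv/= andbT.
Qed.

Let measurable_ocell (x y : E) :
  measurable [set w | ocell (U w : 'I_n -> E) x y].
Proof.
have [sy|sy] := pselect (sphere y); last first.
  by rewrite (_ : [set _ | _] = set0)//; apply/seteqP; split => // w [].
rewrite (_ : [set _ | _] = \bigcap_(i in [set: 'I_n])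
    [set w | 0 < dot (U w i : E) x * dot (U w i : E) y]).
  apply: fin_bigcap_measurable => [|i _]; first exact: finite_finset.
  by apply: measurable_lt0; apply: measurable_funM; apply: measurable_dotl.
by apply/seteqP; split => w; [move=> [_ H] i _; exact: H|
  move=> H; split => // i; exact: H].
Qed.

Let measurable_gen (x : E) : measurable [set w | gen (U w : 'I_n -> E) x].
Proof.
have -> : [set w | gen (U w : 'I_n -> E) x] = [set w | ocell (U w : 'I_n -> E) x x].
  apply/seteqP; split => w [sx H]; split => // i.
    by rewrite -expr2 exprn_even_gt0//= H.
  by apply: contraTneq (H i) => ->; rewrite mul0r ltxx.
exact: measurable_ocell.
Qed.

Lemma measurable_cell_event O1 O2 : open O1 -> open O2 ->
  measurable (cell_event O1 O2).
Proof.
move=> o1 o2; rewrite (_ : cell_event O1 O2 =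
  \bigcup_(j in [set j | O1 (sphvec j)])
    ([set w | gen (U w : 'I_n -> E) (sphvec j)] `&`
     \bigcap_(l in [set l | O2 (sphvec l) /\ sphere (sphvec l : E)])
       ~` [set w | ocell (U w : 'I_n -> E) (sphvec j) (sphvec l)])).
  apply: bigcup_measurable => j _; apply: measurableI => //.
  apply: bigcap_measurableType => l _; exact: measurableC.
apply/seteqP; split => w.
  rewrite /cell_event/= TE => /(cell_hit_avoid _ d_gt0 o1 o2)[j jO1 [gj H]].
  by exists j => //; split => // l [lO2 sl]; exact: H.
move=> [j jO1 [gj H]]; rewrite /cell_event/= TE; apply/(cell_hit_avoid _ d_gt0 o1 o2).
by exists j => //; split => // l lO2 sl; exact: H.
Qed.

(** [T] comes as a plain function, not as a measurable one, so measurability of the event is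
    demanded separately. *)
Definition tessellation_event (A : set Omega) := measurable A /\
  exists2 X : set (collection_space R d), measurable X & A = T @^-1` X.

(** The event is the complement of a zero count: no member among the bodies that hit [O1] but not
    [O2]. *)
Lemma tessellation_cell_event O1 O2 : open O1 -> open O2 ->
  tessellation_event (cell_event O1 O2).
Proof.
move=> o1 o2; split; first exact: measurable_cell_event.
pose B : set (body_space R d) := hits O1 `\` hits O2.
have mB : measurable B by apply: measurableD; exact: measurable_hits.
exists (~` [set Q | (Q `&` B #= `I_0)%card]).
  apply: measurableC; apply: sub_sigma_algebra; exists B, 0%N; split => //.
  by move=> K [[]].
apply/seteqP; split => w.
  move=> [K TK [h1 h2]] /=; rewrite II0 card_eq0 => /eqP e.
  have : (T w `&` B) K.
    split => //; split; last by move=> [].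
    split => //; move: TK; rewrite TE tessE// => -[x [sx _] <-].
    exact: convex_body_face_at.
  by rewrite e.
rewrite /preimage /= II0 card_eq0 => /negP/set0P[K [TK [[bK h1] h2]]].
by exists K => //; split => // h; apply: h2.
Qed.

Lemma tessellation_eventT : tessellation_event setT.
Proof. by split => //; exists setT => //; rewrite preimage_setT. Qed.

Lemma tessellation_eventI A B : tessellation_event A -> tessellation_event B ->
  tessellation_event (A `&` B).
Proof.
move=> [mA [X mX AX]] [mB [Y mY BY]]; split; first exact: measurableI.
by exists (X `&` Y); [exact: measurableI|rewrite AX BY].
Qed.

Definition event_rects : set (set (Omega * E)) :=
  [set A `*` B | A in tessellation_event & B in
    (@measurable _ (borel_space R d) : set (set E))].

(* The product of the sigma-field of events describing the tessellation and the
   Borel sigma-field; it is on this sigma-field that the law of the random point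
   given the tessellation determines the joint law. *)
Definition pointed_space := g_sigma_algebraType event_rects.

Lemma measurable_event_rect A (B : set (borel_space R d)) : tessellation_event A ->
  measurable B -> measurable (A `*` B : set pointed_space).
Proof. by move=> tA mB; apply: sub_sigma_algebra; exists A => //; exists B. Qed.

Lemma pointed_measurable_prod (D : set pointed_space) : measurable D ->
  measurable (D : set (Omega * borel_space R d)).
Proof.
move: D; apply: smallest_sub; first exact: sigma_algebra_measurable.
by move=> _ [A [mA _] [B mB <-]]; exact: measurableX.
Qed.

Definition sphere_points : set pointed_space := setT `*` sphere.

Lemma measurable_sphere_points : measurable sphere_points.
Proof.
apply: measurable_event_rect; first exact: tessellation_eventT.
by apply: measurable_closed; exact: closed_sphere.
Qed.

Definition pointed_face (wx : pointed_space) : body_space R d :=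
  face_at (U wx.1 : 'I_n -> E) (wx.2 : E).

Context (U_neq0 : forall w i, (U w i : E) != 0).

(** The face being the intersection of the cells containing [x], a point is outside it iff one of
    these closed cells misses a ball around the point. The surrogate is therefore the complement of
    [B], which mentions the cells only. *)
Lemma measurable_pointed_face : measurable_fun sphere_points pointed_face.
Proof.
apply: approximable_body_measurable.
- exact: measurable_sphere_points.
- by move=> [w x] [_ sx]; exact: convex_body_face_at.
pose B r q : set pointed_space := [set wx | exists2 K, tess (U wx.1 : 'I_n -> E) K &
  K (wx.2 : E) /\ ~ (K `&` eball q r.+1%:R^-1 !=set0)].
have n0 r : 0 < r.+1%:R^-1 :> R by rewrite invr_gt0.
exists (fun r q => ~` B r q); split.
- move=> r q; rewrite -setDE; apply: measurableD; first exact: measurable_sphere_points.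
  rewrite (_ : B r q = (B r q `\` sphere_points) `|` (sphere_points `&` B r q)); last first.
    by apply/seteqP; split => z; [move=> Bz; have [s|s] := pselect (sphere_points z);
      [right|left]|move=> [[]|[]]].
  rewrite (_ : B r q `\` sphere_points = set0) ?set0U; last first.
    apply/seteqP; split => // -[w x] [[K + [Kx _]] ns]; rewrite tessE// => -[y _ Ky].
    by apply: ns; split => //; move: Kx; rewrite -Ky => -[].
  (* A cell containing [x] is replaced by cells meeting ever smaller rational balls that contain
     [x]; by [cell_near] such a cell contains [x] once the ball is small. This leaves a countable
     combination of rectangles. *)
  rewrite (_ : _ `&` _ = sphere_points `&` \bigcap_m \bigcup_j
     (cell_event (eball (ratvec j) m.+1%:R^-1) (eball q r.+1%:R^-1) `*`
      eball (ratvec j) m.+1%:R^-1)).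
    apply: measurableI; first exact: measurable_sphere_points.
    apply: bigcapT_measurable => m; apply: bigcupT_measurable => j.
    apply: measurable_event_rect; last by apply: measurable_open; exact: open_eball.
    by apply: tessellation_cell_event; exact: open_eball.
  apply/seteqP; split => -[w x].
    move=> [[_ sx] [K TK [Kx Kq]]]; split => // m _.
    have [j jx] := ratvec_dense (x : E) (n0 m); exists j => //; split => /=.
      exists K; first by rewrite TE.
      by split => //; exists x; split => //; rewrite /eball/= enormB.
    by rewrite /eball/= enormB.
  move=> [[_ sx] H]; split => //.
  have [dl dl0 Hdl] := cell_near (U w : 'I_n -> E) sx.
  have dl2 : 0 < dl / 2 by rewrite divr_gt0.
  have [m _ Hm] := near_infty_natSinv_lt (PosNum dl2).
  have /= mdl := Hm m (leqnn m).
  have [j _ [/= [K TK [[y [Ky yj]] Kq]] xj]] := H m Logic.I.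
  exists K; first by rewrite -TE.
  split => //; move: TK; rewrite TE tessE// => -[x0 gx0 Kx0].
  rewrite -Kx0 in Ky *; apply: (Hdl _ y) => //.
  rewrite (le_lt_trans (enorm_triangle (ratvec j) _ _))// (enormB (ratvec j)).
  move: yj xj mdl; rewrite /eball/=; set c := _^-1.
  by move: (enorm _) (enorm _) => p p' *; lra.
- move=> [w x] y r [_ sx] fy; apply/nbhs_eball; exists r.+1%:R^-1 => // q yq.
  move=> [K TK [Kx]]; apply; exists y; split; last by rewrite /eball/= enormB.
  move: fy; rewrite /pointed_face /= face_at_bigcap//; last exact: nonzero_avoid.
  by apply.
- move=> [w x] y [_ sx] H; rewrite /pointed_face /= face_at_bigcap//; last first.
    exact: nonzero_avoid.
  move=> K [TK Kx].
  have cK : closed K by move: TK; rewrite tessE// => -[x0 _ <-]; exact: closed_face_at.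
  apply: ((closed_eballP _).1 cK) => e e0.
  have e2 : 0 < e / 2 by rewrite divr_gt0.
  have [M _ HM] := near_infty_natSinv_lt (PosNum e2).
  have [|r [q [Mr qy Aq]]] := H M (eball y (e / 2)).
    by apply/nbhs_eball; exists (e / 2).
  have [z [Kz zq]] : K `&` eball q r.+1%:R^-1 !=set0.
    by apply: contrapT => h; apply: Aq; exists K.
  exists z => //; have /= h2 := HM r Mr.
  rewrite (le_lt_trans (enorm_triangle q _ _))//.
  move: zq qy h2; rewrite /eball/=; set c := _^-1.
  by move: (enorm _) (enorm _) => p p' *; lra.
Qed.

End tessellation_events.

(** * The joint law of the tessellation and the random point *)

Section nonmeasurable_integrands.
Context {R : realType} {dT : measure_display} {T : measurableType dT}
  (mu : {measure set T -> \bar R}).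
Import HBNNSimple.
Local Open Scope ereal_scope.

Let nnint (f : T -> \bar R) := ereal_sup [set sintegral mu h |
  h in [set h : {nnsfun T >-> R} | forall x, (h x)%:E <= f x]].

Let ae_nnintegral_le (f g : T -> \bar R) : (forall x, 0 <= g x) ->
  {ae mu, forall x, f x <= g x} -> nnint f <= nnint g.
Proof.
move=> g0 [N [mN N0 fgN]]; apply: ub_ereal_sup => _ [s /= sf <-].
pose s' : {nnsfun T >-> R} := mul_nnsfun s (indic_nnsfun R (measurableC mN)).
have s'E x : s' x = (s x * \1_(~` N) x)%R by [].
apply: (@le_trans _ _ (sintegral mu s')); last first.
  apply: ereal_sup_ubound; exists s' => // x; rewrite [s' x]s'E indicE.
  have [/set_mem Nx|_] := boolP (x \in ~` N); last by rewrite mulr0.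
  rewrite mulr1 (le_trans (sf x))//.
  by apply: contrapT => h; apply: Nx; exact: fgN.
rewrite -!integralT_nnsfun le_eqVlt; apply/orP; left; apply/eqP.
apply: ge0_ae_eq_integral => //.
- by apply/measurable_EFinP; exact: measurable_funPT.
- by apply/measurable_EFinP; exact: measurable_funPT.
- by move=> x _; rewrite lee_fin; exact: fun_ge0.
- by move=> x _; rewrite lee_fin; exact: fun_ge0.
exists N; split => // x h; apply: contrapT => Nx; apply: h => _.
by rewrite [s' x]s'E indicE mem_set// mulr1.
Qed.

Let ge0_ae_integral_congr (D : set T) (f g : T -> \bar R) :
  (forall x, D x -> 0 <= f x) -> (forall x, D x -> 0 <= g x) ->
  {ae mu, forall x, D x -> f x = g x} ->
  \int[mu]_(x in D) f x = \int[mu]_(x in D) g x.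
Proof.
move=> f0 g0 fg.
have p0 h : (forall x, D x -> 0 <= h x) -> forall x, 0 <= (h \_ D) x.
  by move=> h0 x; rewrite patchE; case: ifPn => // /set_mem/h0.
rewrite !ge0_integralE//; apply/eqP.
rewrite -/(nnint (f \_ D)) -/(nnint (g \_ D)) eq_le.
by rewrite !ae_nnintegral_le//; try (exact: p0); apply: filterS fg => x H;
  rewrite !patchE; case: ifPn => // /set_mem/H ->.
Qed.

(* No measurability is assumed: the integral of a nonnegative function is a
   supremum over simple minorants, which may be cut off on a null set. *)
Lemma ae_integral_congr (D : set T) (f g : T -> \bar R) :
  {ae mu, forall x, D x -> f x = g x} ->
  \int[mu]_(x in D) f x = \int[mu]_(x in D) g x.
Proof.
move=> fg; rewrite [LHS]integralE [RHS]integralE; congr (_ - _);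
  by apply: ge0_ae_integral_congr => // ; apply: filterS fg => x H Dx;
    rewrite ?funeposE ?funenegE H.
Qed.

End nonmeasurable_integrands.

Lemma measure_almost_disjoint {R : realType} {dT : measure_display}
    {T : measurableType dT} (mu : {measure set T -> \bar R}) (I : eqType)
    (s : seq I) (F : I -> set T) : uniq s -> (forall i, measurable (F i)) ->
  (forall i j, i \in s -> j \in s -> i != j -> mu (F i `&` F j) = 0%E) ->
  mu (\big[setU/set0]_(i <- s) F i) = (\sum_(i <- s) mu (F i))%E.
Proof.
move=> + mF; elim: s => [_ _|i s IH /= /andP[iu us] F0].
  by rewrite !big_nil measure0.
rewrite !big_cons -IH//; last first.
  by move=> j l js ls; apply: F0; rewrite in_cons ?js ?ls orbT.
set B := \big[setU/set0]_(j <- s) F j.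
have mB : measurable B by apply: bigsetU_measurable.
have i0 : mu (B `&` F i) = 0%E.
  have : forall j, j \in s -> mu (F j `&` F i) = 0%E.
    move=> j js; apply: F0; rewrite ?mem_head// ?in_cons ?js ?orbT//.
    by apply: contraNneq iu => <-.
  rewrite /B; elim: (s) => [_|j r IHr H]; first by rewrite big_nil set0I measure0.
  rewrite big_cons setIUl measureU0 ?H ?mem_head//; first exact: measurableI.
    by apply: measurableI => //; apply: bigsetU_measurable.
  by apply: IHr => l lr; rewrite H// in_cons lr orbT.
have -> : mu B = mu (B `\` F i).
  by apply: (etrans (measureDI mu mB (mF i))); rewrite [X in (_ + X)%E]i0 adde0.
rewrite -measureU//; last 2 first.
- exact: measurableD.
- by rewrite setDE setICA setICr setI0.
congr (mu _); apply/seteqP; split => x [|]; first by left.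
- by have [|] := pselect (F i x); [left|right].
- by left.
- by case; right.
Qed.

(** * The joint measure of an outcome and a point drawn from a kernel *)

Section kernel_graph.
Context {dO dY dZ : measure_display} {Omega : measurableType dO}
  {Y : measurableType dY} {Z : measurableType dZ} {R : realType}.
Context (P : probability Omega R) (k : R.-fker Y ~> Z) (g : Omega -> Y).
Context (mg : measurable_fun setT g).
Local Open Scope ereal_scope.

(** The measure of pairs [(w, z)] with [w] fixed and [z] distributed as [k (g w)]. The dummy factor
    [unit] is the source of the kernel composition that defines [kernel_graph]. *)
Definition graph_slice (tw : unit * Omega) :
  {measure set (Omega * Z)%type -> \bar R}.
Proof.
unshelve refine (pushforward (k (g tw.2)) (pair tw.2) :
  {measure set (Omega * Z)%type -> \bar R}).
exact: pair1_measurable.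
Defined.

Local Notation slice := graph_slice.

Let sliceE tw (D : set (Omega * Z)) : slice tw D = k (g tw.2) (xsection D tw.2).
Proof. by rewrite /slice /= /pushforward xsectionE. Qed.

Let measurable_slice (D : set (Omega * Z)) : measurable D ->
  measurable_fun setT (slice ^~ D).
Proof.
move=> mD; pose f (z : Omega * Z) : \bar R := (\1_D z : R)%:E.
have mf : measurable_fun setT f by apply/measurable_EFinP; exact: measurable_indic.
have f0 z : 0 <= f z by rewrite lee_fin.
have := @measurable_integral_pullback _ _ _ _ _ _ _ k g mg f mf f0.
have := @measurable_snd _ _ unit Omega.
move=> H1 H2; apply: eq_measurable_fun (measurableT_comp H2 H1) => tw _ /=.
rewrite sliceE (eq_integral (fun x => (\1_(xsection D tw.2) x : R)%:E)).
  by rewrite integral_indic ?setIT//; exact: (measurable_xsection tw.2 mD).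
by move=> x _; rewrite /f !indicE mem_xsection.
Qed.

HB.instance Definition _ := isKernel.Build _ _ (unit * Omega)%type (Omega * Z)%type R
  slice measurable_slice.

Let slice_uub : measure_fam_uub slice.
Proof.
have [r Hr] := measure_uub k; exists r => x.
rewrite sliceE (_ : xsection _ _ = setT) ?Hr//.
by apply/seteqP; split => // z _; rewrite xsectionE.
Qed.

HB.instance Definition _ := Kernel_isFinite.Build _ _ (unit * Omega)%type
  (Omega * Z)%type R slice slice_uub.

Let base : R.-pker unit ~> Omega :=
  kprobability (@measurable_cst _ _ unit (pprobability Omega R) setT P).

Definition kernel_graph : {measure set (Omega * Z)%type -> \bar R} :=
  (base \; slice) tt.

Lemma kernel_graphE (D : set (Omega * Z)) :
  kernel_graph D = \int[P]_w k (g w) (xsection D w).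
Proof. by rewrite /kernel_graph /= /kcomp; apply: eq_integral => w _; rewrite sliceE. Qed.

Lemma integral_kernel_graph (f : Omega * Z -> \bar R) :
  measurable_fun setT f -> (forall z, 0 <= f z) ->
  \int[kernel_graph]_z f z = \int[P]_w \int[k (g w)]_x f (w, x).
Proof.
move=> mf f0; rewrite /kernel_graph /= (integral_kcomp base slice)//.
apply: eq_integral => w _; rewrite /slice /=.
rewrite ge0_integral_pushforward//.
Qed.

End kernel_graph.

Lemma dim_ge_face_at {R : realType} {d n m : nat} (u : 'I_n -> 'rV[R]_d.+1) x :
  sphere x -> dim_ge m (face_at u x) <-> (m <= \dim (perpv u (zeros u x)))%N.
Proof.
move=> sx; have LE := lin_hull_face_at u sx; split=> [|mL V KV].
  by apply; rewrite -LE; exact: lin_hull_sub.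
apply: (leq_trans mL); apply/dimvS/subvP => y yL.
have : lin_hull (face_at u x) y by rewrite LE.
by apply.
Qed.

(** * Averaging over the sets of [d - k] indices *)

Section pointed_law.
Context {R : realType} {d k n : nat} (d_gt0 : (0 < d)%N) (k_le_d : (k <= d)%N)
  (n_ge : (d - k <= n)%N).
Local Notation E := 'rV[R]_d.+1.
Context (rho : set (borel_space R d) -> R) (rhoT : rho setT = 1)
  (rho_perp : forall x : E, sphere x -> rho [set v : E | dot v x = 0] = 0).
Context {dO : measure_display} {Omega : measurableType dO}
  (P : probability Omega R) (U : {mfun Omega >-> @vecs R d n})
  (lU : box_law rho (distribution P U)).
Context (T : Omega -> collection_space R d)
  (TE : forall w, T w = tess (U w : 'I_n -> E)).
Context (U_neq0 : forall w i, (U w i : E) != 0).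
Context (v : {RV P >-> borel_space R d}) (v_uniform : uniform_on_skeleton k T v).
Local Open Scope ereal_scope.

Definition codim_set := {J : {set 'I_n} | #|J| == (d - k)%N}.

Local Notation omega0 := (hausdorff k (ref_sphere k : set E)).
Local Notation gr J := (fun w => great (U w : 'I_n -> E) (val (J : codim_set)) : body_space R d).

Lemma card_codim_set : (0 < #|{: codim_set}|)%N.
Proof.
rewrite card_sig.
have -> : #|[pred J : {set 'I_n} | #|J| == (d - k)%N]| = 'C(n, d - k).
  by rewrite -[n in 'C(n, _)]card_ord -card_draws cardsE.
by rewrite bin_gt0.
Qed.

Lemma great_gen_position (u : 'I_n -> E) (J : codim_set) : gen_position u ->
  great_subsphere k (great u (val J)).
Proof.
move=> gu; have /eqP cJ := valP J.
exists (perpv u (val J)) => //; rewrite gu cJ; first by lia.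
by rewrite leqW// leq_subr.
Qed.

Lemma measurable_gr (J : codim_set) : measurable_fun setT (gr J).
Proof.
have /eqP cJ := valP J.
have Jd : (#|val J| <= d)%N by rewrite cJ leq_subr.
have := measurableT_comp (measurable_greatv Jd)
  (measurable_funPT (subfam U (@enum_val _ (mem (val J))))).
by apply: eq_measurable_fun => w _; rewrite /= great_enum_val.
Qed.

Lemma ae_overlaps : {ae P, forall w, forall Jj : codim_set * 'I_n,
  Jj.2 \notin val Jj.1 ->
  sphere_kernel k (gr Jj.1 w) [set x : E | dot (U w Jj.2 : E) x = 0%R] = 0}.
Proof.
suff HJ (Jj : codim_set * 'I_n) : {ae P, forall w, Jj.2 \notin val Jj.1 ->
    sphere_kernel k (gr Jj.1 w) [set x : E | dot (U w Jj.2 : E) x = 0%R] = 0}.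
  exact: (@filter_forall _ _ _ _ (ae_filter_ringOfSetsType P) HJ).
have [_|jJ] := boolP (Jj.2 \in val Jj.1); first by apply: aeW.
have /eqP cJ := valP Jj.1.
have := @ae_overlap_null R d rho rhoT rho_perp _ _ P n U lU k (val Jj.1) Jj.2 jJ.
by rewrite cJ leq_subr => /(_ isT); apply: filterS => w h _.
Qed.

Lemma ae_skeleton_measure : omega0 < +oo ->
  {ae P, forall w (B : set (borel_space R d)), measurable B ->
    hausdorff k (skeleton k (T w) `&` B) =
    \sum_(J : codim_set) sphere_kernel k (gr J w) B}.
Proof.
move=> fin0.
apply: filterS2 (ae_gen_position rhoT rho_perp lU) ae_overlaps => w gu H B mB.
have fg (J : codim_set) : finite_great k (gr J w) by split=> //; exact: great_gen_position.
rewrite TE skeletonE// (_ : _ `&` B =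
    \big[setU/set0]_(J : codim_set) (gr J w `&` B)); last first.
  rewrite -bigcup_seq; apply/seteqP; split => x.
    move=> [[J /= cJ gx] Bx]; have cJ' : #|J| == (d - k)%N by apply/eqP.
    by exists (Sub J cJ') => //=; rewrite mem_index_enum.
  move=> [J _ [gx Bx]]; split => //; exists (val J) => //=.
  exact/eqP/(valP J).
have mg (J : codim_set) : measurable (gr J w : set (borel_space R d)).
  exact: (measurable_great (great_gen_position J gu)).
rewrite (@measure_almost_disjoint _ _ _ (@hausdorff R d k : {measure set (borel_space R d) -> \bar R}))//.
- by apply: eq_bigr => J _; rewrite sphere_kernelE// setIC.
- exact: index_enum_uniq.
- by move=> J; exact: measurableI.
move=> I J _ _ IJ.
(* Distinct sets of the same size are not nested; the overlap then lies in the part of [gr I]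
   orthogonal to the normal of index [j], which is null. *)
have [j jJ jI] : exists2 j, j \in val J & j \notin val I.
  apply: contrapT => h; move/eqP: IJ; apply; apply: val_inj; apply/esym/eqP.
  rewrite finset.eqEcard (eqP (valP I)) (eqP (valP J)) leqnn andbT.
  by apply/fintype.subsetP => j jJ; apply: contrapT => /negP jI; apply: h; exists j.
apply/eqP; rewrite -measure_le0; have <- := H (I, j) jI.
rewrite sphere_kernelE//; apply: le_measure; rewrite ?inE.
- by apply: measurableI; apply: measurableI.
- apply: measurableI => //; apply: measurable_closed.
  have /continuous_closedP C := @continuous_dotr R d (U w j).
  exact: (C [set s | s = 0%R] (@closed_eq _ 0%R)).
by move=> x [[gx _] [[_ /mem_perpv gx'] _]]; split => //=; exact: gx'.
Qed.

(* Neither bound is computed: if one failed, the density in [v_uniform] would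
   vanish almost surely ([fine +oo = 0] and [0^-1 = 0]), and the total mass would
   be [0]. *)
Lemma omega_pos_fin : 0 < omega0 < +oo.
Proof.
have [J0] : exists J : codim_set, true.
  by have /card_gt0P[J _] := card_codim_set; exists J.
move=> _.
have contra : (\int[P]_w (hausdorff k (skeleton k (T w) `&` setT) *
        (fine (hausdorff k (skeleton k (T w))))^-1%:E) = 0) -> False.
  move=> i0; have := v_uniform measurableT measurableT.
  rewrite !preimage_setT setIT probability_setT i0 => /eqP.
  by rewrite eqe oner_eq0.
have [fin0|] := ltP omega0 +oo; last first.
  rewrite leye_eq => /eqP inf0; exfalso; apply: contra.
  rewrite (@ae_integral_congr _ _ _ _ _ _ (cst 0)) ?integral0//.
  apply: filterS (ae_gen_position rhoT rho_perp lU) => w gu _.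
  suff -> : hausdorff k (skeleton k (T w)) = +oo by rewrite /= invr0 mule0.
  apply/eqP; rewrite -leye_eq -inf0.
  rewrite -(great_subsphere_measure k_le_d (great_gen_position J0 gu)).
  apply: le_hausdorff; rewrite TE skeletonE//.
  by move=> x gx; exists (val J0) => //=; exact/eqP/(valP J0).
rewrite andbT lt0e hausdorff_ge0 andbT; apply/eqP => h0; apply: contra.
rewrite (@ae_integral_congr _ _ _ _ _ _ (cst 0)) ?integral0//.
apply: filterS2 (ae_gen_position rhoT rho_perp lU) (ae_skeleton_measure fin0).
move=> w gu H _; rewrite H// big1 ?mul0e// => J _.
by rewrite sphere_kernelT ?h0//; split => //; exact: (great_gen_position J gu).
Qed.

Local Notation omega := (fine omega0).
(** The reciprocal of the almost sure measure of the skeleton. *)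
Let c : R := ((#|{: codim_set}|)%:R * omega)^-1%R.

Let c_ge0 : (0 <= c)%R.
Proof. by rewrite invr_ge0 mulr_ge0// fine_ge0// hausdorff_ge0. Qed.

Let mK J (B : set (borel_space R d)) : measurable B ->
  measurable_fun setT (fun w => sphere_kernel k (gr J w) B).
Proof.
by move=> mB; exact: (measurableT_comp (measurable_kernel (sphere_kernel k) B mB)
  (measurable_gr J)).
Qed.

(** The random normalization in [v_uniform] is almost surely the constant [c], and the integrand
    agrees almost everywhere with a measurable one, to which linearity of the integral applies. *)
Lemma uniform_event A (B : set (borel_space R d)) : tessellation_event T A ->
  measurable B -> P (A `&` v @^-1` B) =
  c%:E * \sum_(J : codim_set) \int[P]_(w in A) sphere_kernel k (gr J w) B.
Proof.
move=> [mA [X mX AX]] mB; rewrite {1}AX v_uniform// -AX.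
have /andP[_ fin0] := omega_pos_fin.
have foo : omega0 \is a fin_num by rewrite ge0_fin_numE// hausdorff_ge0.
transitivity (\int[P]_(w in A) (c%:E * \sum_(J : codim_set) sphere_kernel k (gr J w) B)).
  apply: ae_integral_congr.
  apply: filterS2 (ae_gen_position rhoT rho_perp lU) (ae_skeleton_measure fin0).
  move=> w gu H _; rewrite H// muleC; congr (_%:E * _).
  rewrite -[skeleton k (T w)]setIT H// (eq_bigr (fun=> omega%:E)).
    rewrite sumEFin/= sumr_const -[X in (X *+ _)%R]mul1r -mulrnAl.
    by rewrite /c.
  move=> J _; rewrite sphere_kernelT ?fineK//; split => //.
  exact: (great_gen_position J gu).
have mKA J : measurable_fun A (fun w => sphere_kernel k (gr J w) B).
  exact: measurable_funTS (mK J mB).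
rewrite ge0_integralZl_EFin//.
- by rewrite ge0_integral_sum.
- by move=> w _; apply: sume_ge0.
- exact: emeasurable_sum.
Qed.

Local Notation PS := (pointed_space T).

Definition graph_measure (J : codim_set) : {measure set (Omega * borel_space R d)%type -> \bar R} :=
  kernel_graph P (sphere_kernel k) (measurable_gr J).

(** The identity, seen as a measurable map to the smaller sigma-field. *)
Let to_PS (z : Omega * borel_space R d) : PS := z.

Let measurable_to_PS : measurable_fun setT to_PS.
Proof. by move=> _ D mD; rewrite setTI; exact: (pointed_measurable_prod mD). Qed.

Let at_v (w : Omega) : PS := (w, v w).

Let measurable_at_v : measurable_fun setT at_v.
Proof.
apply: (measurableT_comp measurable_to_PS (_ : measurable_fun setT (fun w => (w, v w)))).
apply: measurable_fun_pair; first exact: measurable_id.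
exact: (measurable_funPT v).
Qed.

Let pf_at_v : {measure set PS -> \bar R}.
Proof.
unshelve refine (pushforward P at_v : {measure set PS -> \bar R}).
exact: measurable_at_v.
Defined.

Let pf_graph (J : codim_set) : {measure set PS -> \bar R}.
Proof.
unshelve refine (pushforward (graph_measure J) to_PS : {measure set PS -> \bar R}).
exact: measurable_to_PS.
Defined.

(** [msum] adds measures indexed by integers, hence the enumeration of the index sets with [J0] as
    default. *)
Let mixture (J0 : codim_set) : {measure set PS -> \bar R} :=
  mscale (NngNum c_ge0) (msum (fun i => pf_graph (nth J0 (enum {: codim_set}) i))
    #|{: codim_set}|).

Let sum_nth J0 (F : codim_set -> \bar R) :
  \sum_(i < #|{: codim_set}|) F (nth J0 (enum {: codim_set}) i) = \sum_J F J.
Proof.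
rewrite -(big_mkord xpredT (fun i => F (nth J0 (enum {: codim_set}) i))) cardE.
by rewrite -(big_nth J0 xpredT F) big_enum.
Qed.

Let mixtureE J0 D : mixture J0 D = c%:E * \sum_(J : codim_set) graph_measure J D.
Proof.
by rewrite /mixture /= /mscale /= /msum (sum_nth J0 (fun J => graph_measure J D)).
Qed.

Let joint_lawE J0 (D : set PS) : measurable D -> pf_at_v D = mixture J0 D.
Proof.
move=> mD.
have sub : event_rects T `<=` (@measurable _ PS) by exact: sub_sigma_algebra.
have rI : setI_closed (event_rects T).
  move=> _ _ [A tA [B mB <-]] [A' tA' [B' mB' <-]].
  exists (A `&` A'); first exact: tessellation_eventI.
  by exists (B `&` B'); [exact: measurableI|rewrite setXI].
have rT (i : nat) : event_rects T setT.
  exists setT; first exact: tessellation_eventT.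
  by exists setT => //; rewrite setXTT.
have rc : \bigcup_(i in [set: nat]) [set: PS] = setT by rewrite bigcup_const.
have r12 B : event_rects T B -> pf_at_v B = mixture J0 B.
  move=> [A tA [C mC <-]]; rewrite mixtureE.
  transitivity (P (A `&` v @^-1` C)); first by [].
  rewrite uniform_event//; congr (_ * _); apply: eq_bigr => J _.
  have mA : measurable A by case: tA.
  rewrite /graph_measure kernel_graphE [LHS]integral_mkcond.
  apply: eq_integral => w _; rewrite patchE.
  have [wA|wA] := boolP (w \in A).
    by rewrite in_xsectionX.
  by rewrite notin_xsectionX// measure0.
have r1 : forall i : nat, pf_at_v [set: PS] < +oo.
  by move=> _; rewrite (_ : pf_at_v _ = P setT)// probability_setT ltry.
exact: (@g_sigma_algebra_measure_unique _ R PS (event_rects T) sub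
  (fun=> setT) rT rc pf_at_v (mixture J0) rI r12 r1 D mD).
Qed.

Lemma joint_law (D : set PS) : measurable D ->
  P [set w | D (w, v w)] = c%:E * \sum_(J : codim_set) graph_measure J D.
Proof.
have /card_gt0P[J0 _] := card_codim_set.
by move=> mD; rewrite -(mixtureE J0) -joint_lawE.
Qed.

Lemma integral_joint_law (f : PS -> \bar R) : measurable_fun setT f ->
  (forall z, 0 <= f z) -> \int[P]_w f (w, v w) =
  c%:E * \sum_(J : codim_set) \int[P]_w \int[sphere_kernel k (gr J w)]_x f (w, x).
Proof.
move=> mf f0; have /card_gt0P[J0 _] := card_codim_set.
transitivity (\int[pf_at_v]_z f z).
  by rewrite /pf_at_v ge0_integral_pushforward.
transitivity (\int[mixture J0]_z f z).
  by apply: eq_measure_integral => D mD _; exact: joint_lawE.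
rewrite /mixture ge0_integral_mscale//= ge0_integral_measure_sum//.
rewrite (sum_nth J0 (fun J => \int[pf_graph J]_z f z)).
congr (_ * _); apply: eq_bigr => J _.
rewrite /pf_graph ge0_integral_pushforward// preimage_setT.
rewrite integral_kernel_graph//.
exact: (measurableT_comp mf measurable_to_PS).
Qed.

(** The number of tight constraints is read off the dimension of the face, a measurable function on
    [pointed_space], so the joint law applies. It remains to consider a point of [gr J]: almost
    everywhere it is orthogonal to the normals of [J] and to no other. *)
Lemma ae_zeros_codim : {ae P, forall w, sphere (v w : E) /\
  \dim (perpv (U w) (zeros (U w) (v w : E))) = k.+1}.
Proof.
pose G m : set (body_space R d) := [set K | convex_body K /\ dim_ge m K].
pose D : set PS := (@sphere_points _ _ _ _ T) `&` (@pointed_face _ _ _ _ _ U T) @^-1` (G k.+1 `\` G k.+2).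
have mD : measurable D.
  apply: (measurable_pointed_face d_gt0 TE U_neq0).
    exact: measurable_sphere_points.
  by apply: measurableD; exact: measurable_dim_ge.
have DE w (x : E) : D (w, x) <-> sphere x /\ \dim (perpv (U w) (zeros (U w) x)) = k.+1.
  rewrite /D /G /pointed_face /=; split=> [[[_ sx] []]|[sx dx]].
    rewrite !dim_ge_face_at// => -[_ h1] h2; split => //; apply/eqP.
    rewrite eqn_leq h1 andbT leqNgt; apply/negP => h3; apply: h2; split => //.
    exact: convex_body_face_at.
  split => //; rewrite !dim_ge_face_at// dx; split.
    by split => //; exact: convex_body_face_at.
  by move=> []; rewrite ltnn.
suff : {ae P, forall w, D (w, v w)} by apply: filterS => w /DE.
apply/negligibleP.
  have := measurable_at_v measurableT (measurableC mD).
  by rewrite setTI.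
apply: (etrans (joint_law (measurableC mD))).
rewrite big1 ?mule0// => J _; rewrite /graph_measure kernel_graphE.
rewrite (@ae_integral_congr _ _ _ _ _ _ (cst 0)) ?integral0//.
apply: filterS2 (ae_gen_position rhoT rho_perp lU) ae_overlaps => w gu H _.
have fg : finite_great k (gr J w).
  by split => //; [exact: great_gen_position|case/andP: omega_pos_fin].
set B := xsection _ _.
have mB : measurable (B : set (borel_space R d)).
  by apply: measurable_xsection; apply: pointed_measurable_prod; exact: measurableC.
have : {ae sphere_kernel k (gr J w), forall x, ~ B x}.
  have h1 : {ae sphere_kernel k (gr J w), forall x : E, gr J w x}.
    have mg : measurable (gr J w : set (borel_space R d)).
      exact: measurable_great (great_gen_position J gu).
    apply/negligibleP; first exact: measurableC.
    by rewrite /= sphere_kernelE// setICl hausdorff0.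
  have h2 : {ae sphere_kernel k (gr J w), forall x : E, forall j, j \notin val J ->
      dot (U w j : E) x != 0%R}.
    suff Hj j : {ae sphere_kernel k (gr J w), forall x : E, j \notin val J ->
        dot (U w j : E) x != 0%R}.
      exact: (@filter_forall _ _ _ _ (ae_filter_ringOfSetsType _) Hj).
    have [_|jJ] := boolP (j \in val J); first by apply: aeW.
    exists [set x : E | dot (U w j : E) x = 0%R]; split.
    - apply: measurable_closed.
      have /continuous_closedP C := @continuous_dotr R d (U w j).
      exact: (C [set s | s = 0%R] (@closed_eq _ 0%R)).
    - exact: (H (J, j) jJ).
    by move=> x /= h; apply: contrapT => h'; apply: h => _; apply/eqP.
  have FK := ae_filter_ringOfSetsType (sphere_kernel k (gr J w)).
  apply: filterS2 h1 h2 => x gx nx; rewrite /B xsectionE => nD; apply: nD; apply/DE.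
  have zJ : zeros (U w) x = val J.
    apply/finset.setP => j; rewrite finset.inE; apply/eqP/idP => [dj|jJ].
      by apply: contrapT => /negP /nx; rewrite dj eqxx.
    by case: gx => _ /mem_perpv; exact.
  split; first by case: gx.
  by rewrite zJ gu (eqP (valP J)); lia.
by move=> /negligibleP; rewrite setCK; exact.
Qed.

End pointed_law.

(** If [finite_great k G] fails, the kernel is the zero measure and everything holds almost
    everywhere; otherwise it is carried by [G]. *)
Lemma sphere_kernel_ae {R : realType} {d k : nat} (G : body_space R d) :
  {ae sphere_kernel k G, forall x : 'rV[R]_d.+1, finite_great k G /\ G x}.
Proof.
have [fG|nG] := pselect (finite_great k G); last first.
  by exists setT; split => //; rewrite sphere_kernelN.
have mG : measurable (G : set (borel_space R d)) by case: fG => gG _ _; exact: measurable_great gG.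
exists (~` (G : set (borel_space R d))); split; first exact: measurableC.
- by rewrite /= sphere_kernelE// setICl hausdorff0.
by move=> x /= h Gx; apply: h.
Qed.

(** At a point of the great subsphere the constraints of [J] are tight and amount to membership in
    it; the others, enumerated by [t], form the face of the remaining arrangement. *)
Lemma face_at_great {R : realType} {d n m : nat} (u : 'I_n -> 'rV[R]_d.+1)
    (J : {set 'I_n}) (t : 'I_m -> 'I_n) x :
  (forall i, (i \notin J) = (i \in codom t)) -> great u J x ->
  face_at u x = face_at (u \o t) x `&` great u J.
Proof.
move=> tJ [_ /mem_perpv ux]; apply/seteqP; split => y.
  move=> [sy Cy]; split; first by split => // i; exact: Cy.
  split => //; apply/mem_perpv => i iJ; have := Cy i.
  by rewrite /side ux// eqxx => /eqP.
move=> [[sy Cy] [_ /mem_perpv uy]]; split => // i.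
have [iJ|] := boolP (i \in J); first by rewrite /side ux// uy// eqxx.
by rewrite tJ => /codomP[j ->]; exact: Cy.
Qed.

(** * The two sides of the formula *)

Section body_functional.
Context {R : realType} {d : nat}.
Local Notation E := 'rV[R]_d.+1.
Context (h : body_space R d -> R)
  (h_measurable : measurable_fun (convex_body : set (body_space R d)) h)
  (h_ge0 : forall K, convex_body K -> 0 <= h K).
Local Open Scope ereal_scope.

(** Outside [convex_body] nothing is assumed of [h]; the value [0] there makes the function
    measurable and nonnegative everywhere. *)
Definition body_fun : body_space R d -> \bar R :=
  (EFin \o h) \_ (convex_body : set (body_space R d)).

Lemma body_funE K : convex_body K -> body_fun K = (h K)%:E.
Proof. by move=> bK; rewrite /body_fun patchE mem_set. Qed.

Lemma body_fun_ge0 K : 0 <= body_fun K.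
Proof.
rewrite /body_fun patchE; case: ifPn => // /set_mem bK.
by rewrite lee_fin h_ge0.
Qed.

Lemma measurable_body_fun : measurable_fun setT body_fun.
Proof.
apply/(measurable_restrictT _ _).1; first exact: measurable_convex_body.
exact/measurable_EFinP.
Qed.

(** A body is closed, so it contains [x] iff at every scale it hits a rational ball containing [x];
    this is a countable combination of rectangles. *)
Lemma measurable_incidence : measurable
  ([set z | convex_body z.1 /\ z.1 (z.2 : E)] : set (body_space R d * borel_space R d)).
Proof.
have n0 r : (0 < r.+1%:R^-1 :> R)%R by rewrite invr_gt0.
rewrite (_ : [set _ | _] = \bigcap_r \bigcup_j
    (hits (eball (ratvec j) r.+1%:R^-1) `*` (eball (ratvec j : E) r.+1%:R^-1))).
  apply: bigcapT_measurable => r; apply: bigcupT_measurable => j.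
  apply: measurableX; first by apply: measurable_hits; exact: open_eball.
  by apply: measurable_open; exact: open_eball.
apply/seteqP; split => -[G x].
  move=> [/= bG Gx] r _; have [j jx] := ratvec_dense (x : E) (n0 r).
  have xj : eball (ratvec j) r.+1%:R^-1 x by rewrite /eball/= enormB.
  by exists j => //; split => //; split => //; exists x.
move=> H; have bG : convex_body G by have [j _ [[]]] := H 0%N Logic.I.
split => //; apply: ((closed_eballP _).1 (convex_body_closed bG)) => e e0.
have e2 : (0 < e / 2)%R by rewrite divr_gt0.
have [r _ Hr] := near_infty_natSinv_lt (PosNum e2).
have /= re := Hr r (leqnn r).
have [j _ [[_ [y [Gy yj]]] xj]] := H r Logic.I.
exists y => //; rewrite /eball/= (le_lt_trans (enorm_triangle (ratvec j) _ _))//.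
rewrite (enormB (ratvec j)).
move: yj xj re; rewrite /eball/=; set c := (_^-1)%R.
by move: (enorm _) (enorm _) => p p' *; lra.
Qed.

Section great_faces.
Context (k m : nat).
Local Notation Z := ((body_space R d * @vecs R d m) * borel_space R d)%type.

Let D : set Z := [set z | great_subsphere k (z.1.1 : set E) /\ z.1.1 (z.2 : E)].

Let measurable_D : measurable D.
Proof.
have -> : D = (fun z => z.1.1) @^-1` (great_subsphere k : set (body_space R d)) `&`
   (fun z => (z.1.1, z.2)) @^-1` [set z | convex_body z.1 /\ z.1 (z.2 : E)].
  apply/seteqP; split => z; last by move=> [? []].
  by move=> [gz zz]; split => //; split => //; exact: great_subsphere_convex_body gz.
have m1 : measurable_fun setT (fun z : Z => z.1.1).
  exact: (measurableT_comp measurable_fst measurable_fst).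
apply: measurableI.
  rewrite -[X in measurable X]setTI; apply: m1 => //; exact: measurable_great_subsphere.
have m2 : measurable_fun setT (fun z : Z => (z.1.1, z.2)).
  by apply: measurable_fun_pair => //; exact: measurable_snd.
rewrite -[X in measurable X]setTI; apply: m2 => //; exact: measurable_incidence.
Qed.

Lemma convex_body_great_face (u : 'I_m -> E) (G : set E) x : great_subsphere k G -> G x ->
  convex_body (face_at u x `&` G).
Proof.
move=> [L _ ->] [sx Lx]; exists (cone_at u x `&` [set` L]); split.
- by apply: closedI; [exact: closed_cone_at|exact: vspace_closed].
- have [C0 CD] := convex_cone_at u x; split; first by split => //=; rewrite mem0v.
  move=> y z a b [Cy Ly] [Cz Lz] a0 b0; split; first exact: CD.
  by rewrite /= memvD ?memvZ.
- move=> H; have : (cone_at u x `&` [set` L]) x by split=> // i; exact: side_refl.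
  by rewrite H => /eqP; apply/negP; exact: sphere_neq0.
by apply/seteqP; split => y; rewrite /face_at /=; [move=> [[]] sy Cy []|move=> [[]]].
Qed.

Let great_face (z : Z) : body_space R d :=
  face_at (z.1.2 : 'I_m -> E) (z.2 : E) `&` z.1.1.

Let measurable_great_face : measurable_fun D great_face.
Proof.
apply: approximable_body_measurable; first exact: measurable_D.
  by move=> z [gz zz]; exact: convex_body_great_face gz zz.
have m1 : measurable_fun setT (fun z : Z => z.1.1).
  exact: (measurableT_comp measurable_fst measurable_fst).
have m2 : measurable_fun setT (fun z : Z => z.1.2).
  exact: (measurableT_comp measurable_snd measurable_fst).
apply: approximableI.
  apply: approximable_face_at; first exact: measurable_D.
    by move=> i; apply: measurable_funTS; exact: (measurableT_comp (measurable_nth i) m2).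
  by apply: measurable_funTS; exact: measurable_snd.
apply: approximable_body; first exact: measurable_D.
  by move=> z [gz _]; exact: great_subsphere_convex_body gz.
exact: measurable_funTS.
Qed.

(** The restriction to [D], where the section is known to be a body, with value [0] elsewhere, gives
    measurability on the whole product. *)
Definition face_fun : Z -> \bar R := (body_fun \o great_face) \_ D.

Lemma face_funE (G : body_space R d) (u : 'I_m -> E) (x : E) :
  great_subsphere k G -> G x ->
  face_fun ((G, u), x) = body_fun (face_at u x `&` G : set E).
Proof. by move=> gG Gx; rewrite /face_fun patchE mem_set. Qed.

Lemma face_fun_ge0 z : 0 <= face_fun z.
Proof. by rewrite /face_fun patchE; case: ifPn => // _; exact: body_fun_ge0. Qed.

Lemma measurable_face_fun : measurable_fun setT face_fun.
Proof.
apply: (measurable_restrictT (body_fun \o great_face) measurable_D).1.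
exact: (measurableT_comp measurable_body_fun measurable_great_face).
Qed.

(** The common core of both sides: great subsphere and remaining normals are fixed, and only the
    point moves. *)
Definition mean_face_fun (z : body_space R d * @vecs R d m) : \bar R :=
  \int[sphere_kernel k z.1]_x face_fun (z, x).

Lemma mean_face_fun_ge0 z : 0 <= mean_face_fun z.
Proof. by apply: integral_ge0 => x _; exact: face_fun_ge0. Qed.

Lemma measurable_mean_face_fun : measurable_fun setT mean_face_fun.
Proof.
exact: (@measurable_integral_pullback _ _ _ _ _ _ _ (sphere_kernel k) fst
  measurable_fst face_fun measurable_face_fun face_fun_ge0).
Qed.

End great_faces.
End body_functional.

(** * Reducing both sides to the same iterated integral *)

Section two_sides.
Context {R : realType} {d k n : nat} (d_gt0 : (0 < d)%N) (k_le_d : (k <= d)%N)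
  (n_ge : (d - k <= n)%N).
Local Notation E := 'rV[R]_d.+1.
Context (rho : set (borel_space R d) -> R) (rhoT : rho setT = 1)
  (rho_perp : forall x : E, sphere x -> rho [set v : E | dot v x = 0] = 0).
Context (h : body_space R d -> R)
  (h_measurable : measurable_fun (convex_body : set (body_space R d)) h)
  (h_ge0 : forall K, convex_body K -> 0 <= h K).
Context {dO2 : measure_display} {Omega2 : measurableType dO2}
  (P2 : probability Omega2 R) {m : nat} (U2 : {mfun Omega2 >-> @vecs R d m})
  (lU2 : box_law rho (distribution P2 U2)).
Local Open Scope ereal_scope.

Local Notation omega0 := (hausdorff k (ref_sphere k : set E)).

Lemma ae_gen (x : E) : sphere x -> {ae P2, forall w, gen (U2 w : 'I_m -> E) x}.
Proof.
move=> sx.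
have H : {ae P2, forall w, forall i, dot (U2 w i : E) x != 0%R}.
  suff Hi i : {ae P2, forall w, dot (U2 w i : E) x != 0%R}.
    exact: (@filter_forall _ _ _ _ (ae_filter_ringOfSetsType P2) Hi).
  exists [set w | dot (U2 w i : E) x = 0%R]; split.
  - have := measurable_dotl x (measurableT_comp (@measurable_nth R d m i) (measurable_funPT U2)).
    by move=> /(_ measurableT [set 0%R] (measurable_set1 _)); rewrite setTI.
  - exact: (coordinate_perp_null rho_perp lU2 i sx).
  by move=> w /= /negP; rewrite negbK => /eqP.
by apply: filterS H => w.
Qed.

(** For each fixed [x], almost surely no hypersphere passes through it, so its cell is the
    [face_at]. Tonelli's theorem, for the finite measure [sphere_measure k G], then brings the
    expectation outside. *)
Lemma mean_cell_section (G : body_space R d) :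
  great_subsphere k (G : set E) -> omega0 < +oo ->
  \int[hausdorff k]_(x in (G : set (borel_space R d)))
    \int[P2]_w (h (pick_at (tess (U2 w : 'I_m -> E)) (x : E) `&` G))%:E =
  \int[P2]_w mean_face_fun h k (G, U2 w).
Proof.
move=> gG fin0; have fG : finite_great k G by [].
have mG : measurable (G : set (borel_space R d)) by exact: measurable_great gG.
pose F (wx : Omega2 * borel_space R d) := face_fun h k ((G, U2 wx.1), wx.2).
have mg : measurable_fun setT
    (fun wx : Omega2 * borel_space R d => ((G, U2 wx.1), wx.2)).
  apply: measurable_fun_pair; last exact: measurable_snd.
  apply: measurable_fun_pair; first exact: measurable_cst.
  exact: (measurableT_comp (measurable_funPT U2) measurable_fst).
have mF : measurable_fun setT F.
  exact: (measurableT_comp (@measurable_face_fun _ _ h h_measurable k m) mg).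
have F0 wx : 0 <= F wx by exact: face_fun_ge0.
transitivity (\int[hausdorff k]_(x in (G : set (borel_space R d))) \int[P2]_w F (w, x)).
  apply: eq_integral => x /set_mem Gx.
  have sx : sphere (x : E) by case: gG Gx => L _ -> [].
  apply: ae_integral_congr; apply: filterS (ae_gen sx) => w gx _.
  rewrite pick_cell// /F face_funE// body_funE//.
  exact: convex_body_great_face gG Gx.
transitivity (\int[sphere_measure k G]_(x in (G : set (borel_space R d))) \int[P2]_w F (w, x)).
  apply: eq_measure_integral => A mA AG.
  by rewrite /sphere_measure/= sphere_kernelE// (setIidl AG).
transitivity (\int[sphere_measure k G]_x \int[P2]_w F (w, x)).
  rewrite [LHS]integral_mkcond; apply: ae_integral_congr.
  have FK := ae_filter_ringOfSetsType (sphere_measure k G).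
  have aeG : {ae sphere_measure k G, forall x : E, finite_great k G /\ G x}.
    exact: sphere_kernel_ae.
  apply: filterS aeG => x [_ Gx] _.
  by rewrite patchE mem_set.
transitivity (\int[P2]_w \int[sphere_measure k G]_x F (w, x)); last by [].
by rewrite fubini_tonelli.
Qed.

Context {dO1 : measure_display} {Omega1 : measurableType dO1}
  (P1 : probability Omega1 R) (U1 : {mfun Omega1 >-> @vecs R d (d - k)})
  (lU1 : box_law rho (distribution P1 U1)).
Context {dO : measure_display} {Omega : measurableType dO}
  (P : probability Omega R) (U : {mfun Omega >-> @vecs R d n})
  (lU : box_law rho (distribution P U)).
Context (T : Omega -> collection_space R d)
  (TE : forall w, T w = tess (U w : 'I_n -> E)).
Context (U_neq0 : forall w i, (U w i : E) != 0%R).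
Context (v : {RV P >-> borel_space R d}) (v_uniform : uniform_on_skeleton k T v).
Context (m_def : m = (n - (d - k))%N).

Lemma integral_great_faces (J : {set 'I_n}) : #|J| = (d - k)%N ->
  \int[P]_w \int[sphere_kernel k (great (U w) J)]_x
    body_fun h (face_at (U w : 'I_n -> E) (x : E)) =
  \int[P1]_w1 \int[P2]_w2 mean_face_fun h k (greatv (U1 w1) : body_space R d, U2 w2).
Proof.
move=> cJ; have cJ' : #|~: J| = m by have := cardsC J; rewrite card_ord; lia.
(* [sg] and [tau] enumerate [J] and its complement; the casts give them the index types of [U1] and
   [U2]. *)
pose sg i := enum_val (cast_ord (esym cJ) i).
pose tau i := enum_val (cast_ord (esym cJ') i).
have sgJ i : sg i \in J by exact: enum_valP.
have tauJ i : tau i \notin J by have := enum_valP (cast_ord (esym cJ') i); rewrite finset.inE.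
have sgI : injective sg by move=> i j /enum_val_inj /cast_ord_inj.
have tauI : injective tau by move=> i j /enum_val_inj /cast_ord_inj.
have sgtau j l : sg j != tau l by apply: contraNneq (tauJ l) => <-.
have ctau i : (i \notin J) = (i \in codom tau).
  apply/idP/codomP => [iJ|[j ->]//].
  have iC : i \in ~: J by rewrite finset.inE.
  exists (cast_ord cJ' (enum_rank_in iC i)).
  by rewrite /tau cast_ord_comp cast_ord_id enum_rankK_in.
have gJ w : greatv (subfam U sg w : 'I_(d - k) -> E) = great (U w) J.
  rewrite -great_enum_val; congr (_ `&` _); apply/seteqP; split => y H i /=.
    by have := H (cast_ord cJ i); rewrite /= /sg cast_ord_comp cast_ord_id.
  exact: H.
pose f (z : @vecs R d (d - k) * @vecs R d m) :=
  mean_face_fun h k (greatv z.1 : body_space R d, z.2).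
have mg : measurable_fun setT (fun z : @vecs R d (d - k) * @vecs R d m =>
    (greatv z.1 : body_space R d, z.2)).
  apply: measurable_fun_pair; last exact: measurable_snd.
  exact: (measurableT_comp (measurable_greatv (leq_subr k d)) measurable_fst).
have mf : measurable_fun setT f.
  exact: (measurableT_comp (@measurable_mean_face_fun _ _ h h_measurable h_ge0 k m) mg).
have f0 z : 0 <= f z by exact: mean_face_fun_ge0.
rewrite -(integral_independent_split rhoT lU lU1 lU2 sgI tauI sgtau mf f0).
apply: eq_integral => w _; rewrite /f /mean_face_fun /= gJ.
apply: ae_integral_congr.
have FK := ae_filter_ringOfSetsType (sphere_kernel k (great (U w) J)).
have aeG : {ae sphere_kernel k (great (U w) J), forall x : E,
    finite_great k (great (U w) J) /\ great (U w) J x}.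
  exact: sphere_kernel_ae.
apply: filterS aeG => x [[gG _ _] Gx] _.
by rewrite face_funE// (face_at_great ctau Gx).
Qed.

(** Every index set contributes the same term, so their number cancels against the one in the
    normalizing constant and only the reciprocal of [omega] remains. *)
Lemma mean_weighted_face :
  \int[P]_w (h (weighted_face k T v w))%:E =
  ((fine omega0)^-1)%:E * \int[P1]_w1 \int[P2]_w2
     mean_face_fun h k (greatv (U1 w1) : body_space R d, U2 w2).
Proof.
pose F : pointed_space T -> \bar R := (body_fun h \o @pointed_face _ _ _ _ _ U T) \_ (@sphere_points _ _ _ _ T).
have FE w (x : E) : sphere x -> F (w, x) = body_fun h (face_at (U w : 'I_n -> E) x).
  by move=> sx; rewrite /F patchE mem_set.
have mF : measurable_fun setT F.
  apply: (measurable_restrictT _ (@measurable_sphere_points _ _ _ _ T)).1.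
  exact: (measurableT_comp (measurable_body_fun h_measurable)
    (measurable_pointed_face d_gt0 TE U_neq0)).
have F0 z : 0 <= F z.
  by rewrite /F patchE; case: ifPn => // _; exact: body_fun_ge0.
transitivity (\int[P]_w F (w, v w)).
  apply: ae_integral_congr; apply: filterS2 (ae_gen_position rhoT rho_perp lU)
    (ae_zeros_codim d_gt0 k_le_d n_ge rhoT rho_perp lU TE U_neq0 v_uniform).
  move=> w gu [sv dv] _; rewrite FE// body_funE; last exact: convex_body_face_at.
  by rewrite /weighted_face TE (pick_face (k := k)).
rewrite (integral_joint_law d_gt0 k_le_d n_ge rhoT rho_perp lU TE v_uniform mF F0).
rewrite (eq_bigr (fun=> \int[P1]_w1 \int[P2]_w2
     mean_face_fun h k (greatv (U1 w1) : body_space R d, U2 w2))); last first.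
  move=> J _; rewrite -(integral_great_faces (eqP (valP J))).
  apply: eq_integral => w _; apply: ae_integral_congr.
  have FK := ae_filter_ringOfSetsType (sphere_kernel k (great (U w) (val J))).
  have aeG : {ae sphere_kernel k (great (U w) (val J)), forall x : E,
    finite_great k (great (U w) (val J)) /\ great (U w) (val J) x}.
  exact: sphere_kernel_ae.
apply: filterS aeG => x [_ [sx _]] _.
  exact: FE.
have c0 : (0 < #|{: @codim_set d k n}|)%N by exact: card_codim_set.
set I := \int[P1]_w1 _.
rewrite (eq_bigr (fun=> 1%:E * I)) => [|J _]; last by rewrite mul1e.
rewrite -ge0_sume_distrl// sumEFin sumr_const muleA -EFinM; congr (_%:E * _).
by rewrite invfM mulrAC mulVf ?mul1r// pnatr_eq0 -lt0n.
Qed.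

End two_sides.

Theorem theorem3p1 (R : realType) (d k n : nat)
    (d_gt0 : (0 < d)%N) (k_le_d : (k <= d)%N) (n_ge : (d - k <= n)%N)
    (kappa0 : probability (borel_space R d) R)
    (kappa0_nondegenerate : nondegenerate_direction kappa0)
    (* the tessellation T_{n,d} and the random point v *)
    (dO : measure_display) (Omega : measurableType dO)
    (P : probability Omega R)
    (S : 'I_n -> {RV P >-> body_space R d})
    (S_iid : iid_hyperspheres kappa0 S)
    (v : {RV P >-> borel_space R d})
    (v_uniform : uniform_on_skeleton k (random_tessellation S) v)
    (* the hyperspheres defining kappa_k *)
    (dO1 : measure_display) (Omega1 : measurableType dO1)
    (P1 : probability Omega1 R)
    (S1 : 'I_(d - k) -> {RV P1 >-> body_space R d})
    (S1_iid : iid_hyperspheres kappa0 S1)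
    (* the tessellation T_{n-d+k,d} *)
    (dO2 : measure_display) (Omega2 : measurableType dO2)
    (P2 : probability Omega2 R)
    (S2 : 'I_(n - (d - k)) -> {RV P2 >-> body_space R d})
    (S2_iid : iid_hyperspheres kappa0 S2)
    (h : body_space R d -> R)
    (h_measurable : measurable_fun (convex_body : set (body_space R d)) h)
    (h_ge0 : forall K, convex_body K -> 0 <= h K) :
  ('E_P[fun w => h (weighted_face k (random_tessellation S) v w)] =
   (omega R d k)^-1%:E *
   \int[intersection_law S1]_(G in (great_subsphere k : set (body_space R d)))
     \int[hausdorff k]_(x in (G : set (borel_space R d)))
       'E_P2[fun w => h (pick_at (random_tessellation S2 w) x `&` G)])%E.
Proof.
pose U := normals S_iid; pose U1 := normals S1_iid.
pose U2 := normals S2_iid.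
have rhoT := normal_lawT d_gt0 kappa0.
have rho_perp := normal_law_perp d_gt0 kappa0_nondegenerate.
have lU := normals_box_law S_iid.
have lU1 := normals_box_law S1_iid.
have lU2 := normals_box_law S2_iid.
have TE w : random_tessellation S w = tess (U w : 'I_n -> 'rV[R]_d.+1).
  by congr tessellation; apply/funext => i; case: (normalsE d_gt0 S_iid i w).
have TE2 w : random_tessellation S2 w = tess (U2 w : 'I_(n - (d - k)) -> 'rV[R]_d.+1).
  by congr tessellation; apply/funext => i; case: (normalsE d_gt0 S2_iid i w).
have U0 w i : (U w i : 'rV[R]_d.+1) != 0 by case: (normalsE d_gt0 S_iid i w).
have /andP[_ fin0] := omega_pos_fin d_gt0 k_le_d n_ge rhoT rho_perp lU TE v_uniform.
transitivity (\int[P]_w (h (weighted_face k (random_tessellation S) v w))%:E)%E.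
  by rewrite unlock.
rewrite (mean_weighted_face d_gt0 k_le_d n_ge rhoT rho_perp h_measurable h_ge0
  lU2 lU1 lU TE U0 v_uniform)//; congr (_ * _)%E.
pose g w : body_space R d := greatv (U1 w : 'I_(d - k) -> 'rV[R]_d.+1).
have mg : measurable_fun setT g.
  exact: (measurableT_comp (measurable_greatv (leq_subr k d)) (measurable_funPT U1)).
(* [intersection_law S1] is a bare set function; [law] is the same function bundled as a measure. *)
have [law lawE] : exists law : {measure set (body_space R d) -> \bar R},
    law = pushforward P1 g :> (set (body_space R d) -> \bar R).
  by unshelve eexists (pushforward P1 g : {measure set (body_space R d) -> \bar R}).
have -> : intersection_law S1 = law.
  rewrite lawE; congr pushforward; apply/funext => w; apply/seteqP.
  split=> y [sy H]; split => // i; have [SE _] := normalsE d_gt0 S1_iid i w.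
    by have := H i Logic.I; rewrite SE => -[].
  by rewrite SE; split => //; exact: H.
pose Theta (G : body_space R d) := (\int[P2]_w2 mean_face_fun h k (G, U2 w2))%E.
have mT : measurable_fun setT Theta.
  have mp : measurable_fun setT (fun z : body_space R d * Omega2 => (z.1, U2 z.2)).
    apply: measurable_fun_pair; first exact: measurable_fst.
    exact: (measurableT_comp (measurable_funPT U2) measurable_snd).
  have := measurableT_comp (@measurable_mean_face_fun _ _ h h_measurable h_ge0 k _) mp.
  by move=> /measurable_fun_fubini_tonelli_F; apply => z; exact: mean_face_fun_ge0.
have T0 G : (0 <= Theta G)%E by apply: integral_ge0 => w _; exact: mean_face_fun_ge0.
transitivity (\int[law]_(G in (great_subsphere k : set (body_space R d))) Theta G)%E; last first.
  apply: eq_integral => G /set_mem gG.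
  rewrite /Theta -(mean_cell_section d_gt0 k_le_d rho_perp h_measurable h_ge0 lU2 gG fin0).
  by apply: eq_integral => x _; rewrite unlock; apply: eq_integral => w _; rewrite TE2.
(* When [G] is not a great subsphere of dimension [k] the kernel vanishes, hence so does [Theta G],
   and the domain of integration may be enlarged. *)
transitivity (\int[law]_G Theta G)%E; last first.
  rewrite [RHS]integral_mkcond; apply: eq_integral => G _; rewrite patchE.
  case: ifPn => // /negP nG; apply: integral0_eq => w _.
  rewrite /mean_face_fun -(integral0 (sphere_kernel k G) setT).
  apply: ae_integral_congr.
  have FK := ae_filter_ringOfSetsType (sphere_kernel k G).
  have aeG : {ae sphere_kernel k G, forall x : 'rV[R]_d.+1, finite_great k G /\ G x}.
    exact: sphere_kernel_ae.
  by apply: filterS aeG => x [[gG _ _] _]; case: nG; rewrite inE.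
by rewrite lawE ge0_integral_pushforward.
Qed.
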